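(* Let $k\ge1$ be an integer. Consider the smooth nonlinear system $$\dot x=f(x,u,v),\qquad \dot v=Sv,\qquad e=h(x,v),$$ with $x\in\mathbb{R}^{n_x}$, $u\in\mathbb{R}^{n_u}$, $v\in\mathbb{R}^{n_v}$, $e\in\mathbb{R}^{n_y}$, $f(0,0,0)=0$ and $h(0,0)=0$, where $f,h$ are unknown and $S$ is known and all its eigenvalues have zero real parts. Write $$f(x,u,v)=Ax+Bu+Ev+\alpha(x,u,v),\qquad h(x,v)=Cx+Fv+\gamma(x,v),$$ where $A,B,E,C,F$ are the Jacobians $\partial f/\partial x,\partial f/\partial u,\partial f/\partial v$ at $(0,0,0)$ and $\partial h/\partial x,\partial h/\partial v$ at the origin, and $\alpha,\gamma$ are the higher-order remainders. Let $(G_1,G_2)$ be an $n_y$-copy internal model of the $k$-fold exosystem matrix $\mathcal{S}_{kf}$ (defined in the context), let $z\in\mathbb{R}^{n_z}$, $\xi=\mathrm{col}(x,z)\in\mathbb{R}^{n_\xi}$, $n_\xi=n_x+n_z$, and $$A_\xi=\begin{bmatrix} A & 0 \\ G_2C & G_1 \end{bmatrix},\quad B_\xi=\begin{bmatrix} B \\ 0 \end{bmatrix},\quad E_\xi=\begin{bmatrix} E \\ G_2F \end{bmatrix},\quad \psi(\xi,u,v)=\begin{bmatrix} \alpha(x,u,v) \\ G_2\gamma(x,v) \end{bmatrix}.$$ Let data $\{u(\tau),\xi(\tau),\dot\xi(\tau)\}_{\tau=0}^{T-1}$ be collected from $\dot\xi=A_\xi\xi+B_\xi u+E_\xi v+\psi(\xi,u,v)$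 and set $U_-=[u(0)\cdots u(T-1)]$, $\Xi_-=[\xi(0)\cdots\xi(T-1)]$, $\Xi_+=[\dot\xi(0)\cdots\dot\xi(T-1)]$, $V=[v(0)\cdots v(T-1)]$, $D=[\psi(\xi(0),u(0),v(0))\cdots\psi(\xi(T-1),u(T-1),v(T-1))]$, so that $\Xi_+=A_\xi\Xi_-+B_\xi U_-+E_\xi V+D$, with $V$ and $D$ unknown. Assume that $\begin{bmatrix} U_- \\ \Xi_- \end{bmatrix}$ has full row rank and that, for a given matrix $\Delta$, $(E_\xi V+D)(E_\xi V+D)^\top\preceq\Delta\Delta^\top$. Put $$\Psi=\begin{bmatrix} \Xi_- \\ U_- \end{bmatrix}\begin{bmatrix} \Xi_- \\ U_- \end{bmatrix}^\top,\quad \Upsilon=-\begin{bmatrix} \Xi_- \\ U_- \end{bmatrix}\Xi_+^\top,\quad \Sigma=\Xi_+\Xi_+^\top-\Delta\Delta^\top .$$ If there exist $P=P^\top\succ0$ and $Y$ such that $$\begin{bmatrix} -\Sigma & \Upsilon^\top-\begin{bmatrix} P \\ Y \end{bmatrix}^\top \\ \Upsilon-\begin{bmatrix} P \\ Y \end{bmatrix} & -\Psi \end{bmatrix}\prec0,$$ then the controller $$u=K_xx+K_zz,\qquad \dot z=G_1z+G_2e,\qquad [K_x\ \ K_z]=YP^{-1},$$ solves the $k$th-order nonlinear output regulation problem, i.e. the closed-loop system satisfies: (1) for all sufficiently small $x(0)$ and $v(0)$, the trajectory $\mathrm{col}(x(t),v(t))$ of the closed-loop system exists and is bounded for all $t\ge0$;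 (2) for all sufficiently small $x(0)$ and $v(0)$, the trajectory $\mathrm{col}(x(t),v(t))$ of the closed-loop system satisfies $$\lim_{t\to\infty}\bigl(e(t)-O(v^{(k+1)}(t))\bigr)=\lim_{t\to\infty}\bigl(h(x(t),v(t))-O(v^{(k+1)}(t))\bigr)=0,$$ where $O(v^{(k+1)})$ is such that $\lim_{v\to0}\|O(v^{(k+1)})\|/\|v\|^{k+1}$ is a finite constant.
   Context: $\mathrm{col}(\cdot)$ denotes stacking of column vectors; $M\prec0$ ($\preceq0$) means symmetric negative (semi-)definite. For $\ell\ge1$, $v^{[\ell]}$ is the column vector of all monomials of degree $\ell$ in the components of $v$ (in lexicographic order), and $v^{(\ell)}=v\otimes\cdots\otimes v$ ($\ell$ factors). Along $\dot v=Sv$ one has $\frac{d}{dt}v^{[\ell]}=S^{[\ell]}v^{[\ell]}$ with $$S^{[\ell]}=M_\ell\Bigl[\sum_{i=1}^{\ell}I_{n_v^{i-1}}\otimes S\otimes I_{n_v^{\ell-i}}\Bigr]N_\ell,$$ where $M_\ell,N_\ell$ are constant matrices with $v^{[\ell]}=M_\ell v^{(\ell)}$ and $v^{(\ell)}=N_\ell v^{[\ell]}$. The $k$-fold exosystem matrix is $\mathcal{S}_{kf}=\mathrm{blockdiag}(S^{[1]},S^{[2]},\dots,S^{[k]})$. Internal model: given a square matrix $Q$, a pair $(G_1,G_2)$ is an $n_y$-copy internal model of $Q$ if $G_1=\mathrm{blockdiag}(\beta,\dots,\beta)$ and $G_2=\mathrm{blockdiag}(\sigma,\dots,\sigma)$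 ($n_y$ blocks each), where $\beta$ is a constant square matrix whose characteristic polynomial equals the minimal polynomial of $Q$ and $\sigma$ is a constant column vector such that $(\beta,\sigma)$ is controllable.
   Formalization: Added: S is diagonalizable over C (otherwise v(t) is unbounded and (1) fails); the order condition on O(v^{(k+1)}) is boundedness of ‖O‖/‖v‖^{k+1} near 0, since the limit need not exist for n_v≥2; z(0) is also taken sufficiently small. *)

(* Defs.v *)
From HB Require Import structures.
From mathcomp Require Import all_boot all_order all_algebra.
From mathcomp Require Import mxtens complex.
From mathcomp Require Import all_classical all_reals all_analysis.

Set Implicit Arguments.
Unset Strict Implicit.
Unset Printing Implicit Defensive.

Import Order.TTheory GRing.Theory Num.Theory.
Import numFieldNormedType.Exports.

Local Open Scope classical_set_scope.
Local Open Scope ring_scope.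

(* The carriers are finite-dimensional below, so that continuity of all iterated
   directional derivatives is the usual notion of class C^m. *)
Fixpoint class_C (R : realType) (V W : normedModType R) (m : nat) (g : V -> W) :
    Prop :=
  if m is m'.+1 then
    (forall p, differentiable g p) /\ (forall d, class_C m' (fun p => 'D_d g p))
  else continuous g.

Definition smooth (R : realType) (V W : normedModType R) (g : V -> W) : Prop :=
  forall m, class_C m g.

(* Column-vector convention: entry (i, j) is the j-th partial derivative of the
   i-th component (the library's [jacobian] is its transpose, for row vectors). *)
Definition jac (R : realType) (m n : nat) (g : 'cV[R]_m -> 'cV[R]_n)
    (p : 'cV[R]_m) : 'M[R]_(n, m) :=
  \matrix_(i, j) ('D_(delta_mx j 0) g p) i 0.

Definition symmetric_mx (R : realType) (n : nat) (M : 'M[R]_n) : Prop := M^T = M.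

Definition qform (R : realType) (n : nat) (M : 'M[R]_n) (x : 'cV[R]_n) : R :=
  (x^T *m M *m x) 0 0.

Definition posdef (R : realType) (n : nat) (M : 'M[R]_n) : Prop :=
  symmetric_mx M /\ forall x : 'cV[R]_n, x != 0 -> 0 < qform M x.

Definition negdef (R : realType) (n : nat) (M : 'M[R]_n) : Prop :=
  symmetric_mx M /\ forall x : 'cV[R]_n, x != 0 -> qform M x < 0.

Definition negsemidef (R : realType) (n : nat) (M : 'M[R]_n) : Prop :=
  symmetric_mx M /\ forall x : 'cV[R]_n, qform M x <= 0.

Definition cols (R : realType) (n T : nat) (c : 'I_T -> 'cV[R]_n) : 'M[R]_(n, T) :=
  \matrix_(i, j) c j i 0.

Definition complexify (R : realType) (n : nat) (S : 'M[R]_n) : 'M[R[i]]_n :=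
  map_mx (real_complex R) S.

Definition eigenvalues_zero_real_part (R : realType) (n : nat) (S : 'M[R]_n) : Prop :=
  forall lam : R[i], eigenvalue (complexify S) lam -> complex.Re lam = 0.

(* Eigenvalues on the imaginary axis alone do not bound the solutions of v' = S v:
   for S = [[0, 1], [0, 0]], v = (c t, c) is a solution. Semisimplicity over the
   complex numbers is what makes such an exosystem neutrally stable. *)
Definition semisimple (R : realType) (n : nat) (S : 'M[R]_n) : Prop :=
  diagonalizable (complexify S).

(* All words of length l over 'I_n, in dictionary order. *)
Fixpoint words (n l : nat) : seq (seq 'I_n) :=
  if l is l'.+1 then [seq i :: w | i <- enum 'I_n, w <- words n l'] else [:: [::]].

(* A monomial of degree l is encoded by its nondecreasing word of indices;
   dictionary order on these words lists v_1^l, v_1^(l-1) v_2, and so on up to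
   v_n^l, i.e. the lexicographic order on exponents. *)
Definition monomials (n l : nat) : seq (seq 'I_n) :=
  [seq w <- words n l | sorted (fun i j : 'I_n => (i <= j)%N) w].

Definition nmon (n l : nat) : nat := size (monomials n l).

(* v^[l] *)
Definition monvec (R : realType) (n l : nat) (v : 'cV[R]_n) : 'cV[R]_(nmon n l) :=
  \col_j \prod_(i <- nth [::] (monomials n l) j) v i 0.

(* v^(l) = v (x) ... (x) v *)
Fixpoint kronpow (R : realType) (n l : nat) (v : 'cV[R]_n) : 'cV[R]_(n ^ l) :=
  if l is l'.+1 then
    castmx (esym (expnS n l'), erefl 1%N) (tensmx v (kronpow l' v))
  else const_mx 1.

Lemma kron_dim (n l : nat) (i : 'I_l) :
  (n ^ i * n * n ^ (l - i.+1) = n ^ l)%N.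
Proof. by rewrite -expnSr -expnD subnKC. Qed.

Definition kronsum (R : realType) (n l : nat) (S : 'M[R]_n) : 'M[R]_(n ^ l) :=
  \sum_(i < l) castmx (kron_dim n i, kron_dim n i)
    (tensmx (tensmx (1%:M : 'M[R]_(n ^ i)) S) (1%:M : 'M[R]_(n ^ (l - i.+1)))).

Definition conversion_mx (R : realType) (n l : nat)
    (M : 'M[R]_(nmon n l, n ^ l)) (N : 'M[R]_(n ^ l, nmon n l)) : Prop :=
  forall v : 'cV[R]_n,
    monvec l v = M *m kronpow l v /\ kronpow l v = N *m monvec l v.

(* S^[l] *)
Definition lifted (R : realType) (n l : nat) (M : 'M[R]_(nmon n l, n ^ l))
    (N : 'M[R]_(n ^ l, nmon n l)) (S : 'M[R]_n) : 'M[R]_(nmon n l) :=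
  M *m kronsum l S *m N.

Definition kfold (R : realType) (n k : nat) (M : forall l, 'M[R]_(nmon n l, n ^ l))
    (N : forall l, 'M[R]_(n ^ l, nmon n l)) (S : 'M[R]_n) :
    'M[R]_(\sum_(l < k) nmon n l.+1) :=
  \mxdiag_(l < k) lifted (M l.+1) (N l.+1) S.

(* [mxminpoly] is only available in positive dimension. *)
Definition minpoly (R : realType) (n : nat) : 'M[R]_n -> {poly R} :=
  if n is _.+1 then fun Q => mxminpoly Q else fun _ => 1.

Definition controllable (R : realType) (n : nat) (beta : 'M[R]_n)
    (sigma : 'cV[R]_n) : Prop :=
  \rank (\matrix_(i < n, j < n) (beta ^+ j *m sigma) i 0) = n.

(* Row block i of the second matrix is sigma *m e_i^T, which is
   blockdiag (sigma, ..., sigma) with its ny blocks of width 1. *)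
Variant internal_model (R : realType) (ny n : nat) (Q : 'M[R]_n) :
    forall nz : nat, 'M[R]_nz -> 'M[R]_(nz, ny) -> Prop :=
  InternalModel (nb : nat) (beta : 'M[R]_nb) (sigma : 'cV[R]_nb) of
      char_poly beta = minpoly Q & controllable beta sigma :
    internal_model Q (\mxdiag_(i < ny) beta)
      (\mxcol_(i < ny) (sigma *m (delta_mx 0 i : 'rV[R]_ny))).

(* y is continuous on [0, +oo[ and has derivative w t at every t > 0 *)
Definition evolves (R : realType) (V : normedModType R) (y w : R -> V) : Prop :=
  {within `[0 : R, +oo[, continuous y} /\ forall t : R, 0 < t -> is_derive t 1 y (w t).

Definition closed_loop (R : realType) (nx nu nv ny nz : nat)
    (f : 'cV[R]_nx * 'cV[R]_nu * 'cV[R]_nv -> 'cV[R]_nx)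
    (h : 'cV[R]_nx * 'cV[R]_nv -> 'cV[R]_ny) (S : 'M[R]_nv)
    (Kx : 'M[R]_(nu, nx)) (Kz : 'M[R]_(nu, nz))
    (G1 : 'M[R]_nz) (G2 : 'M[R]_(nz, ny))
    (x : R -> 'cV[R]_nx) (z : R -> 'cV[R]_nz) (v : R -> 'cV[R]_nv) : Prop :=
  [/\ evolves x (fun t => f (x t, Kx *m x t + Kz *m z t, v t)),
      evolves z (fun t => G1 *m z t + G2 *m h (x t, v t)) &
      evolves v (fun t => S *m v t)].

(* The initial state z0 of the dynamic compensator is part of the initial state
   of the closed loop and is taken small as well. *)
Definition bounded_trajectories (R : realType) (nx nu nv ny nz : nat)
    (f : 'cV[R]_nx * 'cV[R]_nu * 'cV[R]_nv -> 'cV[R]_nx)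
    (h : 'cV[R]_nx * 'cV[R]_nv -> 'cV[R]_ny) (S : 'M[R]_nv)
    (Kx : 'M[R]_(nu, nx)) (Kz : 'M[R]_(nu, nz))
    (G1 : 'M[R]_nz) (G2 : 'M[R]_(nz, ny)) : Prop :=
  exists2 delta : R, 0 < delta &
    forall (x0 : 'cV[R]_nx) (z0 : 'cV[R]_nz) (v0 : 'cV[R]_nv),
      `|x0| < delta -> `|z0| < delta -> `|v0| < delta ->
      (exists x z v, closed_loop f h S Kx Kz G1 G2 x z v /\
         [/\ x 0 = x0, z 0 = z0 & v 0 = v0]) /\
      (forall x z v, closed_loop f h S Kx Kz G1 G2 x z v ->
         [/\ x 0 = x0, z 0 = z0 & v 0 = v0] ->
         exists c : R, forall t : R, 0 <= t -> `|col_mx (x t) (v t)| <= c).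

(* The function o, which stands for O(v^(k+1)), is one fixed function of v,
   chosen before the initial conditions. For several exogenous variables the
   ratio |o v| / |v|^(k+1) has in general no limit at 0 (already for
   o v = v_1^2 and k = 1), so the order condition is the boundedness of this
   ratio near 0. *)
Definition kth_order_tracking (R : realType) (k nx nu nv ny nz : nat)
    (f : 'cV[R]_nx * 'cV[R]_nu * 'cV[R]_nv -> 'cV[R]_nx)
    (h : 'cV[R]_nx * 'cV[R]_nv -> 'cV[R]_ny) (S : 'M[R]_nv)
    (Kx : 'M[R]_(nu, nx)) (Kz : 'M[R]_(nu, nz))
    (G1 : 'M[R]_nz) (G2 : 'M[R]_(nz, ny)) : Prop :=
  exists o : 'cV[R]_nv -> 'cV[R]_ny,
    (exists c : R, \forall v \near nbhs (0 : 'cV[R]_nv), `|o v| <= c * `|v| ^+ k.+1) /\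
    exists2 delta : R, 0 < delta &
      forall (x : R -> 'cV[R]_nx) (z : R -> 'cV[R]_nz) (v : R -> 'cV[R]_nv),
        closed_loop f h S Kx Kz G1 G2 x z v ->
        `|x 0| < delta -> `|z 0| < delta -> `|v 0| < delta ->
        (h (x t, v t) - o (v t)) @[t --> +oo] --> (0 : 'cV[R]_ny).

Definition solves_output_regulation (R : realType) (k nx nu nv ny nz : nat)
    (f : 'cV[R]_nx * 'cV[R]_nu * 'cV[R]_nv -> 'cV[R]_nx)
    (h : 'cV[R]_nx * 'cV[R]_nv -> 'cV[R]_ny) (S : 'M[R]_nv)
    (Kx : 'M[R]_(nu, nx)) (Kz : 'M[R]_(nu, nz))
    (G1 : 'M[R]_nz) (G2 : 'M[R]_(nz, ny)) : Prop :=
  bounded_trajectories f h S Kx Kz G1 G2 /\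
  kth_order_tracking k f h S Kx Kz G1 G2.

(* Main.v *)
(** With [K = Y P^-1], testing the LMI on vectors [(x, - Z^T x)],
    [Z = [A_xi B_xi]], makes the data cancel and shows that
    [A_cl = A_xi + B_xi K] satisfies the Lyapunov inequality
    [A_cl P + P A_cl^T < 0]. Since [S] is semisimple with imaginary spectrum, it
    preserves a positive definite form, so that all its trajectories are bounded
    on the whole line.

    No center manifold theorem is needed. After saturation of the nonlinearity
    near the origin the closed loop is a contraction, and for each [v] there is
    exactly one bounded solution [xi : R -> R^n] driven by the exosystem
    trajectory through [v]; its value at time 0 defines an invariant graph
    [xi = pi v] which attracts all small trajectories exponentially. The function
    [O(v^(k+1))] of the theorem is [o v = h (pi v, v)].

    To see that [o] has order [k + 1], solve the invariance equation
    degree by degree: the Sylvester equations [X K_l - A_cl X = Q], [K_l] the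
    Kronecker sum of [l] copies of [S], are solvable because a solution of the
    homogeneous equation yields bounded solutions of [y' = A_cl y] on the whole
    line. The polynomial of degree [k] so obtained differs from [pi] by
    [O(v^(k+1))]. The lower block row of its degree [l] part reads
    [Z K_l - G1 Z = G2 Gamma] on the vectors [v^(l)], [Gamma] being the degree [l]
    part of the error. The minimal polynomial of the k-fold exosystem matrix
    annihilates [K_l] on these vectors and equals the characteristic polynomial of
    [beta], so by Cayley-Hamilton and controllability of [(beta, sigma)] the
    vectors [Gamma v^(l)] vanish for [1 <= l <= k]. *)

Require Import Defs.
From HB Require Import structures.
From mathcomp Require Import all_boot all_order all_algebra.
From mathcomp Require Import mxtens complex.
From mathcomp Require Import all_classical all_reals all_analysis.
From mathcomp Require Import ring lra zify.

Set Implicit Arguments.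
Unset Strict Implicit.
Unset Printing Implicit Defensive.

Import Order.TTheory GRing.Theory Num.Theory.
Import numFieldNormedType.Exports.

Local Open Scope classical_set_scope.
Local Open Scope ring_scope.


(** * Matrix norms and derivatives of curves *)

(** The map [pi] comes without any smoothness, so its expansion cannot be read off from derivatives.
    Orders are obtained by comparison instead: a polynomial [p] that solves the invariance equation
    up to a defect of order [k + 1] is nearly a solution on the whole time line, because
    [|w t| <= c * |w s|] for all [s] and [t] along the exosystem, so that a defect small at one time
    is small at all times; contraction turns it into a bound on [pi - p]. One inequality,
    [lyapunov_for], serves throughout: the pullback construction of [pi], uniqueness, attraction,
    approximation and injectivity of the Sylvester operator. Two mismatches shape the rest. The
    vectors [v^(l)] span only the symmetric tensors, whereas the Kronecker sum acts on all of them: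
    Sylvester equations are tested on products of distinct flows, the internal model only on the
    span of the powers. And the closed loop coincides with the saturated system only near the
    origin, with derivatives given for positive times only: a sublevel set of the Lyapunov function
    has to be shown to trap it first. *)

Lemma mx_entry_le (R : realType) m n (A : 'M[R]_(m, n)) i j : `|A i j| <= `|A|.
Proof.
rewrite [leRHS]/Num.Def.normr/= mx_normrE.
exact: (le_bigmax _ (fun ij : 'I_m * 'I_n => `|A ij.1 ij.2|) (i, j)).
Qed.

Lemma mx_norm_le (R : realType) m n (A : 'M[R]_(m, n)) c :
  0 <= c -> (forall i j, `|A i j| <= c) -> `|A| <= c.
Proof.
move=> c0 Ac; rewrite [leLHS]/Num.Def.normr/= mx_normrE.
by apply: bigmax_le => // -[i j] _; exact: Ac.
Qed.

(** The norm is the largest absolute value of an entry; the factor [n] counts the summands of one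
    entry of the product. *)
Lemma mulmx_norm_le (R : realType) m n p (A : 'M[R]_(m, n)) (B : 'M[R]_(n, p)) :
  `|A *m B| <= n%:R * `|A| * `|B|.
Proof.
apply: mx_norm_le => [|i j]; first by rewrite !mulr_ge0.
rewrite mxE (le_trans (ler_norm_sum _ _ _))//.
apply: (@le_trans _ _ (\sum_(k < n) `|A| * `|B|)).
  by apply: ler_sum => k _; rewrite normrM ler_pM// mx_entry_le.
by rewrite sumr_const card_ord -[X in X <= _]mulr_natl mulrA.
Qed.

Lemma trmx_norm (R : realType) m n (A : 'M[R]_(m, n)) : `|A^T| = `|A|.
Proof.
apply/eqP; rewrite eq_le; apply/andP; split; apply: mx_norm_le => // i j.
  by rewrite mxE mx_entry_le.
by have := mx_entry_le A^T j i; rewrite mxE.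
Qed.

Lemma col_mx_norm_le (R : realType) m n p (A : 'M[R]_(m, p)) (B : 'M[R]_(n, p)) c :
  `|A| <= c -> `|B| <= c -> `|col_mx A B| <= c.
Proof.
move=> Ac Bc; apply: mx_norm_le => [|i j]; first exact: le_trans Ac.
by rewrite mxE; case: splitP => k _; [apply: le_trans Ac|apply: le_trans Bc];
  exact: mx_entry_le.
Qed.

Lemma usubmx_norm_le (R : realType) m n p (A : 'M[R]_(m + n, p)) :
  `|usubmx A| <= `|A|.
Proof. by apply: mx_norm_le => // i j; rewrite mxE mx_entry_le. Qed.

Lemma dsubmx_norm_le (R : realType) m n p (A : 'M[R]_(m + n, p)) :
  `|dsubmx A| <= `|A|.
Proof. by apply: mx_norm_le => // i j; rewrite mxE mx_entry_le. Qed.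

Section derive_curve.
Context {R : realType}.

Lemma is_derive_mxP (V : normedModType R) m n (y : V -> 'M[R]_(m, n)) t d w :
  is_derive t d y w <-> forall i j, is_derive t d (fun s => y s i j) (w i j).
Proof.
split=> [[dy yw] i j|H].
  have dyij := (derivable_mxP y t d).1 dy i j.
  by apply: DeriveDef => //; rewrite -yw derive_mx// mxE.
have dy : derivable y t d by apply/derivable_mxP => i j; case: (H i j).
apply: DeriveDef => //; rewrite derive_mx//; apply/matrixP => i j.
by rewrite mxE; case: (H i j).
Qed.

Lemma is_derive_continuous (V : normedModType R) (y : R -> V) (t : R) w :
  is_derive t 1 y w -> {for t, continuous y}.
Proof. by case=> dy _; apply/differentiable_continuous/derivable1_diffP. Qed.

Lemma is_deriveM_fun (V : normedModType R) (f g : V -> R) t d a b :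
  is_derive t d f a -> is_derive t d g b ->
  is_derive t d (fun s => f s * g s) (a * g t + f t * b).
Proof.
move=> fa gb; have := @is_deriveM _ _ f g t d a b fa gb.
by rewrite addrC /GRing.scale/= (mulrC (g t)).
Qed.

Lemma is_deriveD_fun (V W : normedModType R) (f g : V -> W) t d a b :
  is_derive t d f a -> is_derive t d g b ->
  is_derive t d (fun s => f s + g s) (a + b).
Proof. exact: is_deriveD. Qed.

Lemma is_deriveB_fun (V W : normedModType R) (f g : V -> W) t d a b :
  is_derive t d f a -> is_derive t d g b ->
  is_derive t d (fun s => f s - g s) (a - b).
Proof. exact: is_deriveB. Qed.

Lemma is_deriveN_fun (V W : normedModType R) (f : V -> W) t d a :
  is_derive t d f a -> is_derive t d (fun s => - f s) (- a).
Proof. exact: is_deriveN. Qed.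

Lemma is_deriveZ_fun (V : normedModType R) (c : R) (f : V -> R) t d a :
  is_derive t d f a -> is_derive t d (fun s => c * f s) (c * a).
Proof. exact: is_deriveZ. Qed.

Lemma is_derive_sum_fun (V W : normedModType R) n (f : 'I_n -> V -> W) t d a :
  (forall i, is_derive t d (f i) (a i)) ->
  is_derive t d (fun s => \sum_i f i s) (\sum_i a i).
Proof.
move=> fa; have -> : (fun s => \sum_i f i s) = \sum_i f i.
  by apply/funext => s; rewrite fct_sumE.
exact: is_derive_sum.
Qed.

Lemma is_derive_mulmxl (V : normedModType R) m n p (A : 'M[R]_(m, n))
    (y : V -> 'M[R]_(n, p)) t d w :
  is_derive t d y w -> is_derive t d (fun s => A *m y s) (A *m w).
Proof.
move=> /is_derive_mxP dy; apply/is_derive_mxP => i j.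
under eq_fun do rewrite mxE.
by rewrite mxE; apply: is_derive_sum_fun => k; exact: is_deriveZ_fun.
Qed.

Lemma is_derive_dot n (x y : R -> 'cV[R]_n) (t : R) dx dy :
  is_derive t 1 x dx -> is_derive t 1 y dy ->
  is_derive t 1 (fun s => ((x s)^T *m y s) 0 0) ((dx^T *m y t) 0 0 + ((x t)^T *m dy) 0 0).
Proof.
move=> /is_derive_mxP Hx /is_derive_mxP Hy.
under eq_fun do rewrite mxE; rewrite !mxE -big_split/=.
apply: is_derive_sum_fun => k; rewrite !mxE.
under eq_fun do rewrite mxE; exact: is_deriveM_fun.
Qed.

Lemma is_derive_qform n (M : 'M[R]_n) (y : R -> 'cV[R]_n) (t : R) w :
  symmetric_mx M -> is_derive t 1 y w ->
  is_derive t 1 (fun s => qform M (y s)) (2 * ((y t)^T *m M *m w) 0 0).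
Proof.
move=> sM dy; have H := is_derive_dot dy (is_derive_mulmxl M dy).
rewrite /qform; under eq_fun do rewrite -mulmxA.
apply: is_derive_eq H _.
(* Transposing the first 1 by 1 term turns it into the second one, as [M] is symmetric; hence the
   factor 2. *)
rewrite mulmxA -[X in X + _](_ : (w^T *m (M *m y t))^T 0 0 = _); last by rewrite mxE.
by rewrite !trmx_mul trmxK sM mulrDl mul1r.
Qed.

Lemma is_derive_shift_fun (V : normedModType R) (y : R -> V) (t t0 : R) w :
  is_derive (t + t0) 1 y w -> is_derive t 1 (fun s => y (s + t0)) w.
Proof.
have E : (fun h : R => h^-1 *: (((fun s => y (s + t0)) \o shift t) (h *: 1) - y (t + t0)))
    = (fun h => h^-1 *: ((y \o shift (t + t0)) (h *: 1) - y (t + t0))).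
  by apply/funext => h /=; rewrite addrA.
by case=> dy yw; split; [rewrite /derivable E|rewrite -yw /derive E].
Qed.

End derive_curve.

(** * Gronwall estimates for scalar functions *)

Section scalar_comparison.
Context {R : realType}.
Implicit Types (f g : R -> R) (a b c t : R).

(** Mean value theorem for [f - g]. Derivatives are required in the open interval only, because
    [evolves] provides none at time 0. *)
Lemma derive_le_diff f g df dg (s t : R) : s <= t ->
  {within `[s, t], continuous f} -> {within `[s, t], continuous g} ->
  (forall r, s < r < t -> is_derive r 1 f (df r)) ->
  (forall r, s < r < t -> is_derive r 1 g (dg r)) ->
  (forall r, s < r < t -> df r <= dg r) ->
  f t - f s <= g t - g s.
Proof.
move=> st cf cg Hf Hg fg.
move: st; rewrite le_eqVlt => /predU1P[-> *|st]; first by rewrite !subrr.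
have [||c] := @MVT R (fun r => f r - g r) (fun r => df r - dg r) s t st.
- by move=> r; rewrite in_itv => rst; exact: is_deriveB_fun (Hf r rst) (Hg r rst).
- by move=> r; apply: cvgB; [exact: cf|exact: cg].
rewrite in_itv/= => /fg fgc fgst.
have : (df c - dg c) * (t - s) <= 0 by rewrite mulr_le0_ge0 ?subr_le0// subr_ge0 ltW.
by rewrite -fgst; lra.
Qed.

Lemma is_derive_expR_fun (a t : R) :
  is_derive t 1 (fun s => expR (a * s)) (a * expR (a * t)).
Proof.
have H : is_derive t 1 (fun s : R => a * s) a.
  by have := is_deriveZ_fun a (is_derive_id t 1); rewrite mulr1.
have := @is_derive1_comp R expR (fun s => a * s) t _ _ (is_derive_expR _) H.
by rewrite mulrC.
Qed.

(* Gronwall: [expR (a t) (phi t - b / a)] is nonincreasing. *)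
Lemma decay_le_itv (phi dphi : R -> R) (a b t0 t : R) : a != 0 -> t0 <= t ->
  {within `[t0, t], continuous phi} ->
  (forall s, t0 < s < t -> is_derive s 1 phi (dphi s)) ->
  (forall s, t0 < s < t -> dphi s <= - a * phi s + b) ->
  phi t <= expR (- a * (t - t0)) * (phi t0 - b / a) + b / a.
Proof.
move=> a0 t0t cphi dphiE dphi_le.
pose f s := expR (a * s) * (phi s - b / a).
have df s : t0 < s < t ->
    is_derive s 1 f (a * expR (a * s) * (phi s - b / a) + expR (a * s) * dphi s).
  move=> t0s; apply: is_deriveM_fun; first exact: is_derive_expR_fun.
  have := is_deriveB_fun (dphiE _ t0s) (is_derive_cst (b / a) s 1).
  by rewrite subr0.
have cf : {within `[t0, t], continuous f}.
  move=> s; apply: cvgM; last by apply: cvgB; [exact: cphi|exact: cvg_cst].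
  have : {within `[t0, t], continuous (fun s : R => expR (a * s))}.
    apply: continuous_subspaceT => r.
    exact: (is_derive_continuous (is_derive_expR_fun a r)).
  exact.
have := @derive_le_diff f (cst 0) _ (fun=> 0) t0 t t0t cf (fun s => cvg_cst _)
  df (fun r _ => is_derive_cst _ _ _) _.
have -> : expR (- a * (t - t0)) = expR (a * t0) / expR (a * t).
  by rewrite -expRB; congr expR; ring.
rewrite subrr subr_le0 /f => H.
rewrite -lerBlDr mulrAC ler_pdivlMr ?expR_gt0// mulrC; apply: H.
move=> r t0r; rewrite /= -mulrA mulrCA -mulrDr mulr_ge0_le0 ?expR_ge0//.
by have := dphi_le _ t0r; rewrite mulrBr mulrCA divff// mulr1; lra.
Qed.

Lemma decay_le (phi dphi : R -> R) (a b t0 : R) : 0 < a ->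
  {within `[t0, +oo[, continuous phi} ->
  (forall t, t0 < t -> is_derive t 1 phi (dphi t)) ->
  (forall t, t0 < t -> dphi t <= - a * phi t + b) ->
  forall t, t0 <= t -> phi t <= expR (- a * (t - t0)) * (phi t0 - b / a) + b / a.
Proof.
move=> a0 cphi dphiE dphi_le t t0t.
apply: (@decay_le_itv phi dphi) => //; first by rewrite gt_eqF.
- by apply: continuous_subspaceW cphi => s; rewrite /= !in_itv/= => /andP[->].
- by move=> s /andP[? _]; exact: dphiE.
- by move=> s /andP[? _]; exact: dphi_le.
Qed.

(** On the whole line the starting time of the decay estimate can recede to minus infinity. The a
    priori upper bound on [phi] then makes the transient vanish. Uniqueness of bounded solutions and
    injectivity of the Sylvester operator rest on this. *)
Lemma bounded_decay_le (phi dphi : R -> R) (a b : R) : 0 < a ->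
  (forall t, is_derive t 1 phi (dphi t)) ->
  (forall t, dphi t <= - a * phi t + b) ->
  (exists c, forall t, phi t <= c) ->
  forall t, phi t <= b / a.
Proof.
move=> a0 dphiE dphi_le [c phic] t.
have H t0 : t0 <= t -> phi t <= expR (- a * (t - t0)) * (c - b / a) + b / a.
  move=> t0t; apply: (le_trans (@decay_le phi dphi a b t0 a0 _ _ _ t t0t)) => //.
    by apply: continuous_subspaceT => s; exact: is_derive_continuous (dphiE s).
  by rewrite lerD2r ler_wpM2l ?expR_ge0// lerD2r.
rewrite leNgt; apply/negP => lt_phi.
set d := phi t - b / a; have d0 : 0 < d by rewrite subr_gt0.
set K := c - b / a.
have K0 : 0 < K by apply: lt_le_trans d0 _; rewrite lerD2r.
(* If [phi t] exceeded [b / a] by [d], starting [K / d / a] earlier would give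
   [d * expR (K / d) <= K], against [expR u >= 1 + u]. *)
have xt : t - K / d / a <= t by rewrite gerBl !divr_ge0// ltW.
have := H _ xt; rewrite -lerBlDr -/d -/K opprB addrCA subrr addr0 mulNr.
rewrite mulrCA divff ?gt_eqF// mulr1 expRN -ler_pdivrMl ?invr_gt0 ?expR_gt0//.
rewrite invrK; apply/negP; rewrite -ltNge.
apply: (@lt_le_trans _ _ ((1 + K / d) * d)); last by rewrite ler_pM2r// expR_ge1Dx.
by rewrite mulrDl mul1r divfK ?gt_eqF// ltrDr.
Qed.

End scalar_comparison.

(** * Barriers, antiderivatives and initial value problems *)

Section barrier.
Context {R : realType}.

Lemma within_continuous_dist (V : normedModType R) (A : set R) (f : R -> V) (x e : R) :
  {within A, continuous f} -> A x -> 0 < e ->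
  exists2 d : R, 0 < d & forall y, A y -> `|y - x| < d -> `|f y - f x| < e.
Proof.
move=> /subspace_continuousP cf Ax e0.
have /cvgrPdist_lt/(_ _ e0) := cf x Ax; rewrite near_withinE.
move=> /nbhs_ballP[d /= d0 H]; exists d => // y Ay yx.
rewrite distrC; apply: H => //; by rewrite /ball/= distrC.
Qed.

(** The differential inequality is available only below the level [rho]. Let [tau] be the supremum
    of the times up to which [phi] stays below it: Gronwall on [[0, tau]] bounds [phi tau] by a
    convex combination of [phi 0] and [b / a], which is again below [rho], and continuity carries
    the bound beyond [tau]. *)
Lemma barrier (phi dphi : R -> R) (a b rho : R) : 0 < a ->
  {within `[0, +oo[, continuous phi} ->
  (forall t : R, 0 < t -> is_derive t 1 phi (dphi t)) ->
  (forall t, 0 < t -> phi t < rho -> dphi t <= - a * phi t + b) ->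
  phi 0 < rho -> b / a < rho ->
  forall t, 0 <= t -> phi t < rho.
Proof.
move=> a0 cphi dphiE dphi_le phi0 ba t1 t10.
pose B := [set s : R | 0 <= s <= t1 /\ forall r, 0 <= r <= s -> phi r < rho].
have B0 : B 0.
  split=> [|r]; first by rewrite lexx.
  by rewrite -eq_le => /eqP <-.
have ub1 : ubound B t1 by move=> s [/andP[]].
have supB : has_sup B by split; [exists 0|exists t1].
set tau := sup B.
have tau0 : 0 <= tau by exact: (sup_upper_bound supB).
have taut1 : tau <= t1 := ge_sup supB.1 ub1.
have lttau r : 0 <= r < tau -> phi r < rho.
  move=> /andP[r0 rtau]; have tr0 : 0 < tau - r by rewrite subr_gt0.
  have [s [_ Bs] rs] := sup_adherent tr0 supB.
  by apply: Bs; rewrite r0 ltW//; move: rs; rewrite subKr.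
have phitau : phi tau < rho.
  have [<-|tau_neq0] := eqVneq 0 tau; first by [].
  have tau_gt0 : 0 < tau by rewrite lt_neqAle tau_neq0.
  have e1 : expR (- a * (tau - 0)) <= 1.
    by rewrite subr0 -[leRHS]expR0 ler_expR mulNr oppr_le0 mulr_ge0// ltW.
  have e0 := expR_gt0 (- a * (tau - 0)).
  apply: le_lt_trans (@decay_le_itv _ phi dphi a b 0 tau (lt0r_neq0 a0) tau0 _ _ _) _.
  - apply: continuous_subspaceW cphi => s; rewrite /= !in_itv/= andbT.
    by move=> /andP[].
  - by move=> s /andP[/dphiE].
  - by move=> s /andP[s0 stau]; apply: dphi_le => //; rewrite lttau// ltW.
  - by nra.
have [taut|] := ltrP tau t1; last first.
  by move=> t1tau; have <- : tau = t1 by apply/eqP; rewrite eq_le taut1.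
have rho0 : 0 < rho - phi tau by rewrite subr_gt0.
have Atau : `[0, +oo[%classic tau by rewrite /= in_itv/= andbT.
have [d d0 Hd] := within_continuous_dist cphi Atau rho0.
pose s := Num.min (tau + d / 2) t1.
have taus : tau < s by rewrite lt_min taut andbT ltrDl divr_gt0.
suff /(sup_upper_bound supB) : B s by rewrite leNgt taus.
split=> [|r /andP[r0]]; first by rewrite (ltW (le_lt_trans tau0 taus)) ge_min lexx orbT.
rewrite le_min => /andP[rtau _].
have [?|taur] := ltrP r tau; first by apply: lttau; rewrite r0.
have Ar : `[0, +oo[%classic r by rewrite /= in_itv/= andbT.
suff /(Hd r Ar)/ltr_normlW : `|r - tau| < d by rewrite ltrD2r.
rewrite ger0_norm ?subr_ge0//; move: rtau; lra.
Qed.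

End barrier.

Section antiderivative.
Context {R : realType}.
Notation mu := (@lebesgue_measure R).

Lemma antiderivative_itv (f : R -> R) (a b : R) : continuous f ->
  exists F : R -> R, forall x : R, a < x < b -> is_derive x 1 F (f x).
Proof.
move=> cf; exists (fun x => \int[mu]_(t in [set` `[a, x]]) f t)%R.
move=> x /andP[ax xb].
have [|] := @continuous_FTC1_closed R f a x b xb _ ax (cf x).
  apply: continuous_compact_integrable; first exact: segment_compact.
  by apply: continuous_subspaceT => t; exact: cf.
by rewrite derive1E => dF Fx; exact: DeriveDef dF Fx.
Qed.

Lemma eq_derive_diff (F G f : R -> R) (s t : R) : s <= t ->
  (forall r, s <= r <= t -> is_derive r 1 F (f r)) ->
  (forall r, s <= r <= t -> is_derive r 1 G (f r)) ->
  F t - F s = G t - G s.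
Proof.
move=> st HF HG.
have cts H : (forall r, s <= r <= t -> is_derive r 1 H (f r)) ->
    {within `[s, t], continuous H}.
  move=> HH; apply/subspace_continuousP => r; rewrite /= in_itv/= => /HH dH.
  by apply: cvg_within_filter; exact: is_derive_continuous dH.
have oc (r : R) : s < r < t -> s <= r <= t by move=> /andP[/ltW-> /ltW->].
have H1 := derive_le_diff st (cts F HF) (cts G HG)
  (fun r h => HF r (oc r h)) (fun r h => HG r (oc r h)) (fun r _ => lexx (f r)).
have H2 := derive_le_diff st (cts G HG) (cts F HF)
  (fun r h => HG r (oc r h)) (fun r h => HF r (oc r h)) (fun r _ => lexx (f r)).
by apply/eqP; rewrite eq_le H1.
Qed.

(** An integral primitive has a finite lower endpoint. Primitives on the growing intervals are
    normalised to vanish at 0, which forces them to agree on overlaps, and are then glued. *)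
Lemma antiderivative (f : R -> R) : continuous f ->
  exists2 F : R -> R, F 0 = 0 & forall x : R, is_derive x 1 F (f x).
Proof.
move=> cf.
have /choice[F FP] (n : nat) : exists F : R -> R, F 0 = 0 /\
    forall x : R, `|x| < n.+1%:R -> is_derive x 1 F (f x).
  have [F FP] := @antiderivative_itv f (- n.+1%:R) n.+1%:R cf.
  exists (fun x => F x - F 0); split=> [|x]; first by rewrite subrr.
  rewrite ltr_norml => /FP dF.
  by have := is_deriveB_fun dF (is_derive_cst (F 0) x 1); rewrite subr0.
have FE n m x : `|x| < n.+1%:R -> `|x| < m.+1%:R -> F n x = F m x.
  wlog nm : n m / (n <= m)%N.
    by move=> H nx mx; have [/H->//|/ltnW/H->] := leqP n m.
  move=> xn _.
  have lt_norm_m y : `|y| <= `|x| -> `|y| < n.+1%:R /\ `|y| < m.+1%:R.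
    by move=> yx; have ynx := le_lt_trans yx xn; split=> //;
      apply: lt_le_trans ynx _; rewrite ler_nat.
  have [x0|x0] := lerP 0 x.
    have lt_r r : 0 <= r <= x -> `|r| < n.+1%:R /\ `|r| < m.+1%:R.
      by move=> /andP[r0 rx]; apply: lt_norm_m; rewrite !ger0_norm.
    have : F n x - F n 0 = F m x - F m 0.
      by apply: (eq_derive_diff x0) => r /lt_r[rn rm]; [exact: (FP n).2|exact: (FP m).2].
    by rewrite (FP n).1 (FP m).1 !subr0.
  have lt_r r : x <= r <= 0 -> `|r| < n.+1%:R /\ `|r| < m.+1%:R.
    by move=> /andP[rx r0]; apply: lt_norm_m; rewrite !ler0_norm ?lerN2// ltW.
  have : F n 0 - F n x = F m 0 - F m x.
    apply: (eq_derive_diff (ltW x0)) => r /lt_r[rn rm];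
      by [exact: (FP n).2|exact: (FP m).2].
  by rewrite (FP n).1 (FP m).1 !sub0r => /oppr_inj.
pose N (x : R) := Num.truncn `|x|.
have ltN x : `|x| < (N x).+1%:R by exact: truncnS_gt.
exists (fun x => F (N x) x) => [|x]; first by rewrite (FP _).1.
have := (FP (N x)).2 x (ltN x); apply: near_eq_is_derive.
have : \forall y \near x, `|y| < (N x).+1%:R.
  by have /cvgr_lt := @norm_continuous R R x; apply; exact: ltN.
by apply: filterS => y yx; exact: FE.
Qed.

End antiderivative.

Section picard.
Context {R : realType}.

(** The explicit rate survives in the limit; the Picard iteration and the pullback construction both
    use the error at a given index. *)
Lemma cauchy_limit n (u : nat -> 'cV[R]_n) (eps : nat -> R) :
  (forall i j, (i <= j)%N -> `|u j - u i| <= eps i) ->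
  (eps i @[i --> \oo] --> (0 : R)) ->
  exists l, forall i, `|l - u i| <= eps i.
Proof.
move=> ueps eps0.
have cu : cvg (u @ \oo).
  apply/cauchy_cvgP/cauchyP => e e0.
  have /cvgrPdist_lt/(_ _ e0)[N _ HN] := eps0.
  exists (u N); exists N => // i /= Ni; rewrite -ball_normE/= distrC.
  apply: le_lt_trans (ueps _ _ Ni) _.
  by have := HN N (leqnn N); rewrite /= sub0r normrN; apply: le_lt_trans (ler_norm _).
exists (lim (u @ \oo)) => i.
have cn : `|u j - u i| @[j --> \oo] --> `|lim (u @ \oo) - u i|.
  by apply: cvg_norm; apply: cvgB => //; exact: cvg_cst.
rewrite -(cvg_lim _ cn)//; apply: limr_le; first by apply/cvg_ex; eexists; exact: cn.
by exists i => // j ij; exact: ueps.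
Qed.

Lemma vector_antiderivative n (f : R -> 'cV[R]_n) (y0 : 'cV[R]_n) : continuous f ->
  exists F : R -> 'cV[R]_n, F 0 = y0 /\ forall x : R, is_derive x 1 F (f x).
Proof.
move=> cf.
have /choice[F FP] (i : 'I_n) : exists F : R -> R, F 0 = 0 /\
    forall x : R, is_derive x 1 F (f x i 0).
  have [|F F0 FP] := @antiderivative R (fun x => f x i 0); last by exists F.
  by move=> x; exact: (continuous_comp (cf x) (@coord_continuous R n 1 i 0 (f x))).
exists (fun x => y0 + \col_i F i x); split=> [|x].
  by apply/matrixP => i j; rewrite ord1 !mxE (FP i).1 addr0.
apply/is_derive_mxP => i j; rewrite ord1.
under eq_fun do rewrite !mxE.
have := is_deriveD_fun (is_derive_cst (y0 i 0) x 1) ((FP i).2 x).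
by rewrite add0r.
Qed.

(** Integration from 0 reproduces the weight [expR (b * |x|)] with gain [1 / b]. A large [b] thus
    makes the integral operator a contraction on the whole line at once, with no patching of short
    intervals. *)
Lemma exp_primitive_bound (F f : R -> R) (b c : R) : 0 < b -> 0 <= c -> F 0 = 0 ->
  (forall x : R, is_derive x 1 F (f x)) ->
  (forall x, `|f x| <= c * expR (b * `|x|)) ->
  forall x, `|F x| <= c / b * expR (b * `|x|).
Proof.
move=> b0 c0.
have half (G g : R -> R) : G 0 = 0 -> (forall x : R, is_derive x 1 G (g x)) ->
    (forall x, 0 <= x -> g x <= c * expR (b * x)) ->
    forall x, 0 <= x -> G x <= c / b * expR (b * x).
  move=> G0 Gg gc x x0.
  have dE (y : R) : is_derive y 1 (fun s => c / b * expR (b * s)) (c * expR (b * y)).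
    have := is_deriveZ_fun (c / b) (is_derive_expR_fun b y).
    by rewrite mulrA divfK ?gt_eqF.
  have cts (H h : R -> R) : (forall y : R, is_derive y 1 H (h y)) ->
      {within `[0, x], continuous H}.
    by move=> dH; apply: continuous_subspaceT => y; exact: is_derive_continuous (dH y).
  have := derive_le_diff x0 (cts _ _ Gg) (cts _ _ dE) (fun r _ => Gg r) (fun r _ => dE r).
  rewrite G0 subr0 mulr0 expR0 mulr1 => H; apply: le_trans (H _) _.
    by move=> r /andP[/ltW r0 _]; exact: gc.
  by rewrite gerBl divr_ge0// ltW.
have both (G g : R -> R) : G 0 = 0 -> (forall x : R, is_derive x 1 G (g x)) ->
    (forall x, 0 <= x -> `|g x| <= c * expR (b * x)) ->
    forall x, 0 <= x -> `|G x| <= c / b * expR (b * x).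
  move=> G0 Gg gc x x0; rewrite ler_norml lerNl; apply/andP; split.
    apply: (half (fun y => - G y) (fun y => - g y)) => //; first by rewrite G0 oppr0.
    by move=> y y0; apply: le_trans (gc y y0); rewrite -normrN ler_norm.
  by apply: (half G g) => // y y0; apply: le_trans (gc y y0); rewrite ler_norm.
move=> F0 Ff fc x; have [x0|x0] := lerP 0 x.
  rewrite (ger0_norm x0); apply: (both F f) => // y y0.
  by have := fc y; rewrite (ger0_norm y0).
rewrite (ltr0_norm x0).
have := both (fun y => F (- y)) (fun y => - f (- y)) _ _ _ (- x).
rewrite opprK; apply; rewrite ?oppr0 ?oppr_ge0 ?ltW//.
  move=> y; have dN : is_derive y 1 (fun s : R => - s) (-1).
    exact: is_deriveN_fun (is_derive_id y 1).
  by have := @is_derive1_comp R F (fun s => - s) y _ _ (Ff (- y)) dN; rewrite mulrN1.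
by move=> y y0; rewrite normrN; have := fc (- y); rewrite normrN (ger0_norm y0).
Qed.

Lemma vector_exp_primitive_bound n (F f : R -> 'cV[R]_n) (b c : R) :
  0 < b -> 0 <= c -> F 0 = 0 ->
  (forall x : R, is_derive x 1 F (f x)) ->
  (forall x, `|f x| <= c * expR (b * `|x|)) ->
  forall x, `|F x| <= c / b * expR (b * `|x|).
Proof.
move=> b0 c0 F0 Ff fc x; apply: mx_norm_le => [|i j].
  by rewrite mulr_ge0 ?expR_ge0// divr_ge0// ltW.
apply: (@exp_primitive_bound (fun x => F x i j) (fun x => f x i j)) => //.
- by rewrite F0 mxE.
- by move=> y; have /is_derive_mxP := Ff y; apply.
- by move=> y; apply: le_trans (fc y); exact: mx_entry_le.
Qed.

Lemma geometric_cvg (c z : R) : `|z| < 1 -> c * z ^+ i @[i --> \oo] --> (0 : R).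
Proof.
by move=> z1; rewrite -[X in _ --> X](mulr0 c); apply: cvgM;
  [exact: cvg_cst|exact: cvg_expr z1].
Qed.

Lemma geometric_half_cvg (c : R) : c * (2^-1) ^+ i @[i --> \oo] --> (0 : R).
Proof. by apply: geometric_cvg; rewrite ger0_norm ?invr_ge0// invf_lt1// ltr1n. Qed.

(* Successive approximations, controlled in the norm weighted by
   [expR (- 2 L |t|)], in which the integral operator is a contraction of ratio
   [1 / 2]. *)
Lemma picard n (G : R -> 'cV[R]_n -> 'cV[R]_n) (L M : R) (y0 : 'cV[R]_n) : 0 < L ->
  (forall s x y, `|G s x - G s y| <= L * `|x - y|) ->
  (forall y : R -> 'cV[R]_n, continuous y -> continuous (fun s => G s (y s))) ->
  (forall s, `|G s y0| <= M) ->
  exists y : R -> 'cV[R]_n, y 0 = y0 /\ forall t : R, is_derive t 1 y (G t (y t)).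
Proof.
move=> L0 GL Gc GM.
have L2 : 0 < 2 * L by rewrite mulr_gt0.
(* The choice ranges over all curves, with default 0 at discontinuous ones; the iterates stay
   continuous, so the specification applies to them. *)
have /choice[T TP] (y : R -> 'cV[R]_n) : exists z : R -> 'cV[R]_n, continuous y ->
    z 0 = y0 /\ forall t : R, is_derive t 1 z (G t (y t)).
  have [cy|ncy] := pselect (continuous y); last by exists (fun=> 0).
  by have [z zP] := vector_antiderivative y0 (Gc _ cy); exists z.
have cT y : continuous y -> continuous (T y).
  by move=> cy t; exact: is_derive_continuous ((TP y cy).2 t).
pose Y k := iter k T (fun=> y0).
have cY k : continuous (Y k).
  by elim: k => [|k IH]; [move=> t; exact: cvg_cst|exact: cT].
(* [C * w t] bounds the first step: the constant [M] is at most [M * w t], and integration gains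
   [1 / (2 * L)]. *)
pose C := M / (2 * L).
have M0 : 0 <= M by apply: le_trans (GM 0).
have C0 : 0 <= C by rewrite divr_ge0// ltW.
pose w (t : R) := expR (2 * L * `|t|).
have w0 t : 0 <= w t by exact: expR_ge0.
have contr (x y : R -> 'cV[R]_n) c : continuous x -> continuous y -> 0 <= c ->
    (forall t, `|x t - y t| <= c * w t) -> forall t, `|T x t - T y t| <= c / 2 * w t.
  move=> cx cy c0 xyc t.
  have -> : c / 2 = L * c / (2 * L) by field; rewrite gt_eqF.
  apply: (@vector_exp_primitive_bound _ (fun s => T x s - T y s) (fun s => G s (x s) - G s (y s))) => //.
  - by rewrite mulr_ge0// ltW.
  - by rewrite (TP x cx).1 (TP y cy).1 subrr.
  - by move=> s; exact: is_deriveB_fun ((TP x cx).2 s) ((TP y cy).2 s).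
  - by move=> s; apply: le_trans (GL _ _ _) _; rewrite -mulrA ler_wpM2l ?xyc// ltW.
have Ystep k t : `|Y k.+1 t - Y k t| <= C * 2^-1 ^+ k * w t.
  elim: k t => [|k IH] t.
    rewrite expr0 mulr1.
    apply: (@vector_exp_primitive_bound _ (fun s => T (Y 0%N) s - y0) (fun s => G s y0)) => //.
    - by rewrite (TP _ (cY 0%N)).1 subrr.
    - move=> s; have := is_deriveB_fun ((TP _ (cY 0%N)).2 s) (is_derive_cst y0 s 1).
      by rewrite subr0.
    - move=> s; apply: le_trans (GM s) _; rewrite ler_peMr//.
      by rewrite -expR0 ler_expR !mulr_ge0// ltW.
  rewrite exprSr mulrA; apply: contr.
  - exact: cY k.+1.
  - exact: cY k.
  - by rewrite mulr_ge0 ?exprn_ge0.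
  - exact: IH.
have C2 : 0 <= 2 * C by rewrite mulr_ge0.
have Cw t : 0 <= 2 * C * w t by rewrite mulr_ge0.
have Ycauchy k m t : (k <= m)%N -> `|Y m t - Y k t| <= 2 * C * w t * 2^-1 ^+ k.
  move=> /subnK <-; move: (m - k)%N => {}m.
  (* The exact partial sum of the geometric series is what the induction on [m] can carry. *)
  suff : `|Y (m + k)%N t - Y k t| <= 2 * C * w t * (2^-1 ^+ k - 2^-1 ^+ (m + k)).
    move=> H; apply: le_trans H _; rewrite ler_wpM2l ?Cw//.
    by rewrite gerBl exprn_ge0.
  elim: m => [|m IH]; first by rewrite add0n !subrr normr0 mulr0.
  rewrite -(subrKA (Y (m + k)%N t)); apply: le_trans (ler_normD _ _) _.
  have := Ystep (m + k)%N t; rewrite addSn exprS; move: IH.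
  move: (2^-1 ^+ (m + k)) (2^-1 ^+ k) (w t) => p q r; lra.
have /choice[y yP] t : exists l, forall k, `|l - Y k t| <= 2 * C * w t * 2^-1 ^+ k.
  apply: cauchy_limit; first by move=> i j; exact: Ycauchy.
  exact: geometric_half_cvg.
have small (c e : R) : 0 < e -> exists k, c * 2^-1 ^+ k < e.
  move=> e0; have /cvgrPdist_lt/(_ _ e0)[k _ /(_ k (leqnn k))/=] := geometric_half_cvg c.
  by rewrite sub0r normrN => /ltr_normlW; exists k.
have cy : continuous y.
  move=> t; apply/cvgrPdist_lt => e e0.
  have e3 : 0 < e / 3 by rewrite divr_gt0.
  have [k Hk] := small (2 * C * expR (2 * L * (`|t| + 1))) _ e3.
  have yk s : `|s - t| < 1 -> `|y s - Y k s| < e / 3.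
    move=> st; apply: le_lt_trans (yP s k) _; apply: le_lt_trans Hk.
    rewrite ler_wpM2r ?exprn_ge0// ler_wpM2l ?C2// ler_expR ler_wpM2l ?ltW//.
    by rewrite -(subrK t s) addrC; apply: le_lt_trans (ler_normD _ _) _; rewrite ltrD2l.
  near=> s.
  have sk : `|s - t| < 1 by rewrite distrC; near: s; exact: cvgr_dist_lt.
  have tk : `|t - t| < 1 by rewrite subrr normr0.
  have H1 := yk s sk; have H2 := yk t tk.
  have H3 : `|Y k t - Y k s| < e / 3.
    by near: s; have /cvgrPdist_lt := cY k t; apply.
  have -> : y t - y s = (y t - Y k t) + (Y k t - Y k s) - (y s - Y k s).
    by rewrite opprB !addrA !subrK.
  apply: le_lt_trans (ler_normB _ _) _.
  have := ler_normD (y t - Y k t) (Y k t - Y k s); lra.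
exists y.
suff yT : y = T y.
  by split=> [|t]; [rewrite yT (TP y cy).1|have := (TP y cy).2 t; rewrite -yT].
apply/funext => t; apply/eqP; rewrite -subr_eq0 -normr_le0.
apply/ler_addgt0Pl => e e0; rewrite addr0.
have [k Hk] := small (4 * C * w t) _ e0.
apply: le_trans (ltW Hk).
have H1 := yP t k.+1.
have H2 : `|Y k.+1 t - T y t| <= C * w t * 2^-1 ^+ k.
  have -> : C * w t * 2^-1 ^+ k = (2 * C * 2^-1 ^+ k) / 2 * w t by field.
  apply: (@contr (Y k) y (2 * C * 2^-1 ^+ k)) => //; first by rewrite mulr_ge0 ?exprn_ge0 ?invr_ge0 ?C2.
  by move=> s; rewrite distrC mulrAC; exact: yP.
rewrite -(subrKA (Y k.+1 t)); apply: le_trans (ler_normD _ _) _.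
apply: le_trans (lerD H1 H2) _; rewrite exprS.
have : 0 <= C * w t * 2^-1 ^+ k by rewrite mulr_ge0 ?(mulr_ge0 C0 (w0 t)) ?exprn_ge0 ?invr_ge0 ?ler0n.
move: (2^-1 ^+ k) (w t) => p q; lra.
Unshelve. all: by end_near. Qed.

End picard.

(** * Lyapunov functions *)

Section quadratic_forms.
Context {R : realType}.

Lemma qform_continuous n (M : 'M[R]_n) : continuous (fun x : 'rV[R]_n => qform M x^T).
Proof.
have -> : (fun x : 'rV[R]_n => qform M x^T) =
    (fun x => \sum_j (\sum_i x 0 i * M i j) * x 0 j).
  apply/funext => y; rewrite /qform trmxK mxE; apply: eq_bigr => j _.
  by rewrite !mxE.
apply: continuous_big; first exact: add_continuous.
move=> j _.
have cs : continuous (fun x : 'rV[R]_n => \sum_i x 0 i * M i j).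
  apply: continuous_big; first exact: add_continuous.
  move=> i _ x.
  have c1 : {for x, continuous (fun x : 'rV[R]_n => x 0 i)} by exact: coord_continuous.
  have c2 : {for x, continuous (fun _ : 'rV[R]_n => M i j)} by exact: cst_continuous.
  exact: (continuousM c1 c2).
move=> x.
have c1 : {for x, continuous (fun x : 'rV[R]_n => x 0 j)} by exact: coord_continuous.
exact: (continuousM (cs x) c1).
Qed.

Lemma qformZ n (M : 'M[R]_n) (a : R) x : qform M (a *: x) = a ^+ 2 * qform M x.
Proof.
rewrite /qform; have -> : (a *: x)^T = a *: x^T by rewrite linearZ.
by rewrite -scalemxAr -!scalemxAl scalerA mxE expr2.
Qed.

Lemma qformN n (M : 'M[R]_n) x : qform (- M) x = - qform M x.
Proof. by rewrite /qform mulmxN mulNmx mxE. Qed.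

(** The unit sphere is compact, so the form has a positive minimum on it, and homogeneity of degree
    2 does the rest. Dimension 0 has no unit vector, and any constant does. *)
Lemma posdef_lower n (M : 'M[R]_n) : posdef M ->
  exists2 c : R, 0 < c & forall x, c * `|x| ^+ 2 <= qform M x.
Proof.
move=> [_ Mpos]; case: n M Mpos => [|n] M Mpos.
  exists 1 => // x; rewrite (_ : x = 0) ?normr0 ?expr0n ?mulr0; last by apply/matrixP => -[].
  by rewrite /qform trmx0 !mul0mx mxE.
pose A := [set x : 'rV[R]_n.+1 | `|x| = 1].
have cA : compact A.
  apply: bounded_closed_compact.
    by exists 1; split=> // y y1 x /= ->; exact: ltW.
  apply: (@preimage_closed _ _ (fun x : 'rV[R]_n.+1 => `|x|) [set y | y = 1]).
    by move=> x _; exact: norm_continuous.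
  exact: closed_eq.
have A1 : A (const_mx 1).
  apply/eqP; rewrite eq_le; apply/andP; split.
    by apply: mx_norm_le => // i j; rewrite mxE normr1.
  by have := mx_entry_le (const_mx 1 : 'rV[R]_n.+1) 0 0; rewrite mxE normr1.
have [|c cA' minc] := @EVT_min_rV R _ (fun x => qform M x^T) A (ex_intro _ _ A1) cA.
  by apply: continuous_subspaceT; exact: (@qform_continuous _ M).
have c1 : `|c| = 1 by move: cA'; rewrite inE.
exists (qform M c^T).
  apply: Mpos; apply/eqP => /(congr1 trmx); rewrite trmxK trmx0 => c0.
  by move: c1; rewrite c0 normr0 => /eqP; rewrite eq_sym oner_eq0.
move=> x; have [->|x0] := eqVneq x 0.
  by rewrite normr0 expr0n mulr0 /qform trmx0 !mul0mx mxE.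
have nx0 : `|x| != 0 by rewrite normr_eq0.
have : qform M c^T <= qform M (`|x|^-1 *: x)^T^T.
  by apply: minc; rewrite inE /A/= trmx_norm normrZ normfV normr_id mulVf.
rewrite trmxK qformZ exprVn mulrC ler_pdivlMr ?exprn_gt0 ?normr_gt0//.
Qed.

Lemma bilinear_norm_le n (M : 'M[R]_n) (x y : 'cV[R]_n) :
  `|(x^T *m M *m y) 0 0| <= n%:R ^+ 2 * `|M| * `|x| * `|y|.
Proof.
apply: le_trans (mx_entry_le _ _ _) _.
apply: le_trans (mulmx_norm_le _ _) _; rewrite ler_wpM2r//.
apply: le_trans (ler_wpM2l _ (mulmx_norm_le _ _)) _ => //.
by rewrite trmx_norm expr2 -!mulrA (mulrC `|x|).
Qed.

Lemma posdef_unit n (P : 'M[R]_n) : posdef P -> P \in unitmx.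
Proof.
move=> [sP Pp]; rewrite -row_free_unit -kermx_eq0; apply/eqP/row_matrixP => i.
rewrite row0; apply/eqP; apply: contraT => k0.
have : 0 < qform P (row i (kermx P))^T.
  by apply: Pp; apply: contraNneq k0 => /(congr1 trmx); rewrite trmxK trmx0 => ->.
by rewrite /qform trmxK -row_mul mulmx_ker row0 mul0mx mxE ltxx.
Qed.

Lemma posdef_inv n (P : 'M[R]_n) : posdef P -> posdef (invmx P).
Proof.
move=> pP; have uP := posdef_unit pP; have [sP Pp] := pP.
have sI : symmetric_mx (invmx P) by rewrite /symmetric_mx trmx_inv sP.
split=> // x x0.
have -> : qform (invmx P) x = qform P (invmx P *m x).
  by rewrite /qform trmx_mul sI mulmxKV// mulmxA.
apply: Pp; apply: contraNneq x0 => Px0.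
by rewrite -[x]mul1mx -(mulmxV uP) -mulmxA Px0 mulmx0.
Qed.

Lemma negdef_opp n (M : 'M[R]_n) : negdef M -> posdef (- M).
Proof.
move=> [sM Mn]; split=> [|x /Mn]; last by rewrite qformN oppr_gt0.
by rewrite /symmetric_mx linearN/= sM.
Qed.

(** Here [d] stands for the difference of two states, [nu] for the difference of their nonlinear
    terms, small relative to [d] and absorbed by the decay, and [rho] for a defect of any size, paid
    for by [C]. The left-hand side is the derivative of [qform W d]. *)
Definition lyapunov_for n (A W : 'M[R]_n) (a C eps : R) :=
  forall d nu rho : 'cV[R]_n, `|nu| <= eps * `|d| ->
    2 * (d^T *m W *m (A *m d + nu + rho)) 0 0 <= - a * qform W d + C * `|rho| ^+ 2.

(** The weight is [W = P^-1]: with [e = W d], the form [2 d^T W A d] is the given negative definite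
    one evaluated at [e]. *)
Lemma lyapunov_exists n (A P : 'M[R]_n) :
  posdef P -> negdef (A *m P + P *m A^T) ->
  exists W a C eps, [/\ posdef W, 0 < a, 0 < C, 0 < eps & lyapunov_for A W a C eps].
Proof.
move=> pP nA; have uP := posdef_unit pP; have pW := posdef_inv pP.
have [c c0 cP] := posdef_lower (negdef_opp nA).
set W := invmx P in pW *.
pose p := n%:R * `|P| + 1; have p0 : 0 < p by rewrite ltr_wpDl// mulr_ge0.
have [K K0 WK] : exists2 K : R, 0 < K &
    forall x y : 'cV[R]_n, `|(x^T *m W *m y) 0 0| <= K * `|x| * `|y|.
  exists (n%:R ^+ 2 * `|W| + 1) => [|x y].
    by rewrite ltr_wpDl// mulr_ge0// exprn_ge0.
  apply: le_trans (bilinear_norm_le _ _ _) _.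
  by rewrite !ler_wpM2r// lerDl.
pose c' := c / p ^+ 2; have c'0 : 0 < c' by rewrite divr_gt0// exprn_gt0.
have decay (d : 'cV[R]_n) : 2 * (d^T *m W *m (A *m d)) 0 0 <= - c' * `|d| ^+ 2.
  pose e := W *m d.
  have dE : d = P *m e by rewrite /e mulmxA mulmxV// mul1mx.
  have -> : 2 * (d^T *m W *m (A *m d)) 0 0 = qform (A *m P + P *m A^T) e.
    have sW : W^T = W by case: pW.
    have -> : d^T *m W *m (A *m d) = e^T *m (A *m P) *m e.
      by rewrite {2}dE /e trmx_mul sW !mulmxA.
    rewrite /qform mulmxDr mulmxDl [RHS]mxE mulr_natl mulr2n; congr (_ + _).
    rewrite -[LHS](_ : (e^T *m (A *m P) *m e)^T 0 0 = _); last by rewrite mxE.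
    have sP : P^T = P by case: pP.
    by rewrite !trmx_mul !trmxK sP !mulmxA.
  have de : `|d| <= p * `|e|.
    rewrite dE; apply: le_trans (mulmx_norm_le _ _) _.
    by rewrite ler_wpM2r// lerDl.
  have := cP e; rewrite qformN => H.
  have : `|d| ^+ 2 <= p ^+ 2 * `|e| ^+ 2 by rewrite -exprMn lerXn2r ?nnegrE// mulr_ge0// ltW.
  rewrite -ler_pdivrMl ?exprn_gt0// => H2.
  have := ler_wpM2l (ltW c0) H2; rewrite mulrA -/c' mulNr => H3.
  by rewrite lerNr; exact: le_trans H3 H.
have VK (d : 'cV[R]_n) : qform W d <= K * `|d| ^+ 2.
  apply: le_trans (ler_norm _) _; apply: le_trans (WK _ _) _.
  by rewrite expr2 mulrA.
(* Budget for the decay [c' |d|^2]: one half absorbs [nu], one quarter absorbs [rho] by Young's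
   inequality, and the last quarter dominates [a * qform W d] because [qform W d <= K |d|^2]. *)
exists W, (c' / (4 * K)), (4 * K ^+ 2 / c'), (c' / (4 * K)).
split=> //; rewrite ?divr_gt0 ?mulr_gt0 ?exprn_gt0//.
move=> d nu rho nud.
have addE (X Y : 'M[R]_1) : (X + Y) 0 0 = X 0 0 + Y 0 0 by rewrite mxE.
rewrite !mulmxDr !addE !mulrDr mulNr.
have H1 := decay d.
have H2 : 2 * (d^T *m W *m nu) 0 0 <= c' / 2 * `|d| ^+ 2.
  have := le_trans (ler_norm _) (WK d nu).
  have := ler_wpM2l (mulr_ge0 (ltW K0) (normr_ge0 d)) nud.
  have -> : K * `|d| * (c' / (4 * K) * `|d|) = c' / 4 * `|d| ^+ 2.
    by field; rewrite gt_eqF.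
  by lra.
have H3 : 2 * (d^T *m W *m rho) 0 0 <= c' / 4 * `|d| ^+ 2 + 4 * K ^+ 2 / c' * `|rho| ^+ 2.
  have := le_trans (ler_norm _) (WK d rho).
  have : 0 <= (c' * `|d| - 4 * K * `|rho|) ^+ 2 / (4 * c').
    by rewrite divr_ge0 ?sqr_ge0// mulr_ge0// ltW.
  have -> : (c' * `|d| - 4 * K * `|rho|) ^+ 2 / (4 * c') =
     c' / 4 * `|d| ^+ 2 + 4 * K ^+ 2 / c' * `|rho| ^+ 2 - 2 * (K * `|d| * `|rho|).
    by field; rewrite gt_eqF.
  by lra.
have H4 : c' / (4 * K) * qform W d <= c' / 4 * `|d| ^+ 2.
  apply: le_trans (ler_wpM2l _ (VK d)) _; first by rewrite ltW// divr_gt0// mulr_gt0.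
  by rewrite le_eqVlt; apply/orP; left; apply/eqP; field; rewrite gt_eqF.
by lra.
Qed.

End quadratic_forms.

(** * Neutral stability and the data inequality *)

Section neutral_stability.
Context {R : realType}.

Lemma dot_self_ge0 n (x : 'cV[R]_n) : 0 <= (x^T *m x) 0 0.
Proof. by rewrite mxE sumr_ge0// => i _; rewrite mxE -expr2 sqr_ge0. Qed.

Lemma dot_self_eq0 n (x : 'cV[R]_n) : (x^T *m x) 0 0 = 0 -> x = 0.
Proof.
rewrite mxE => /eqP; rewrite psumr_eq0; last first.
  by move=> i _; rewrite mxE -expr2 sqr_ge0.
move=> /allP x0; apply/matrixP => i j; rewrite ord1 mxE.
have := x0 i (mem_index_enum i); rewrite mxE -expr2 sqrf_eq0.
by move/eqP.
Qed.

(* With [P S P^-1 = diag (i omega)], the squared length of the complex vector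
   [P v] is a real quadratic form that is constant along [v' = S v]. *)
Lemma invariant_form n (S : 'M[R]_n) :
  eigenvalues_zero_real_part S -> semisimple S ->
  exists H : 'M[R]_n, posdef H /\ forall v : 'cV[R]_n, (v^T *m H *m (S *m v)) 0 0 = 0.
Proof.
move=> Sre [P uP simD].
have [D diagD PS] : exists2 D, is_diag_mx D & P *m complexify S = D *m P.
  exists (P *m complexify S *m invmx P); first by rewrite -conjumx.
  by rewrite mulmxKV.
have DE i k : (D *m P) i k = D i i * P i k.
  rewrite mxE (bigD1 i)//= big1 ?addr0// => j ji.
  by rewrite (is_diag_mxP diagD) ?mul0r// eq_sym.
(* Row [i] of [P] is a left eigenvector for [D i i], nonzero because [P] is invertible. *)
have ReD i : complex.Re (D i i) = 0.
  apply: Sre; apply/eigenvalueP; exists (row i P).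
    by rewrite -row_mul PS; apply/rowP => k; rewrite [LHS]mxE DE !mxE.
  apply: contraTneq uP => Pi0; rewrite -row_free_unit -kermx_eq0.
  apply/eqP => ker0.
  have : (delta_mx 0 i : 'rV[R[i]]_n) *m P = 0 by rewrite -rowE.
  move=> /eqP; rewrite -sub_kermx ker0 submx0 => /eqP/rowP/(_ i)/eqP.
  by rewrite !mxE !eqxx oner_eq0.
(* On the real and imaginary parts of eigenrow [i], [S] acts as an infinitesimal rotation with
   frequency [w i], which conserves the sum of the squares of [A v] and [B v]. *)
pose A := map_mx (@complex.Re R) P; pose B := map_mx (@complex.Im R) P.
pose w i := complex.Im (D i i).
have AS i k : (A *m S) i k = - w i * B i k.
  have := congr1 (fun X : 'M[R[i]]_n => complex.Re (X i k)) PS; rewrite /= DE.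
  rewrite mxE raddf_sum/= => H.
  transitivity (complex.Re (D i i * P i k)).
    rewrite -H mxE; apply: eq_bigr => j _; rewrite !mxE.
    by case: (P i j) => a b /=; rewrite mulr0 subr0.
  rewrite mxE /w; move: (ReD i); case: (D i i) => a b /= ->.
  by case: (P i k) => c d /=; rewrite mul0r sub0r mulNr.
have BS i k : (B *m S) i k = w i * A i k.
  have := congr1 (fun X : 'M[R[i]]_n => complex.Im (X i k)) PS; rewrite /= DE.
  rewrite mxE raddf_sum/= => H.
  transitivity (complex.Im (D i i * P i k)).
    rewrite -H mxE; apply: eq_bigr => j _; rewrite !mxE.
    by case: (P i j) => a b /=; rewrite mulr0 add0r.
  rewrite mxE /w; move: (ReD i); case: (D i i) => a b /= ->.
  by case: (P i k) => c d /=; rewrite mul0r add0r.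
exists (A^T *m A + B^T *m B).
have HE v u : (v^T *m (A^T *m A + B^T *m B) *m u) 0 0 =
    ((A *m v)^T *m (A *m u)) 0 0 + ((B *m v)^T *m (B *m u)) 0 0.
  by rewrite mulmxDr mulmxDl mxE !trmx_mul !mulmxA.
split.
  split; first by rewrite /symmetric_mx linearD/= !trmx_mul !trmxK.
  move=> v v0; rewrite /qform HE lt_neqAle addr_ge0 ?dot_self_ge0// andbT.
  apply: contraNneq v0 => /esym/eqP; rewrite paddr_eq0 ?dot_self_ge0//.
  move=> /andP[/eqP/dot_self_eq0 Av /eqP/dot_self_eq0 Bv].
  have Pv : P *m map_mx (real_complex R) v = 0.
    apply/matrixP => i j; rewrite ord1 !mxE.
    have /eqP := congr1 (fun X : 'cV[R]_n => X i 0) Av.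
    have /eqP := congr1 (fun X : 'cV[R]_n => X i 0) Bv.
    rewrite !mxE => /eqP Bi /eqP Ai.
    apply/eqP; rewrite eq_complex !raddf_sum/=; apply/andP; split; apply/eqP.
      rewrite -[RHS]Ai; apply: eq_bigr => k _; rewrite !mxE.
      by case: (P i k) => a b /=; rewrite mulr0 subr0.
    rewrite -[RHS]Bi; apply: eq_bigr => k _; rewrite !mxE.
    by case: (P i k) => a b /=; rewrite mulr0 add0r.
  have := congr1 (mulmx (invmx P)) Pv; rewrite mulKmx// mulmx0 => /matrixP v0.
  apply/eqP/matrixP => i j; have := congr1 (@complex.Re R) (v0 i j).
  by rewrite !mxE.
have dotE (x y : 'cV[R]_n) : (x^T *m y) 0 0 = \sum_i x i 0 * y i 0.
  by rewrite mxE; apply: eq_bigr => i _; rewrite mxE.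
have ASv v i : (A *m (S *m v)) i 0 = - w i * (B *m v) i 0.
  rewrite mulmxA mxE [in RHS]mxE mulr_sumr.
  by apply: eq_bigr => j _; rewrite AS mulrA.
have BSv v i : (B *m (S *m v)) i 0 = w i * (A *m v) i 0.
  rewrite mulmxA mxE [in RHS]mxE mulr_sumr.
  by apply: eq_bigr => j _; rewrite BS mulrA.
move=> v; rewrite HE !dotE -big_split big1//= => i _.
by rewrite ASv BSv; ring.
Qed.

End neutral_stability.

Section data_lmi.
Context {R : realType}.

(* Testing the LMI on [(x, - Z^T x)] makes the data terms assemble into
   [(Xi' - Z X) (Xi' - Z X)^T], where [Z = (A B)]. *)
Lemma data_lmi_negdef n m T nd (A : 'M[R]_n) (B : 'M[R]_(n, m))
    (Xi Xi' : 'M[R]_(n, T)) (U : 'M[R]_(m, T)) (W : 'M[R]_(n, T)) (Delta : 'M[R]_(n, nd))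
    (P : 'M[R]_n) (Y : 'M[R]_(m, n)) :
  Xi' = A *m Xi + B *m U + W ->
  negsemidef (W *m W^T - Delta *m Delta^T) ->
  let Psi := col_mx Xi U *m (col_mx Xi U)^T in
  let Upsilon := - (col_mx Xi U *m Xi'^T) in
  let Sigma := Xi' *m Xi'^T - Delta *m Delta^T in
  posdef P ->
  negdef (block_mx (- Sigma) (Upsilon^T - (col_mx P Y)^T)
                   (Upsilon - col_mx P Y) (- Psi)) ->
  let Acl := A + B *m (Y *m invmx P) in
  negdef (Acl *m P + P *m Acl^T).
Proof.
move=> XiE [_ Wneg] Psi Upsilon Sigma pP [_ Lneg] Acl.
have uP := posdef_unit pP; have sP : P^T = P by case: pP.
have sAcl : symmetric_mx (Acl *m P + P *m Acl^T).
  by rewrite /symmetric_mx linearD/= !trmx_mul trmxK sP addrC.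
split=> // x x0.
pose X := col_mx Xi U; pose Z := row_mx A B; pose L := col_mx P Y.
have AclP : Acl *m P = Z *m L.
  by rewrite /Z /L mul_row_col /Acl mulmxDl -mulmxA mulmxKV.
have WE : W = Xi' - Z *m X by rewrite /Z /X mul_row_col XiE addrC addKr.
have y0 : col_mx x (- (Z^T *m x)) != 0.
  by apply: contraNneq x0; rewrite -[0]col_mx0 => /eq_col_mx[->].
have := Lneg _ y0; have := Wneg x.
rewrite /qform tr_col_mx.
have -> : row_mx x^T (- (Z^T *m x))^T *m
    block_mx (- Sigma) (Upsilon^T - L^T) (Upsilon - L) (- Psi) *m
    col_mx x (- (Z^T *m x)) =
  - (x^T *m (W *m W^T - Delta *m Delta^T) *m x) + x^T *m (Z *m L + (Z *m L)^T) *m x.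
  have yT : (- (Z^T *m x))^T = - (x^T *m Z).
    by rewrite -[RHS]trmxK; congr trmx; rewrite [RHS]linearN/= trmx_mul trmxK.
  have UT : Upsilon^T = - (Xi' *m X^T).
    by rewrite -[RHS]trmxK; congr trmx; rewrite [RHS]linearN/= trmx_mul trmxK.
  have WT : (Xi' - Z *m X)^T = Xi'^T - X^T *m Z^T by rewrite linearB/= trmx_mul.
  rewrite mul_row_block mul_row_col yT UT WE WT /Sigma /Upsilon /Psi -/X trmx_mul.
  rewrite !(mulmxDl, mulmxDr, mulmxN, mulNmx, opprD, opprK, mulmxA).
  set t1 := x^T *m Xi' *m Xi'^T *m x.
  set t2 := x^T *m Delta *m Delta^T *m x.
  set t3 := x^T *m Z *m X *m Xi'^T *m x.
  set t4 := x^T *m Xi' *m X^T *m Z^T *m x.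
  set t5 := x^T *m Z *m X *m X^T *m Z^T *m x.
  set t6 := x^T *m Z *m L *m x.
  set t7 := x^T *m L^T *m Z^T *m x.
  clearbody t1 t2 t3 t4 t5 t6 t7.
  by apply/matrixP => i j; rewrite !mxE; ring.
have addE (a b : 'M[R]_1) : (a + b) 0 0 = a 0 0 + b 0 0 by rewrite mxE.
have oppE (a : 'M[R]_1) : (- a) 0 0 = - a 0 0 by rewrite mxE.
(* The value of the LMI at the test vector is the wanted form minus the noise form; the value is
   negative and the noise form is nonpositive. *)
rewrite addE oppE -AclP trmx_mul sP; lra.
Qed.

End data_lmi.

(** * Kronecker powers *)

Section tensors.
Context {R : realType}.

(* Entry of a column vector at a natural number, [0] out of range: it is blind
   to casts of dimensions. *)
Definition entry N (x : 'cV[R]_N) (k : nat) : R :=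
  if insub k is Some i then x i 0 else 0.

Lemma entry_ord N (x : 'cV[R]_N) (i : 'I_N) : entry x i = x i 0.
Proof. by rewrite /entry valK. Qed.

Lemma entry_out N (x : 'cV[R]_N) k : (N <= k)%N -> entry x k = 0.
Proof. by move=> Nk; rewrite /entry insubN// -leqNgt. Qed.

Lemma entryP N (x y : 'cV[R]_N) : (forall k, entry x k = entry y k) -> x = y.
Proof. by move=> xy; apply/matrixP => i j; rewrite ord1 -!entry_ord. Qed.

Lemma entry_cast N N' (e : N = N') (x : 'cV[R]_N) k :
  entry (castmx (e, erefl 1%N) x) k = entry x k.
Proof. by case: N' / e; rewrite castmx_id. Qed.

Lemma entry_tens m p (a : 'cV[R]_m) (b : 'cV[R]_p) k :
  entry (tensmx a b : 'cV[R]_(m * p)) k = entry a (k %/ p) * entry b (k %% p).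
Proof.
have [kmp|mpk] := ltnP k (m * p).
  rewrite -[LHS]/(entry _ (Ordinal kmp)) entry_ord mxE.
  rewrite -[entry a _]/(entry a (mxtens_unindex (Ordinal kmp)).1).
  rewrite -[entry b _]/(entry b (mxtens_unindex (Ordinal kmp)).2).
  by rewrite !entry_ord; congr (a _ _ * b _ _); rewrite ord1.
rewrite entry_out//; case: p => [|p] in b mpk *.
  by rewrite modn0 (entry_out b)// mulr0.
by rewrite (entry_out a) ?mul0r// leq_divRL.
Qed.

(** Products of distinct vectors, unlike the powers of one vector, span the whole tensor space. Only
    the first [l] terms of the sequence matter. *)
Fixpoint ktens n l (vs : nat -> 'cV[R]_n) : 'cV[R]_(n ^ l) :=
  if l is l'.+1 then
    castmx (esym (expnS n l'), erefl 1%N)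
      (tensmx (vs 0%N) (ktens l' (fun i => vs i.+1)))
  else const_mx 1.

Lemma kronpowE n l (v : 'cV[R]_n) : kronpow l v = ktens l (fun=> v).
Proof. by elim: l => //= l ->. Qed.

Lemma eq_ktens n l (vs ws : nat -> 'cV[R]_n) :
  (forall i, (i < l)%N -> vs i = ws i) -> ktens l vs = ktens l ws.
Proof.
elim: l vs ws => //= l IH vs ws vw.
by rewrite vw// (IH _ (fun i => ws i.+1))// => i il; exact: vw.
Qed.

Lemma entry_ktens0 n (vs : nat -> 'cV[R]_n) k : entry (ktens 0 vs) k = (k == 0)%N%:R.
Proof.
case: k => [|k]; last by rewrite entry_out ?expn0.
by have := entry_ord (ktens 0 vs) (Ordinal (ltnSn 0)); rewrite mxE.
Qed.

Lemma entry_ktensS n l (vs : nat -> 'cV[R]_n) k :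
  entry (ktens l.+1 vs) k =
    entry (vs 0%N) (k %/ n ^ l) * entry (ktens l (fun i => vs i.+1)) (k %% n ^ l).
Proof. by rewrite /= entry_cast entry_tens. Qed.

(** In lexicographic order the index of an entry is a number written in base [n], so associativity
    of the tensor product becomes arithmetic of quotients and remainders. *)
Lemma entry_ktensD n a b (vs : nat -> 'cV[R]_n) k :
  entry (ktens (a + b) vs) k =
  entry (ktens a vs) (k %/ n ^ b) * entry (ktens b (fun i => vs (a + i)%N)) (k %% n ^ b).
Proof.
elim: a vs k => [|a IH] vs k.
  have [kb|bk] := ltnP k (n ^ b).
    by rewrite divn_small// modn_small// entry_ktens0 mul1r.
  rewrite entry_out// entry_ktens0; case: (posnP (n ^ b)) => [nb0|nb0].
    by rewrite [X in _ * X]entry_out ?mulr0// nb0.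
  by rewrite gtn_eqF ?mul0r// divn_gt0.
rewrite addSn entry_ktensS IH entry_ktensS -mulrA expnD.
congr (_ * (_ * _)).
- by rewrite mulnC divnMA.
- by rewrite -modn_divl.
- by rewrite modn_dvdm// dvdn_mull.
Qed.

Lemma ktens_split n l (i : 'I_l) (vs : nat -> 'cV[R]_n) :
  ktens l vs = castmx (kron_dim n i, erefl 1%N)
    (tensmx (tensmx (ktens i vs) (vs i)) (ktens (l - i.+1) (fun j => vs (i.+1 + j)%N))).
Proof.
apply: entryP => k; rewrite entry_cast.
have E : l = (i.+1 + (l - i.+1))%N by rewrite subnKC.
rewrite (congr1 (fun L => entry (ktens L vs) k) E).
rewrite entry_ktensD (entry_tens (tensmx (ktens i vs) (vs i))); congr (_ * _).
have E1 : i.+1 = (i + 1)%N by rewrite addn1.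
move: (_ %/ _)%N => k'; rewrite (congr1 (fun L => entry (ktens L vs) k') E1).
rewrite entry_ktensD entry_tens entry_ktensS entry_ktens0 expn0 divn1 modn1 mulr1.
by rewrite addn0 !expn1.
Qed.

Lemma castmx_mul_diag N N' (e : N = N') (A : 'M[R]_N) (x : 'cV[R]_N) :
  castmx (e, e) A *m castmx (e, erefl 1%N) x = castmx (e, erefl 1%N) (A *m x).
Proof. by case: N' / e; rewrite !castmx_id. Qed.

(** By the mixed product rule, summand [i] of the Kronecker sum acts on factor [i] only. The result
    has the shape of the Leibniz rule, which is why tensor products of flows follow the Kronecker
    sum. *)
Lemma kronsum_ktens n l (S : 'M[R]_n) (vs : nat -> 'cV[R]_n) :
  kronsum l S *m ktens l vs =
  \sum_(i < l) ktens l (fun j => if j == i then S *m vs j else vs j).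
Proof.
rewrite /kronsum mulmx_suml; apply: eq_bigr => i _.
rewrite (ktens_split i vs) castmx_mul_diag.
set c := ktens (l - i.+1) _.
have E := tensmx_mul (tensmx (1%:M : 'M[R]_(n ^ i)) S) 1%:M (tensmx (ktens i vs) (vs i)) c.
rewrite (tensmx_mul (1%:M : 'M[R]_(n ^ i)) S (ktens i vs) (vs i)) !mul1mx in E.
apply: (etrans (congr1 (castmx (kron_dim n i, erefl 1%N)) E)).
rewrite (ktens_split i (fun j => if j == i then _ else _)) eqxx.
have <- : ktens i vs = ktens i (fun j => if j == i then S *m vs j else vs j).
  by apply: eq_ktens => j ji; rewrite ltn_eqF.
have <- // : c = ktens (l - i.+1) (fun j =>
    if (i.+1 + j)%N == i then S *m vs (i.+1 + j)%N else vs (i.+1 + j)%N).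
by apply: eq_ktens => j _; rewrite gtn_eqF// leq_addr.
Qed.

Lemma ktens_norm_le n l (vs : nat -> 'cV[R]_n) :
  `|ktens l vs| <= \prod_(i < l) `|vs i|.
Proof.
elim: l vs => [|l IH] vs.
  by rewrite big_ord0; apply: mx_norm_le => // i j; rewrite mxE normr1.
rewrite big_ord_recl; apply: mx_norm_le => [|i j].
  by rewrite mulr_ge0// prodr_ge0.
rewrite ord1 castmxE/= mxE normrM ler_pM ?mx_entry_le//.
exact: le_trans (mx_entry_le _ _ _) (IH (fun i => vs i.+1)).
Qed.

Lemma kronpow_norm_le n l (v : 'cV[R]_n) : `|kronpow l v| <= `|v| ^+ l.
Proof.
rewrite kronpowE; apply: le_trans (ktens_norm_le _ _) _.
by rewrite prodr_const card_ord.
Qed.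

Lemma ktensSE n l (vs : nat -> 'cV[R]_n) r :
  ktens l.+1 vs r 0 = let u := mxtens_unindex (cast_ord (expnS n l) r) in
    vs 0%N u.1 0 * ktens l (fun i => vs i.+1) u.2 0.
Proof.
rewrite -[ktens l.+1 vs]/(castmx (esym (expnS n l), erefl 1%N)
  (tensmx (vs 0%N) (ktens l (fun i => vs i.+1)))).
move: (ktens l (fun i => vs i.+1)) => y; rewrite castmxE mxE/= esymK.
by congr (vs _ _ _ * y _ _); rewrite ord1.
Qed.

(** Standard basis vectors are products of standard basis vectors; a matrix on the tensor space can
    therefore be tested on products. *)
Lemma ktens_basis n l (k : 'I_(n ^ l)) :
  exists vs : nat -> 'cV[R]_n, ktens l vs = delta_mx k 0.
Proof.
elim: l k => [|l IH] k.
  exists (fun=> 0); apply/matrixP => i j.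
  by rewrite !mxE (ord1 j) (ord1 (i : 'I_1)) (ord1 (k : 'I_1)) eqxx.
pose k' := mxtens_unindex (cast_ord (expnS n l) k).
have [vs vsE] := IH k'.2.
exists (fun r => if r is r'.+1 then vs r' else delta_mx k'.1 0).
apply/matrixP => r s; rewrite ord1 ktensSE/= -[ktens l _]/(ktens l vs) vsE !mxE !andbT.
have -> : (r == k) = (mxtens_unindex (cast_ord (expnS n l) r) == k').
  by rewrite (can_eq (@mxtens_unindexK _ _)) (inj_eq (@cast_ord_inj _ _ _)).
by rewrite -natrM mulnb.
Qed.

Lemma mulmx_ktens_eq0 m n l (X : 'M[R]_(m, n ^ l)) :
  (forall vs : nat -> 'cV[R]_n, X *m ktens l vs = 0) -> X = 0.
Proof.
move=> X0; apply/matrixP => i k; have [vs vsE] := ktens_basis k.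
have := X0 vs; rewrite vsE -colE => /matrixP/(_ i 0).
by rewrite !mxE.
Qed.

Lemma is_derive_ktens n l (w dw : nat -> R -> 'cV[R]_n) (t : R) :
  (forall i, is_derive t 1 (w i) (dw i t)) ->
  is_derive t 1 (fun s => ktens l (fun i => w i s))
    (\sum_(i < l) ktens l (fun j => if j == i then dw j t else w j t)).
Proof.
elim: l w dw => [|l IH] w dw Hw.
  by rewrite big_ord0; exact: is_derive_cst.
have {}IH := IH (fun i => w i.+1) (fun i => dw i.+1) (fun i => Hw i.+1).
apply/is_derive_mxP => i j; rewrite ord1.
under eq_fun do rewrite ktensSE.
set r := mxtens_unindex _.
have /is_derive_mxP/(_ r.1 0) H1 := Hw 0%N.
have /is_derive_mxP/(_ r.2 0) H2 := IH.
apply: is_derive_eq (is_deriveM_fun H1 H2) _.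
rewrite big_ord_recl mxE !summxE mulr_sumr ktensSE; congr (_ + _).
by apply: eq_bigr => k _; rewrite ktensSE.
Qed.

Lemma is_derive_ktens_flow n l (S : 'M[R]_n) (w : nat -> R -> 'cV[R]_n) (t : R) :
  (forall i, is_derive t 1 (w i) (S *m w i t)) ->
  is_derive t 1 (fun s => ktens l (fun i => w i s))
    (kronsum l S *m ktens l (fun i => w i t)).
Proof.
by move=> Hw; rewrite kronsum_ktens; exact: (is_derive_ktens l (dw := fun i s => S *m w i s)).
Qed.

Lemma is_derive_kronpow n l (S : 'M[R]_n) (w : R -> 'cV[R]_n) (t : R) :
  is_derive t 1 w (S *m w t) ->
  is_derive t 1 (fun s => kronpow l (w s)) (kronsum l S *m kronpow l (w t)).
Proof.
move=> Hw; under eq_fun do rewrite kronpowE; rewrite kronpowE.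
exact: (@is_derive_ktens_flow n l S (fun=> w)).
Qed.

End tensors.

(** * Exosystem flows and Sylvester equations *)

Section flows.
Context {R : realType}.

Lemma lipschitz_continuous (V W : normedModType R) (L : R) (f : V -> W) :
  (forall x y, `|f x - f y| <= L * `|x - y|) -> continuous f.
Proof.
move=> Lf x; apply/cvgrPdist_lt => e e0.
have L0 : 0 < `|L| + 1 by rewrite ltr_wpDl.
near=> y; apply: le_lt_trans (Lf _ _) _.
apply: (@le_lt_trans _ _ ((`|L| + 1) * `|x - y|)).
  by rewrite ler_wpM2r// (le_trans (ler_norm _))// lerDl.
rewrite mulrC -ltr_pdivlMr//; near: y.
by apply: cvgr_dist_lt => //; rewrite divr_gt0.
Unshelve. all: by end_near. Qed.

Lemma linear_flow n (S : 'M[R]_n) (v0 : 'cV[R]_n) :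
  exists w : R -> 'cV[R]_n, w 0 = v0 /\ forall t : R, is_derive t 1 w (S *m w t).
Proof.
have c0 : 0 < n%:R * `|S| + 1 by rewrite ltr_wpDl// mulr_ge0.
apply: (@picard R n (fun=> mulmx S) (n%:R * `|S| + 1) `|S *m v0| _ c0) => //.
- move=> _ x y; rewrite -mulmxBr; apply: le_trans (mulmx_norm_le _ _) _.
  by rewrite ler_wpM2r// lerDl.
- move=> y cy t; apply: (continuous_comp (cy t)).
  apply: (@lipschitz_continuous _ _ (n%:R * `|S|)) => u v.
  by rewrite -mulmxBr mulmx_norm_le.
Qed.

Lemma qform_upper n (M : 'M[R]_n) :
  exists2 K : R, 0 < K & forall x, qform M x <= K * `|x| ^+ 2.
Proof.
exists (n%:R ^+ 2 * `|M| + 1) => [|x].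
  by rewrite ltr_wpDl// mulr_ge0// exprn_ge0.
apply: le_trans (ler_norm _) _; apply: le_trans (bilinear_norm_le _ _ _) _.
by rewrite expr2 mulrA !ler_wpM2r// lerDl.
Qed.

Lemma qform_continuous_cV n (M : 'M[R]_n) : continuous (qform M : 'cV[R]_n -> R).
Proof.
move=> x.
have ctr : {for x, continuous (fun y : 'cV[R]_n => y^T)}.
  apply: (@lipschitz_continuous _ _ 1) => // {}x y.
  have -> : x^T - y^T = (x - y)^T by rewrite linearB.
  by rewrite trmx_norm mul1r.
have -> : (qform M : 'cV[R]_n -> R) = (fun y => qform M (y^T)^T).
  by apply/funext => y; rewrite trmxK.
exact: (continuous_comp ctr (@qform_continuous _ _ M x^T)).
Qed.

Lemma qform_within_continuous n (M : 'M[R]_n) (A : set R) (y : R -> 'cV[R]_n) :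
  {within A, continuous y} -> {within A, continuous (fun t => qform M (y t))}.
Proof.
by move=> cy t; apply: (continuous_comp (cy t)); exact: qform_continuous_cV.
Qed.

Lemma posdef_eq0 n (M : 'M[R]_n) x : posdef M -> qform M x <= 0 -> x = 0.
Proof.
by move=> [_ Mp] Mx; apply/eqP; apply: contraTT Mx => /Mp; rewrite ltNge.
Qed.

Definition invariant_under n (S H : 'M[R]_n) :=
  posdef H /\ forall v : 'cV[R]_n, (v^T *m H *m (S *m v)) 0 0 = 0.

(** The form [H] is conserved in both time directions, so one constant serves for all pairs of
    times, in either order. *)
Lemma flow_bounded n (S H : 'M[R]_n) : invariant_under S H ->
  exists2 c : R, 0 < c & forall w : R -> 'cV[R]_n,
    (forall t : R, is_derive t 1 w (S *m w t)) -> forall s t, `|w t| <= c * `|w s|.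
Proof.
move=> [pH inv]; have [c1 c10 Hlow] := posdef_lower pH.
have [K K0 Hup] := qform_upper H.
(* The square of [1 + q] dominates [q], so no square root of [K / c1] is needed. *)
exists (1 + K / c1) => [|w Hw s t]; first by rewrite addr_gt0// divr_gt0.
have dq (r : R) : is_derive r 1 (fun r => qform H (w r)) 0.
  by apply: is_derive_eq (is_derive_qform (proj1 pH) (Hw r)) _; rewrite inv mulr0.
have const r r' : r <= r' -> qform H (w r') = qform H (w r).
  move=> rr'; have := @eq_derive_diff R _ (cst 0) (fun=> 0) r r' rr' (fun r _ => dq r)
    (fun r _ => is_derive_cst _ _ _).
  by rewrite subrr => /eqP; rewrite subr_eq0 => /eqP.
have qE : qform H (w t) = qform H (w s).
  by have [st|/ltW ts] := leP s t; [exact: const|rewrite -(const t s)].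
have H1 : `|w t| ^+ 2 <= K / c1 * `|w s| ^+ 2.
  rewrite mulrAC ler_pdivlMr// mulrC.
  by apply: le_trans (Hlow _) _; rewrite qE.
rewrite -(@ler_pXn2r _ 2)// ?nnegrE//; last first.
  by rewrite mulr_ge0// addr_ge0// divr_ge0// ltW.
apply: le_trans H1 _; rewrite exprMn ler_wpM2r ?exprn_ge0//.
have : 0 < K / c1 by rewrite divr_gt0.
move: (K / c1) => q q0; nra.
Qed.

(** The form [H] of the difference has zero derivative at positive times and vanishes at 0. The
    curve [v] is a solution on the half-line only, hence the closed-interval argument. *)
Lemma flow_unique n (S H : 'M[R]_n) (v w : R -> 'cV[R]_n) : invariant_under S H ->
  evolves v (fun t => S *m v t) -> (forall t : R, is_derive t 1 w (S *m w t)) ->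
  v 0 = w 0 -> forall t, 0 <= t -> v t = w t.
Proof.
move=> [pH inv] [cv dv] dw vw0 t t0.
pose d r := v r - w r.
have dq (r : R) : 0 < r -> is_derive r 1 (fun r => qform H (d r)) 0.
  move=> r0; have := is_deriveB_fun (dv r r0) (dw r); rewrite -mulmxBr => dd.
  by apply: is_derive_eq (is_derive_qform (proj1 pH) dd) _; rewrite inv mulr0.
have cd : {within `[0, t], continuous d}.
  have cv' : {within `[0, t], continuous v}.
    by apply: continuous_subspaceW cv => s; rewrite /= !in_itv/= => /andP[->].
  have cw : {within `[0, t], continuous w}.
    by apply: continuous_subspaceT => s; exact: is_derive_continuous (dw s).
  by move=> s; apply: cvgB; [exact: cv'|exact: cw].
have c0 : {within `[0, t], continuous (fun=> 0 : R)} by move=> s; exact: cvg_cst.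
have := derive_le_diff t0 (qform_within_continuous (M := H) cd)
  c0 (fun r r0 => dq r (proj1 (andP r0)))
  (fun r _ => is_derive_cst (0 : R) r 1) (fun r _ => lexx 0).
have -> : qform H (d 0) = 0 by rewrite /d vw0 subrr /qform mulmx0 mxE.
rewrite subrr subr0 => qd; apply/eqP; rewrite -subr_eq0 -/(d t); apply/eqP.
exact: posdef_eq0 pH qd.
Qed.

(** In finite dimension injectivity is enough. If [X K_l = A X], then [X] applied to a product of
    flows solves [y' = A y] and is bounded on the whole line, hence is zero; the flows have
    independent initial values, so [X] vanishes on all tensors and not only on symmetric ones. *)
Lemma sylvester_solvable m n l (A W : 'M[R]_m) a C eps (S H : 'M[R]_n)
    (Q : 'M[R]_(m, n ^ l)) :
  posdef W -> 0 < a -> 0 < eps -> lyapunov_for A W a C eps -> invariant_under S H ->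
  exists X : 'M[R]_(m, n ^ l), X *m kronsum l S - A *m X = Q.
Proof.
move=> pW a0 eps0 Ly HS; have [c c0 Hc] := flow_bounded HS.
have inj (X : 'M[R]_(m, n ^ l)) : X *m kronsum l S = A *m X -> X = 0.
  move=> XA; apply: mulmx_ktens_eq0 => vs.
  have /choice[w wP] i := linear_flow S (vs i).
  pose y t := X *m ktens l (fun i => w i t).
  have dy (t : R) : is_derive t 1 y (A *m y t).
    rewrite /y mulmxA -XA -mulmxA; apply: is_derive_mulmxl.
    by apply: is_derive_ktens_flow => i; exact: (wP i).2.
  have dq (t : R) := is_derive_qform (proj1 pW) (dy t).
  have [K K0 HK] := qform_upper W.
  have H0 := bounded_decay_le (a := a) (b := 0) a0 dq.
  suff : y 0 = 0 by
     rewrite /y (eq_ktens (ws := vs))// => i _; exact: (wP i).1.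
  apply: (posdef_eq0 pW); rewrite -[leRHS](mul0r a^-1); apply: H0.
    move=> t; rewrite mulmxA.
    have := Ly (y t) 0 0; rewrite normr0 expr0n mulr0 !addr0 mulmxA; apply.
    by rewrite mulr_ge0// ltW.
  exists (K * (((n ^ l)%:R * `|X| * \prod_(i < l) (c * `|vs i|)) ^+ 2)) => t.
  apply: le_trans (HK _) _; rewrite ler_wpM2l ?(ltW K0)// lerXn2r ?nnegrE//.
    rewrite !mulr_ge0// prodr_ge0// => i _; by rewrite mulr_ge0// ltW.
  apply: le_trans (mulmx_norm_le _ _) _; rewrite ler_wpM2l ?mulr_ge0//.
  apply: le_trans (ktens_norm_le _ _) _; apply: ler_prod => i _.
  by rewrite normr_ge0/= -(wP i).1; exact: Hc (wP i).2 _ _.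
pose f X := X *m kronsum l S - A *m X.
have lf : linear f.
  by move=> r X Y; rewrite /f mulmxDl mulmxDr -scalemxAl -scalemxAr scalerBr opprD addrACA.
pose fl : {linear 'M[R]_(m, n ^ l) -> 'M[R]_(m, n ^ l)} :=
  HB.pack f (GRing.isLinear.Build _ _ _ _ f lf).
have ker0 : kermx (lin_mx fl) = 0.
  apply/row_matrixP => i; rewrite row0.
  have : row i (kermx (lin_mx fl)) *m lin_mx fl = 0 by rewrite -row_mul mulmx_ker row0.
  rewrite mul_rV_lin => /(congr1 vec_mx); rewrite mxvecK linear0 => /eqP.
  rewrite subr_eq0 => /eqP/inj /(congr1 mxvec); rewrite vec_mxK => ->.
  by rewrite linear0.
have uf : lin_mx fl \in unitmx by rewrite -row_free_unit -kermx_eq0 ker0.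
exists (vec_mx (mxvec Q *m invmx (lin_mx fl))).
have := mul_rV_lin fl (mxvec Q *m invmx (lin_mx fl)).
by rewrite mulmxKV// => /(congr1 vec_mx); rewrite !mxvecK => H0; exact: esym H0.
Qed.

End flows.

(** * Homogeneous parts and Taylor jets *)

Section homogeneous.
Context {R : realType}.

(** Homogeneous polynomials of degree [d]. The coefficient row is not unique, since powers see only
    its symmetric part; it matches the matrices that the Sylvester equations act on. *)
Definition homog n d (p : 'cV[R]_n -> R) : Prop :=
  exists c : 'rV[R]_(n ^ d), forall v, p v = (c *m kronpow d v) 0 0.

Lemma homog_ext n d (p q : 'cV[R]_n -> R) : p =1 q -> homog d p -> homog d q.
Proof. by move=> pq [c cE]; exists c => v; rewrite -pq. Qed.

Lemma homog0 n d : homog d (fun _ : 'cV[R]_n => 0).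
Proof. by exists 0 => v; rewrite mul0mx mxE. Qed.

Lemma homogD n d (p q : 'cV[R]_n -> R) : homog d p -> homog d q -> homog d (fun v => p v + q v).
Proof.
by move=> [c cE] [c' cE']; exists (c + c') => v; rewrite cE cE' mulmxDl [RHS]mxE.
Qed.

Lemma homogZ n d a (p : 'cV[R]_n -> R) : homog d p -> homog d (fun v => a * p v).
Proof. by move=> [c cE]; exists (a *: c) => v; rewrite cE -scalemxAl [RHS]mxE. Qed.

Lemma homog_sum n d (I : Type) (r : seq I) (p : I -> 'cV[R]_n -> R) :
  (forall i, homog d (p i)) -> homog d (fun v => \sum_(i <- r) p i v).
Proof.
move=> hp; elim: r => [|i r IH].
  by apply: homog_ext (homog0 _ _) => v; rewrite big_nil.
by apply: homog_ext (homogD (hp i) IH) => v; rewrite big_cons.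
Qed.

Lemma homog_const n (a : R) : homog 0 (fun _ : 'cV[R]_n => a).
Proof.
exists (const_mx a) => v; rewrite mxE (big_ord1 _ (fun k => const_mx a 0 k * kronpow 0 v k 0)).
by rewrite !mxE mulr1.
Qed.

Lemma homog_coord n (i : 'I_n) : homog 1 (fun v : 'cV[R]_n => v i 0).
Proof.
exists (\row_j (cast_ord (expn1 n) j == i)%:R) => v.
have E j : kronpow 1 v j 0 = v (cast_ord (expn1 n) j) 0.
  rewrite kronpowE ktensSE/= [X in _ * X]mxE mulr1.
  by congr (v _ _); apply: val_inj; rewrite /= expn0 divn1.
rewrite mxE (eq_bigr (fun j => (cast_ord (expn1 n) j == i)%:R * v (cast_ord (expn1 n) j) 0)).
  rewrite (bigD1 (cast_ord (esym (expn1 n)) i))//= big1 ?addr0 => [|j ji].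
    by rewrite cast_ordKV eqxx mul1r.
  rewrite (_ : (_ == i) = false) ?mul0r//; apply: contraNF ji => /eqP <-.
  by rewrite cast_ordK.
by move=> j _; rewrite E mxE.
Qed.

Lemma homog_bound n d (p : 'cV[R]_n -> R) : homog d p ->
  exists2 C : R, 0 <= C & forall v, `|p v| <= C * `|v| ^+ d.
Proof.
move=> [c cE]; exists ((n ^ d)%:R * `|c|) => [|v]; first by rewrite mulr_ge0.
rewrite cE; apply: le_trans (mx_entry_le _ _ _) _.
apply: le_trans (mulmx_norm_le _ _) _.
by rewrite ler_wpM2l ?mulr_ge0// kronpow_norm_le.
Qed.

Lemma kronpowZ n d a (v : 'cV[R]_n) : kronpow d (a *: v) = a ^+ d *: kronpow d v.
Proof.
rewrite !kronpowE; elim: d => [|d IH]; first by rewrite scale1r.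
apply/matrixP => i j; rewrite ord1 mxE !ktensSE/= IH !mxE exprS.
by rewrite mulrACA.
Qed.

Lemma homog_scale n d (p : 'cV[R]_n -> R) a v : homog d p -> p (a *: v) = a ^+ d * p v.
Proof. by move=> [c cE]; rewrite !cE kronpowZ -scalemxAr [LHS]mxE. Qed.

Lemma homogM n d e (p q : 'cV[R]_n -> R) :
  homog d p -> homog e q -> homog (d + e) (fun v => p v * q v).
Proof.
move=> [c cE] [c' cE'].
exists (castmx (erefl 1%N, esym (expnD n d e)) (tensmx c c' : 'rV[R]_(n ^ d * n ^ e))) => v.
have -> : kronpow (d + e) v = castmx (esym (expnD n d e), erefl 1%N)
    (tensmx (kronpow d v) (kronpow e v)).
  by apply: entryP => k; rewrite entry_cast entry_tens !kronpowE entry_ktensD.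
have castmulK N N' (E : N = N') (x : 'rV[R]_N) (y : 'cV[R]_N) :
    castmx (erefl 1%N, E) x *m castmx (E, erefl 1%N) y = x *m y.
  by case: N' / E; rewrite !castmx_id.
rewrite castmulK.
have -> := congr1 (fun X : 'M[R]_1 => X 0 0) (tensmx_mul c c' (kronpow d v) (kronpow e v)).
have tens11 (a b : 'M[R]_1) : (tensmx a b : 'M[R]_1) 0 0 = a 0 0 * b 0 0.
  by rewrite mxE; congr (a _ _ * b _ _); rewrite ord1.
by rewrite tens11 cE cE'.
Qed.

End homogeneous.

Section bigO.
Context {R : realType}.

Definition order_near n K (g : 'cV[R]_n -> R) : Prop :=
  exists C r, [/\ 0 <= C, 0 < r & forall v, `|v| <= r -> `|g v| <= C * `|v| ^+ K].

Lemma order_near_ext n K (f g : 'cV[R]_n -> R) : f =1 g -> order_near K f -> order_near K g.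
Proof. by move=> fg [C [r [C0 r0 H]]]; exists C, r; split=> // v; rewrite -fg; exact: H. Qed.

Lemma order_nearD n K (f g : 'cV[R]_n -> R) :
  order_near K f -> order_near K g -> order_near K (fun v => f v + g v).
Proof.
move=> [C [r [C0 r0 H]]] [C' [r' [C0' r0' H']]].
exists (C + C'), (Num.min r r'); split; [exact: addr_ge0|by rewrite lt_min r0|].
move=> v; rewrite le_min => /andP[/H vC /H' vC'].
by rewrite mulrDl; apply: le_trans (ler_normD _ _) _; exact: lerD.
Qed.

Lemma order_nearM n K L (f g : 'cV[R]_n -> R) :
  order_near K f -> order_near L g -> order_near (K + L) (fun v => f v * g v).
Proof.
move=> [C [r [C0 r0 H]]] [C' [r' [C0' r0' H']]].
exists (C * C'), (Num.min r r'); split; [exact: mulr_ge0|by rewrite lt_min r0|].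
move=> v; rewrite le_min => /andP[/H vC /H' vC'].
by rewrite exprD mulrACA normrM; exact: ler_pM.
Qed.

Lemma order_near_le n K L (f : 'cV[R]_n -> R) :
  (L <= K)%N -> order_near K f -> order_near L f.
Proof.
move=> LK [C [r [C0 r0 H]]]; exists C, (Num.min r 1).
split=> //; first by rewrite lt_min r0/=.
move=> v; rewrite le_min => /andP[/H vC v1]; apply: le_trans vC _.
by rewrite ler_wpM2l// ler_wiXn2l.
Qed.

Lemma order_near0 n K : order_near K (fun _ : 'cV[R]_n => 0).
Proof. by exists 0, 1; split=> // v _; rewrite normr0 mul0r. Qed.

Lemma order_nearZ n K a (f : 'cV[R]_n -> R) : order_near K f -> order_near K (fun v => a * f v).
Proof.
move=> [C [r [C0 r0 H]]]; exists (`|a| * C), r; split=> //; first exact: mulr_ge0.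
by move=> v /H vC; rewrite normrM -mulrA ler_wpM2l.
Qed.

Lemma order_near_sum n K (I : Type) (s : seq I) (f : I -> 'cV[R]_n -> R) :
  (forall i, order_near K (f i)) -> order_near K (fun v => \sum_(i <- s) f i v).
Proof.
move=> hf; elim: s => [|i s IH].
  by apply: order_near_ext (order_near0 _ _) => v; rewrite big_nil.
by apply: order_near_ext (order_nearD (hf i) IH) => v; rewrite big_cons.
Qed.

Lemma homog_order_near n d (p : 'cV[R]_n -> R) : homog d p -> order_near d p.
Proof. by move=> /homog_bound[C C0 H]; exists C, 1; split=> // v _; exact: H. Qed.

(* The lowest-degree nonvanishing part would dominate along rays. *)
Lemma homog_sum_order_near_eq0 n K (P : nat -> 'cV[R]_n -> R) :
  (forall d, homog d (P d)) -> order_near K (fun v => \sum_(d < K) P d v) ->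
  forall d, (d < K)%N -> forall v, P d v = 0.
Proof.
move=> hP [C [r [C0 r0 H]]] d; elim/ltn_ind: d => d IH dK v.
have [->|v0] := eqVneq v 0.
  have := homog_scale 0 0 (hP d); rewrite scale0r.
  case: d IH dK => [|d] IH dK; last by rewrite expr0n mul0r.
  move=> _; have := H 0 _; rewrite normr0 (ltW r0) => /(_ isT).
  rewrite (bigD1 (Ordinal dK))//= big1 ?addr0 => [|i i0].
    by rewrite expr0n; case: (K) dK => // K' _; rewrite mulr0 normr_le0 => /eqP.
  have := homog_scale 0 0 (hP i); rewrite scale0r => ->.
  by rewrite expr0n (negPf (_ : (i : nat) != 0%N)) ?mul0r//; apply: contra i0 => /eqP i0; apply/eqP/val_inj.
have nv0 : 0 < `|v| by rewrite normr_gt0.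
pose s0 := Num.min 1 (r / `|v|).
have s00 : 0 < s0 by rewrite lt_min ltr01 divr_gt0.
(* On the ray through [v], parts of degree below [d] vanish by induction and the others, like the
   order bound, carry at least [s ^+ d.+1]; dividing by [s ^+ d] leaves a bound linear in [s]. *)
have [B B0 HB] : exists2 B : R, 0 <= B & forall s, 0 < s <= s0 -> `|P d v| <= B * s.
  exists (C * `|v| ^+ K + \sum_(i < K) `|P i v|) => [|s /andP[s0' ss0]].
    by rewrite addr_ge0 ?mulr_ge0 ?exprn_ge0// sumr_ge0.
  have s1 : s <= 1 by apply: le_trans ss0 _; rewrite ge_min lexx.
  have sv : `|s *: v| <= r.
    rewrite normrZ gtr0_norm// -ler_pdivlMr//; apply: le_trans ss0 _.
    by rewrite ge_min lexx orbT.
  have := H _ sv; rewrite normrZ gtr0_norm// exprMn.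
  rewrite (bigD1 (Ordinal dK))//= (homog_scale _ _ (hP d)).
  set T := \sum_(i < K | _) _ => HT.
  have hT : `|T| <= s ^+ d.+1 * \sum_(i < K) `|P i v|.
    rewrite [X in _ * X](bigD1 (Ordinal dK))//= mulrDr mulr_sumr.
    apply: le_trans (_ : _ <= \sum_(i < K | i != Ordinal dK) s ^+ d.+1 * `|P i v|) _; last first.
      by rewrite lerDr mulr_ge0// exprn_ge0// ltW.
    apply: le_trans (ler_norm_sum _ _ _) _; apply: ler_sum => i id.
    have [id'|di] := ltnP i d.
      by rewrite IH// normr0 mulr_ge0// exprn_ge0// ltW.
    rewrite (homog_scale _ _ (hP i)) normrM ler_wpM2r// ger0_norm ?exprn_ge0 ?(ltW s0')//.
    rewrite ler_wiXn2l ?(ltW s0')// ltn_neqAle di andbT.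
    by apply: contra id => /eqP id; apply/eqP/val_inj.
  have hK : C * (s ^+ K * `|v| ^+ K) <= s ^+ d.+1 * (C * `|v| ^+ K).
    rewrite mulrCA ler_wpM2r ?mulr_ge0 ?exprn_ge0//.
    by rewrite ler_wiXn2l ?(ltW s0').
  have : s ^+ d * `|P d v| <= s ^+ d * ((C * `|v| ^+ K + \sum_(i < K) `|P i v|) * s).
    have -> : s ^+ d * `|P d v| = `|s ^+ d * P d v + T - T|.
      by rewrite addrK normrM ger0_norm// exprn_ge0// ltW.
    apply: le_trans (ler_normB _ _) _.
    apply: le_trans (lerD (le_trans HT hK) hT) _.
    by rewrite -mulrDr exprSr -mulrA (mulrC s).
  by rewrite ler_pM2l// exprn_gt0.
apply/eqP; rewrite -normr_le0; apply/ler_addgt0Pl => e e0; rewrite addr0.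
pose s := Num.min s0 (e / (B + 1)).
have B1 : 0 < B + 1 by rewrite ltr_wpDl.
have /HB : 0 < s <= s0 by rewrite lt_min s00 divr_gt0//= ge_min lexx.
move=> /le_trans; apply; apply: (@le_trans _ _ (B * (e / (B + 1)))).
  by rewrite ler_wpM2l// ge_min lexx orbT.
rewrite mulrCA ler_piMr ?(ltW e0)// ler_pdivrMr// mul1r lerDl//.
Qed.

End bigO.

Section jets.
Context {R : realType}.

(** Taylor expansion through degree [K - 1], as a pure approximation property. It is stable under
    products and composition without any formula for derivatives of composites. *)
Definition jet n (K : nat) (g : 'cV[R]_n -> R) : Prop :=
  exists P : nat -> 'cV[R]_n -> R, (forall d, homog d (P d)) /\
    order_near K (fun v => g v - \sum_(d < K) P d v).

Lemma jet_ext n K (f g : 'cV[R]_n -> R) : f =1 g -> jet K f -> jet K g.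
Proof. by move=> /funext ->. Qed.

Lemma jet_order_near n K (g : 'cV[R]_n -> R) : order_near K g -> jet K g.
Proof.
move=> gO; exists (fun _ _ => 0); split=> [d|]; first exact: homog0.
by apply: order_near_ext gO => v; rewrite big1_eq subr0.
Qed.

Lemma jet_homog n K d (p : 'cV[R]_n -> R) : homog d p -> jet K p.
Proof.
move=> hp; have [dK|Kd] := ltnP d K; last first.
  by apply: jet_order_near; apply: order_near_le Kd _; exact: homog_order_near.
exists (fun e => if e == d then p else fun=> 0); split=> [e|].
  by case: eqP => [->|_]; [|exact: homog0].
apply: order_near_ext (order_near0 _ _) => v.
rewrite (bigD1 (Ordinal dK))//= eqxx big1 ?addr0 ?subrr// => i id.
by rewrite ifN//; apply: contra id => /eqP id; apply/eqP/val_inj.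
Qed.

Lemma jetD n K (f g : 'cV[R]_n -> R) : jet K f -> jet K g -> jet K (fun v => f v + g v).
Proof.
move=> [P [hP PO]] [Q [hQ QO]]; exists (fun d v => P d v + Q d v).
split=> [d|]; first exact: homogD.
by apply: order_near_ext (order_nearD PO QO) => v; rewrite big_split/= opprD addrACA.
Qed.

Lemma jetZ n K a (f : 'cV[R]_n -> R) : jet K f -> jet K (fun v => a * f v).
Proof.
move=> [P [hP PO]]; exists (fun d v => a * P d v).
split=> [d|]; first exact: homogZ.
by apply: order_near_ext (order_nearZ a PO) => v; rewrite mulrBr mulr_sumr.
Qed.

Lemma jet_sum n K (I : Type) (s : seq I) (f : I -> 'cV[R]_n -> R) :
  (forall i, jet K (f i)) -> jet K (fun v => \sum_(i <- s) f i v).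
Proof.
move=> hf; elim: s => [|i s IH].
  by apply: jet_ext (jet_order_near (order_near0 _ _)) => v; rewrite big_nil.
by apply: jet_ext (jetD (hf i) IH) => v; rewrite big_cons.
Qed.

Lemma jet_locally_bounded n K (f : 'cV[R]_n -> R) : jet K f -> order_near 0 f.
Proof.
move=> [P [hP PO]].
have H : order_near 0 (fun v => \sum_(d < K) P d v).
  by apply: order_near_sum => d; apply: (order_near_le (leq0n d)); exact: homog_order_near.
by apply: order_near_ext (order_nearD (order_near_le (leq0n K) PO) H) => v; rewrite subrK.
Qed.

Lemma jetM n K (f g : 'cV[R]_n -> R) : jet K f -> jet K g -> jet K (fun v => f v * g v).
Proof.
move=> jf jg; have fb := jet_locally_bounded jf.
have [P [hP PO]] := jf; have [Q [hQ QO]] := jg.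
(* Write [f g - P Q] as [f (g - Q) + (f - P) Q], where [f] and [Q] are locally bounded. *)
have PQO : order_near K (fun v => f v * g v - (\sum_(d < K) P d v) * (\sum_(d < K) Q d v)).
  have gb : order_near 0 (fun v => \sum_(d < K) Q d v).
    by apply: order_near_sum => d; apply: (order_near_le (leq0n d)); exact: homog_order_near.
  have H1 := order_nearM fb QO; rewrite add0n in H1.
  have H2 := order_nearM PO gb; rewrite addn0 in H2.
  by apply: order_near_ext (order_nearD H1 H2) => v; ring.
(* Cauchy product; the pairs with [i + j >= K] go to the remainder. *)
exists (fun d v => \sum_(i < K) \sum_(j < K) (if (i + j)%N == d then P i v * Q j v else 0)).
split=> [d|].
  apply: homog_sum => i; apply: homog_sum => j; case: eqP => [<-|_]; last exact: homog0.
  exact: homogM.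
have HO : order_near K (fun v => \sum_(i < K) \sum_(j < K)
    (if (K <= i + j)%N then P i v * Q j v else 0)).
  apply: order_near_sum => i; apply: order_near_sum => j; case: (leqP K (i + j)) => [Kij|_]; last exact: order_near0.
  by apply: order_near_le Kij _; apply: homog_order_near; exact: homogM.
apply: order_near_ext (order_nearD PQO HO) => v.
have <- : \sum_(d < K) \sum_(i < K) \sum_(j < K)
     (if (i + j)%N == d then P i v * Q j v else 0) +
   \sum_(i < K) \sum_(j < K) (if (K <= i + j)%N then P i v * Q j v else 0) =
   (\sum_(d < K) P d v) * (\sum_(d < K) Q d v); last by ring.
rewrite exchange_big/= mulr_suml -big_split/=; apply: eq_bigr => i _.
rewrite exchange_big/= mulr_sumr -big_split/=; apply: eq_bigr => j _.
have [Kij|ijK] := leqP K (i + j).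
  rewrite big1 ?add0r// => d _; case: eqP => // dE.
  by move: (ltn_ord d); rewrite -dE ltnNge Kij.
rewrite (bigD1 (Ordinal ijK))//= eqxx big1 ?addr0// => d dij.
by rewrite ifN//; apply: contra dij => /eqP dE; apply/eqP/val_inj.
Qed.

Lemma jet_const n K a : jet K (fun _ : 'cV[R]_n => a).
Proof. exact: jet_homog (homog_const _ _). Qed.

Lemma jet_coord n K (i : 'I_n) : jet K (fun v : 'cV[R]_n => v i 0).
Proof. exact: jet_homog (homog_coord _). Qed.

(** Since [y v] is of order 1, a remainder of order [K] in [y] is one of order [K] in [v], and small
    [v] keep [y v] in the ball where the expansion of [g] is valid. *)
Lemma jet_compose n N K (g : 'cV[R]_N -> R) (y : 'cV[R]_n -> 'cV[R]_N) :
  jet K g -> (forall i, jet K (fun v => y v i 0)) -> order_near 1 (fun v => `|y v|) ->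
  jet K (fun v => g (y v)).
Proof.
move=> [P [hP [C [r [C0 r0 HP]]]]] jy [C' [r' [C'0 r'0 Hy]]].
have jk d i : jet K (fun v => kronpow d (y v) i 0).
  elim: d i => [|d IH] i.
    apply: jet_ext (jet_const _ _ 1) => v; rewrite kronpowE; by rewrite [RHS]mxE.
  apply: jet_ext (jetM (jy (mxtens_unindex (cast_ord (expnS N d) i)).1) (IH (mxtens_unindex (cast_ord (expnS N d) i)).2)) => v.
  by rewrite !kronpowE ktensSE.
have jP d : jet K (fun v => P d (y v)).
  have [c cE] := hP d.
  apply: jet_ext (jet_sum (index_enum _) (fun k => jetZ (c 0 k) (jk d k))) => v.
  by rewrite cE [RHS]mxE.
apply: jet_ext (jetD (jet_order_near (_ : order_near K (fun v => g (y v) - \sum_(d < K) P d (y v))))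
  (jet_sum (index_enum _) (fun d : 'I_K => jP d))) => [v|]; first by rewrite subrK.
have C1 : 0 < C' + 1 by rewrite ltr_wpDl.
exists (C * C' ^+ K), (Num.min r' (r / (C' + 1))).
split; [by rewrite mulr_ge0// exprn_ge0|by rewrite lt_min r'0 divr_gt0|].
move=> v; rewrite le_min => /andP[vr' vr].
have := Hy v vr'; rewrite normr_id expr1 => yv.
have yr : `|y v| <= r.
  apply: le_trans yv _; apply: le_trans (_ : _ <= (C' + 1) * `|v|) _.
    by rewrite ler_wpM2r// lerDl.
  by rewrite mulrC -ler_pdivlMr.
apply: le_trans (HP _ yr) _; rewrite -mulrA ler_wpM2l// -exprMn.
by rewrite lerXn2r ?nnegrE// mulr_ge0.
Qed.

End jets.

(** * Taylor expansions of smooth maps *)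

Section taylor.
Context {R : realType}.

Lemma is_derive_comp_diff (V W : normedModType R) (g : V -> W) (y : R -> V) (t : R) w :
  differentiable g (y t) -> is_derive t 1 y w -> is_derive t 1 (g \o y) ('d g (y t) w).
Proof.
move=> dg [dy yw]; have dy' : differentiable y t by apply/derivable1_diffP.
have dgy : differentiable (g \o y) t by apply: differentiable_comp.
apply: DeriveDef; first exact: diff_derivable.
by rewrite deriveE// diff_comp//= -yw deriveE.
Qed.

Lemma diff_coord n (W : normedModType R) (g : 'cV[R]_n -> W) p v : differentiable g p ->
  'd g p v = \sum_i v i 0 *: 'D_(delta_mx i 0) g p.
Proof.
move=> dg; have {1}-> : v = \sum_i v i 0 *: delta_mx i 0.
  rewrite {1}(matrix_sum_delta v); apply: eq_bigr => i _.
  by rewrite big_ord1.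
by rewrite linear_sum/=; apply: eq_bigr => i _; rewrite linearZ/= deriveE.
Qed.

(** Induction on [K] through the partial derivatives: their expansions are integrated along the ray
    through [v], and the mean value theorem on [[0, 1]] transfers the error. *)
Lemma taylor n K (g : 'cV[R]_n -> R) : class_C K g -> jet K g.
Proof.
elim: K g => [|K IH] g.
  move=> cg; apply: jet_order_near.
  have /cvgrPdist_lt/(_ 1 ltr01) := cg 0.
  move=> /nbhs_ballP[r /= r0 H]; exists (`|g 0| + 1), (r / 2).
  split; [exact: addr_ge0|exact: divr_gt0|] => v vr; rewrite expr0 mulr1.
  have : `|g 0 - g v| < 1.
    apply: H; rewrite -ball_normE/= sub0r normrN; apply: le_lt_trans vr _.
    by rewrite gtr_pMr// invf_lt1// ltr1n.
  move=> gv; rewrite -(subKr (g 0) (g v)); apply: le_trans (ler_normB _ _) _.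
  by rewrite lerD2l ltW.
move=> [dg cg].
have /choice[P HP] i := IH _ (cg (delta_mx i 0)).
have hP i d : homog d (P i d) by case: (HP i).
have /choice[C /choice[r Hr]] i := (HP i).2.
pose C0 := \sum_i C i.
have [r0 r0_gt0 r0_le] : exists2 r0 : R, 0 < r0 & forall i, r0 <= r i.
  exists (\big[Num.min/1]_i r i).
    by elim/big_ind: _ => // [x y x0 y0|i _]; [rewrite lt_min x0|case: (Hr i)].
  move=> i; exact: bigmin_le.
(* Euler's relation fixes the part of degree [d + 1]; the factor [1 / (d + 1)] is the integral of
   [s ^+ d] over [[0, 1]]. *)
pose T (d : nat) (v : 'cV[R]_n) : R :=
  if d is d'.+1 then d'.+1%:R^-1 * \sum_i v i 0 * P i d' v else g 0.
exists T; split=> [[|d]|].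
- exact: homog_const.
- by apply: homogZ; apply: homog_sum => i; rewrite -add1n; apply: homogM => //; exact: homog_coord.
exists C0, r0; split=> //.
  by apply: sumr_ge0 => i _; case: (Hr i).
move=> v vr.
pose q d := \sum_i v i 0 * P i d v.
pose phi s := g (s *: v) - (g 0 + \sum_(d < K) s ^+ d.+1 * (d.+1%:R^-1 * q d)).
pose dphi s := \sum_i v i 0 * ('D_(delta_mx i 0) g (s *: v) - \sum_(d < K) P i d (s *: v)).
have phiE (s : R) : is_derive s 1 phi (dphi s).
  have dsv : is_derive s 1 (fun s : R => s *: v) v.
    apply/is_derive_mxP => i j; under eq_fun do rewrite mxE.
    have := is_deriveM_fun (is_derive_id s 1) (is_derive_cst (v i j) s 1).
    by rewrite mul1r mulr0 addr0.
  have H1 := @is_derive_comp_diff _ _ g (fun s : R => s *: v) s v (dg (s *: v)) dsv.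
  have H2 (d : 'I_K) : is_derive s 1 (fun s => s ^+ d.+1 * (d.+1%:R^-1 * q d)) (s ^+ d * q d).
    have dX : is_derive s 1 (fun s : R => s ^+ d.+1) (d.+1%:R * s ^+ d).
      apply: DeriveDef; first exact: exprn_derivable.
      by rewrite exp_derive -[_ *: 1]/(_ * 1) mulr1.
    have := is_deriveM_fun dX (is_derive_cst (d.+1%:R^-1 * q d) s 1).
    by rewrite mulr0 addr0 mulrACA mulrA mulfV ?pnatr_eq0// mul1r.
  have H3 := is_deriveD_fun (is_derive_cst (g 0) s 1) (is_derive_sum_fun H2).
  apply: is_derive_eq (is_deriveB_fun H1 H3) _.
  rewrite add0r diff_coord// /dphi.
  under [RHS]eq_bigr do rewrite mulrBr.
  rewrite sumrB; congr (_ - _).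
  rewrite /q; under eq_bigr do rewrite mulr_sumr.
  rewrite exchange_big/=; apply: eq_bigr => i _; rewrite mulr_sumr.
  by apply: eq_bigr => d _; rewrite (homog_scale _ _ (hP i d)) mulrCA.
have [] := @MVT_segment R phi dphi 0 1 ler01 (fun s _ => phiE s).
  by apply: continuous_subspaceT => s; exact: is_derive_continuous (phiE s).
move=> s; rewrite in_itv/= => /andP[s0 s1].
have -> : phi 0 = 0.
  rewrite /phi scale0r big1 ?addr0 ?subrr// => d _.
  by rewrite exprS mul0r mul0r.
have -> : phi 1 = g v - \sum_(d < K.+1) T d v.
  rewrite /phi scale1r big_ord_recl; congr (_ - (_ + _)).
  by apply: eq_bigr => d _; rewrite expr1n mul1r.
rewrite !subr0 mulr1 => ->; rewrite /dphi.
apply: le_trans (ler_norm_sum _ _ _) _; rewrite /C0 mulr_suml; apply: ler_sum => i _.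
have [Ci0 ri0 HPi] := Hr i.
rewrite normrM exprS mulrCA ler_pM ?mx_entry_le//.
have sv : `|s *: v| <= `|v| by rewrite normrZ ger0_norm// ler_piMl.
apply: le_trans (HPi _ _) _; first by rewrite (le_trans sv)// (le_trans vr).
by rewrite ler_wpM2l// lerXn2r ?nnegrE.
Qed.

End taylor.

(** * Contracting systems driven by the exosystem *)

Section contracting.
Context {R : realType}.

Definition field n q (A : 'M[R]_n) (E : 'M[R]_(n, q)) (N : 'cV[R]_n -> 'cV[R]_q -> 'cV[R]_n)
  x w := A *m x + E *m w + N x w.

(** The [eps] of the Lyapunov inequality is also the global Lipschitz constant of [N] in the state,
    so that differences of trajectories contract everywhere. Continuity is asked along curves, which
    is the form used by the Picard iteration. *)
Record contracting_field n q (A : 'M[R]_n) (E : 'M[R]_(n, q)) (W : 'M[R]_n) (a C eps : R)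
    (S H : 'M[R]_q) (N : 'cV[R]_n -> 'cV[R]_q -> 'cV[R]_n) : Prop := ContractingField {
  cf_posdef : posdef W;
  cf_a : 0 < a;
  cf_C : 0 < C;
  cf_eps : 0 < eps;
  cf_lyapunov : lyapunov_for A W a C eps;
  cf_invariant : invariant_under S H;
  cf_lipschitz : forall x y w, `|N x w - N y w| <= eps * `|x - y|;
  cf_N0 : forall w, `|N 0 w| <= eps * `|w|;
  cf_continuous : forall (x : R -> 'cV[R]_n) (w : R -> 'cV[R]_q),
    continuous x -> continuous w -> continuous (fun s => N (x s) (w s)) }.

Definition flow q (S : 'M[R]_q) (w : R -> 'cV[R]_q) :=
  forall t : R, is_derive t 1 w (S *m w t).

Lemma flow_continuous q (S : 'M[R]_q) w : flow S w -> continuous w.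
Proof. by move=> fw t; exact: is_derive_continuous (fw t). Qed.

Lemma flow_shift q (S : 'M[R]_q) w s : flow S w -> flow S (fun t => w (t + s)).
Proof. by move=> fw t; exact: is_derive_shift_fun. Qed.

Lemma flow_eq q (S H : 'M[R]_q) w w' s : invariant_under S H ->
  flow S w -> flow S w' -> w s = w' s -> w = w'.
Proof.
move=> inv fw fw' ws; have [c c0 Hc] := flow_bounded inv.
apply/funext => t; apply/eqP; rewrite -subr_eq0 -normr_le0.
have fd : flow S (fun t => w t - w' t).
  by move=> r; have := is_deriveB_fun (fw r) (fw' r); rewrite -mulmxBr.
by have := Hc _ fd s t; rewrite ws subrr normr0 mulr0.
Qed.

Lemma mulmx_continuous m n (A : 'M[R]_(m, n)) (y : R -> 'cV[R]_n) :
  continuous y -> continuous (fun s => A *m y s).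
Proof.
move=> cy t; apply: (continuous_comp (cy t)).
apply: (@lipschitz_continuous _ _ _ (n%:R * `|A|)) => u v.
by rewrite -mulmxBr mulmx_norm_le.
Qed.

Variables (n q : nat) (A : 'M[R]_n) (E : 'M[R]_(n, q)) (W : 'M[R]_n) (a C eps : R).
Variables (S H : 'M[R]_q) (N : 'cV[R]_n -> 'cV[R]_q -> 'cV[R]_n).
Hypothesis CF : contracting_field A E W a C eps S H N.
Local Notation X := (field A E N).
Local Notation V := (qform W).

Let pW := cf_posdef CF.
Let a0 := cf_a CF.
Let C0 := cf_C CF.
Let eps0 := cf_eps CF.
Let inv := cf_invariant CF.

Definition traj (w : R -> 'cV[R]_q) (x : R -> 'cV[R]_n) :=
  forall t : R, is_derive t 1 x (X (x t) (w t)).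

Lemma traj_continuous w x : traj w x -> continuous x.
Proof. by move=> tx t; exact: is_derive_continuous (tx t). Qed.

Lemma traj_shift w x s : traj w x -> traj (fun t => w (t + s)) (fun t => x (t + s)).
Proof. by move=> tx t; exact: is_derive_shift_fun. Qed.

Lemma fieldB x y w : X x w - X y w = A *m (x - y) + (N x w - N y w).
Proof.
rewrite /field mulmxBr; apply/matrixP => i j; rewrite !mxE.
by move: (\sum__ _) (\sum__ _) (\sum__ _) => *; ring.
Qed.

Lemma traj_exists w s0 x0 : flow S w -> exists2 x, traj w x & x s0 = x0.
Proof.
move=> fw; have [c c0 Hc] := flow_bounded inv.
pose G s x := X x (w (s + s0)).
pose L := n%:R * `|A| + eps; have L0 : 0 < L by rewrite ltr_wpDl// mulr_ge0.
have GL s x y : `|G s x - G s y| <= L * `|x - y|.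
  rewrite fieldB; apply: le_trans (ler_normD _ _) _; rewrite mulrDl lerD//.
    exact: mulmx_norm_le.
  exact: cf_lipschitz CF _ _ _.
have Gc y : continuous y -> continuous (fun s => G s (y s)).
  move=> cy t; have cw := flow_continuous (flow_shift s0 fw).
  apply: cvgD; last exact: (cf_continuous CF cy cw).
  by apply: cvgD; [exact: mulmx_continuous cy t|exact: mulmx_continuous cw t].
pose B := `|A *m x0| + q%:R * `|E| * (c * `|w 0|) + (eps * `|x0| + eps * (c * `|w 0|)).
have GM s : `|G s x0| <= B.
  apply: le_trans (ler_normD _ _) _; apply: lerD.
    apply: le_trans (ler_normD _ _) _; rewrite lerD2l.
    apply: le_trans (mulmx_norm_le _ _) _; rewrite ler_wpM2l ?mulr_ge0//.
    exact: Hc.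
  rewrite -(subrK (N 0 (w (s + s0))) (N x0 _)); apply: le_trans (ler_normD _ _) _.
  apply: lerD; first by have := cf_lipschitz CF x0 0 (w (s + s0)); rewrite subr0.
  apply: le_trans (cf_N0 CF _) _; rewrite ler_wpM2l ?(ltW eps0)//; exact: Hc.
have [y [y0 dy]] := picard L0 GL Gc GM.
exists (fun t => y (t - s0)); last by rewrite subrr.
move=> t; have := is_derive_shift_fun (t := t) (t0 := - s0) (dy (t - s0)).
by rewrite /G subrK.
Qed.

(** The Lyapunov inequality for [d = x - y], with [nu] the difference of the nonlinear terms. The
    defect [rho] allows [y] to be any curve, for instance the zero state or a polynomial graph. *)
Lemma comparison (t0 : R) (x y rho : R -> 'cV[R]_n) (w : R -> 'cV[R]_q) b :
  {within `[t0, +oo[, continuous (fun t => x t - y t)} ->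
  (forall t : R, t0 < t -> is_derive t 1 (fun t => x t - y t)
    (X (x t) (w t) - X (y t) (w t) + rho t)) ->
  (forall t, t0 < t -> `|rho t| <= b) ->
  forall t, t0 <= t ->
    V (x t - y t) <= expR (- a * (t - t0)) * V (x t0 - y t0) + C / a * b ^+ 2.
Proof.
move=> cd dd rb t t0t.
have dq s (t0s : t0 < s) := is_derive_qform (proj1 pW) (dd s t0s).
apply: le_trans (decay_le (b := C * b ^+ 2) a0 (qform_within_continuous (M := W) cd) dq _ t0t) _.
  move=> s t0s; rewrite fieldB.
  apply: le_trans (cf_lyapunov CF (rho s) (cf_lipschitz CF (x s) (y s) (w s))) _.
  rewrite lerD2l ler_wpM2l ?(ltW C0)//.
  by rewrite lerXn2r ?nnegrE// ?rb// (le_trans _ (rb _ t0s)).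
rewrite mulrBr -addrA lerD2l mulrAC gerDr.
by rewrite oppr_le0 mulr_ge0 ?expR_ge0// mulr_ge0 ?sqr_ge0// divr_ge0// ltW.
Qed.

Lemma bounded_comparison (x y rho : R -> 'cV[R]_n) (w : R -> 'cV[R]_q) b B :
  (forall t : R, is_derive t 1 (fun t => x t - y t)
    (X (x t) (w t) - X (y t) (w t) + rho t)) ->
  (forall t, `|rho t| <= b) -> (forall t, `|x t - y t| <= B) ->
  forall t, V (x t - y t) <= C / a * b ^+ 2.
Proof.
move=> dd rb xyB t.
have dq s := is_derive_qform (proj1 pW) (dd s).
rewrite mulrAC; apply: (bounded_decay_le a0 dq).
  move=> s; rewrite fieldB.
  apply: le_trans (cf_lyapunov CF (rho s) (cf_lipschitz CF (x s) (y s) (w s))) _.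
  by rewrite lerD2l ler_wpM2l ?(ltW C0)// lerXn2r ?nnegrE// (le_trans _ (rb s)).
have [K K0 HK] := qform_upper W.
exists (K * B ^+ 2) => s; apply: le_trans (HK _) _; rewrite ler_wpM2l ?(ltW K0)//.
by rewrite lerXn2r ?nnegrE// (le_trans _ (xyB s)).
Qed.

Lemma field0_le w : `|X 0 w| <= (q%:R * `|E| + eps) * `|w|.
Proof.
rewrite /field mulmx0 add0r mulrDl; apply: le_trans (ler_normD _ _) _.
by rewrite lerD ?mulmx_norm_le// (cf_N0 CF).
Qed.

Lemma norm_form_bounds : exists c1 K : R, [/\ 0 < c1, 0 < K,
  (forall x, c1 * `|x| ^+ 2 <= V x) & (forall x, V x <= K * `|x| ^+ 2)].
Proof.
have [c1 c10 H1] := posdef_lower pW; have [K K0 HK] := qform_upper W.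
by exists c1, K.
Qed.

(** Comparison with the zero state, whose defect is [X 0 w]. The constant does not depend on [t0],
    as the pullback construction requires. *)
Lemma traj_ge_bound : exists2 c : R, 0 < c & forall w x t0, flow S w ->
  {within `[t0, +oo[, continuous x} ->
  (forall t : R, t0 < t -> is_derive t 1 x (X (x t) (w t))) ->
  forall t, t0 <= t -> `|x t| <= c * (`|x t0| + `|w 0|).
Proof.
have [c c0 Hc] := flow_bounded inv; have [c1 [K [c10 K0 H1 HK]]] := norm_form_bounds.
pose K1 := (q%:R * `|E| + eps) * c.
have K10 : 0 < K1 by rewrite mulr_gt0// ltr_wpDl// mulr_ge0.
pose M := (K + C / a * K1 ^+ 2) / c1.
have M0 : 0 < M by rewrite divr_gt0// addr_gt0// mulr_gt0 ?exprn_gt0// divr_gt0.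
exists (M + 1) => [|w x t0 fw cx dx t t0t]; first by rewrite addr_gt0.
have x0E : x = (fun t => x t - 0) by apply/funext => s; rewrite subr0.
have HV : V (x t) <= expR (- a * (t - t0)) * V (x t0) + C / a * (K1 * `|w 0|) ^+ 2.
  rewrite x0E; apply: (@comparison t0 x (fun=> 0) (fun t => X 0 (w t)) w) => //.
  - by rewrite -x0E.
  - by move=> s t0s; rewrite -x0E subrK; exact: dx.
  - move=> s _; apply: le_trans (field0_le _) _; rewrite -mulrA; apply: ler_wpM2l.
      by rewrite addr_ge0 ?mulr_ge0// ltW.
    exact: Hc.
have e1 : expR (- a * (t - t0)) <= 1.
  by rewrite -expR0 ler_expR mulNr oppr_le0 mulr_ge0 ?subr_ge0// ltW.
have Vx0 : expR (- a * (t - t0)) * V (x t0) <= K * `|x t0| ^+ 2.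
  apply: le_trans (_ : _ <= 1 * V (x t0)) _; last by rewrite mul1r.
  by rewrite ler_wpM2r// (le_trans _ (H1 _))// mulr_ge0 ?sqr_ge0// ltW.
have H2 : c1 * `|x t| ^+ 2 <= (K + C / a * K1 ^+ 2) * (`|x t0| + `|w 0|) ^+ 2.
  apply: (le_trans (H1 _)); apply: (le_trans HV).
  apply: le_trans (lerD Vx0 (lexx _)) _.
  have p0 : 0 <= C / a * K1 ^+ 2 by rewrite mulr_ge0 ?sqr_ge0// divr_ge0// ltW.
  rewrite exprMn (mulrA (C / a)); move: (C / a * _) p0 (normr_ge0 (x t0)) (normr_ge0 (w 0)).
  move: (`|x t0|) (`|w 0|) => u z p p0 u0 z0.
  rewrite -subr_ge0.
  have -> : (K + p) * (u + z) ^+ 2 - (K * u ^+ 2 + p * z ^+ 2) =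
    K * (2 * (u * z) + z ^+ 2) + p * (u ^+ 2 + 2 * (u * z)) by ring.
  have uz : 0 <= 2 * (u * z) by rewrite !mulr_ge0.
  by rewrite addr_ge0// mulr_ge0// ?(ltW K0)// addr_ge0// sqr_ge0.
rewrite -(ler_pXn2r (n := 2))// ?nnegrE ?mulr_ge0 ?addr_ge0// ?(ltW M0)//.
rewrite exprMn.
have : `|x t| ^+ 2 <= M * (`|x t0| + `|w 0|) ^+ 2.
  by rewrite /M mulrAC ler_pdivlMr// mulrC.
move=> /le_trans; apply; rewrite ler_wpM2r ?sqr_ge0//; nra.
Qed.

End contracting.

(** * The invariant graph: construction, approximation and attraction *)

Section invariant_graph.
Context {R : realType}.
Variables (n q : nat) (A : 'M[R]_n) (E : 'M[R]_(n, q)) (W : 'M[R]_n) (a C eps : R).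
Variables (S H : 'M[R]_q) (N : 'cV[R]_n -> 'cV[R]_q -> 'cV[R]_n).
Hypothesis CF : contracting_field A E W a C eps S H N.
Local Notation X := (field A E N).
Local Notation V := (qform W).

Let pW := cf_posdef CF.
Let a0 := cf_a CF.
Let C0 := cf_C CF.
Let eps0 := cf_eps CF.
Let inv := cf_invariant CF.

Lemma ler_sqr_norm (m : nat) (x : 'cV[R]_m) (D b : R) : 0 <= D -> 0 <= b ->
  `|x| ^+ 2 <= D * b ^+ 2 -> `|x| <= (D + 1) * b.
Proof.
move=> D0 b0 xD; rewrite -(ler_pXn2r (n := 2))// ?nnegrE ?mulr_ge0 ?addr_ge0//.
by apply: le_trans xD _; rewrite exprMn ler_wpM2r ?sqr_ge0//; nra.
Qed.

Lemma traj_diff_ge w x y : traj A E N w x -> traj A E N w y -> forall s t, s <= t ->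
  V (x t - y t) <= expR (- a * (t - s)) * V (x s - y s).
Proof.
move=> tx ty s t st.
have dd (r : R) : is_derive r 1 (fun t => x t - y t) (X (x r) (w r) - X (y r) (w r) + 0).
  by rewrite addr0; exact: is_deriveB_fun (tx r) (ty r).
have := @comparison R _ _ _ _ _ _ _ _ _ _ _ CF s x y (fun=> 0) w 0 _ (fun r _ => dd r) _ t st.
rewrite expr0n mulr0 addr0; apply; last by move=> *; rewrite normr0.
by apply: continuous_subspaceT => r; exact: is_derive_continuous (dd r).
Qed.

(** Backwards in time the distance may grow, but at most exponentially, by the Lipschitz bound on
    the field; reversing time gives a Gronwall estimate with negative rate. It carries convergence
    at time 0 to each negative time. *)
Lemma traj_diff_le : exists2 k : R, 0 < k & forall w x y,
  traj A E N w x -> traj A E N w y -> forall t, t <= 0 ->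
  V (x t - y t) <= expR (k * - t) * V (x 0 - y 0).
Proof.
have [c1 [K [c10 K0 H1 HK]]] := norm_form_bounds CF.
pose L := n%:R ^+ 2 * `|W| * (n%:R * `|A| + eps).
have L0 : 0 <= L by rewrite !mulr_ge0// ?exprn_ge0// addr_ge0 ?mulr_ge0// ltW.
have Lc : 0 <= 2 * L / c1 := divr_ge0 (mulr_ge0 (ler0n _ 2) L0) (ltW c10).
pose k := 2 * L / c1 + 1; have k0 : 0 < k by rewrite ltr_wpDl.
exists k => // w x y tx ty t t0.
pose d r := x r - y r.
have dd (r : R) := is_deriveB_fun (tx r) (ty r).
have dq (r : R) := is_derive_qform (proj1 pW) (dd r).
have dN (r : R) : is_derive r 1 (fun s : R => - s) (-1).
  exact: is_deriveN_fun (is_derive_id r 1).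
pose psi s := V (d (- s)).
have dpsi (r : R) : is_derive r 1 psi
    (- (2 * ((d (- r))^T *m W *m (X (x (- r)) (w (- r)) - X (y (- r)) (w (- r)))) 0 0)).
  have := @is_derive1_comp R (fun s => V (d s)) (fun s => - s) r _ _ (dq (- r)) (dN r).
  by rewrite mulrN1.
have t0' : 0 <= - t by rewrite oppr_ge0.
have := @decay_le_itv R psi _ (- k) 0 0 (- t) _ t0' _ (fun s _ => dpsi s) _.
rewrite mul0r !subr0 addr0 opprK /psi opprK oppr0; apply.
- by rewrite oppr_eq0 gt_eqF.
- by apply: continuous_subspaceT => r; exact: is_derive_continuous (dpsi r).
move=> s _; rewrite addr0 ?opprK; set z := d (- s); rewrite fieldB.
apply: le_trans (ler_norm _) _; rewrite normrN normrM ger0_norm//.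
apply: le_trans (ler_wpM2l _ (bilinear_norm_le _ _ _)) _ => //.
have Nz : `|A *m z + (N (x (- s)) (w (- s)) - N (y (- s)) (w (- s)))| <=
    (n%:R * `|A| + eps) * `|z|.
  apply: le_trans (ler_normD _ _) _; rewrite mulrDl lerD// ?mulmx_norm_le//.
  exact: cf_lipschitz CF _ _ _.
apply: (@le_trans _ _ (2 * (L * `|z| ^+ 2))).
  rewrite ler_wpM2l// /L expr2 -!mulrA.
  rewrite !ler_wpM2l ?exprn_ge0//.
  by rewrite mulrCA ler_wpM2l.
have Vz := H1 z.
have Vz0 : 0 <= V z by apply: le_trans Vz; rewrite mulr_ge0 ?sqr_ge0// ltW.
have -> : k * V z = 2 * L / c1 * V z + V z by rewrite /k; move: (2 * L / c1) => l; ring.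
have -> : 2 * (L * `|z| ^+ 2) = 2 * L / c1 * (c1 * `|z| ^+ 2).
  by move: (L) => l; field; rewrite gt_eqF.
by apply: ler_wpDr => //; rewrite ler_wpM2l.
Qed.

(** Pullback: the trajectories [Y i] that start from 0 at time [- i] are uniformly bounded, and
    contraction makes their values at time 0 a Cauchy sequence. The trajectory through the limit
    inherits the bound. *)
Lemma entire_exists : exists2 c : R, 0 < c & forall w, flow S w ->
  exists2 x, traj A E N w x & forall t, `|x t| <= c * `|w 0|.
Proof.
have [c c0 Hc] := traj_ge_bound CF.
have [c1 [K [c10 K0 H1 HK]]] := norm_form_bounds CF.
have [k k0 Hk] := traj_diff_le.
exists c => // w fw.
have /choice[Y HY] (i : nat) : exists x, traj A E N w x /\ x (- i%:R) = 0.
  by have [x tx x0] := traj_exists CF (- i%:R) 0 fw; exists x.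
have Yb i t : - i%:R <= t -> `|Y i t| <= c * `|w 0|.
  move=> it; have [tY Y0] := HY i.
  have := Hc w (Y i) (- i%:R) fw _ (fun r _ => tY r) t it.
  rewrite Y0 normr0 add0r; apply.
  by apply: continuous_subspaceT => r; exact: is_derive_continuous (tY r).
pose D := K * (c * `|w 0|) ^+ 2 / c1.
have D0 : 0 <= D by rewrite divr_ge0 ?mulr_ge0 ?sqr_ge0// ltW.
(* Norms decay at half the rate of the quadratic form [V]. *)
pose z := expR (- a / 2).
have z0 : 0 <= z by exact: expR_ge0.
have z1 : `|z| < 1 by rewrite ger0_norm// -expR0 ltr_expR mulNr oppr_lt0 divr_gt0.
pose e i := (D + 1) * z ^+ i.
have e0 i : 0 <= e i by rewrite mulr_ge0 ?exprn_ge0// addr_ge0.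
have Ycauchy i j : (i <= j)%N -> `|Y j 0 - Y i 0| <= e i.
  move=> ij; apply: ler_sqr_norm; rewrite ?exprn_ge0//.
  have i0 : - i%:R <= 0 :> R by rewrite oppr_le0.
  have := traj_diff_ge (HY j).1 (HY i).1 i0; rewrite (HY i).2 subr0 => Hd.
  have -> : z ^+ i ^+ 2 = expR (- a * (0 - - i%:R)).
    by rewrite sub0r opprK -exprM -expRM_natl natrM; congr expR; field.
  rewrite /D mulrAC ler_pdivlMr// mulrC; apply: le_trans (H1 _) _.
  apply: le_trans Hd _; rewrite mulrC ler_wpM2r ?expR_ge0//.
  apply: le_trans (HK _) _; rewrite ler_wpM2l ?(ltW K0)// lerXn2r ?nnegrE ?mulr_ge0 ?(ltW c0)//.
  by apply: Yb; rewrite lerN2 ler_nat.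
have ecvg : e i @[i --> \oo] --> (0 : R) by exact: geometric_cvg.
have [l Hl] := cauchy_limit Ycauchy ecvg.
have [x tx x0] := traj_exists CF 0 l fw.
exists x => // t; apply/ler_addgt0Pl => d d0.
(* At a fixed time [t], [G] bounds the amplification of the squared error made at time 0: backward
   growth if [t <= 0], and contraction if [t > 0]. *)
pose G := K / c1 * expR (k * `|t|).
have G0 : 0 <= G by rewrite mulr_ge0 ?expR_ge0// divr_ge0// ltW.
have G1 : 0 < G + 1 by rewrite ltr_wpDl.
have dG : 0 < d / (G + 1) by rewrite divr_gt0.
have /cvgrPdist_lt/(_ _ dG)[M _ HM] := ecvg.
pose i := maxn M (Num.truncn `|t|).+1.
have Mi : (M <= i)%N by exact: leq_maxl.
have ti : `|t| <= i%:R.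
  by apply: le_trans (ltW (truncnS_gt _)) _; rewrite ler_nat leq_maxr.
have ei : e i < d / (G + 1).
  by have := HM i Mi; rewrite /= sub0r normrN; apply: le_lt_trans (ler_norm _).
have xY : `|x t - Y i t| <= (G + 1) * e i.
  apply: ler_sqr_norm => //.
  apply: (@le_trans _ _ (G * `|x 0 - Y i 0| ^+ 2)); last first.
    by rewrite ler_wpM2l// lerXn2r ?nnegrE// x0.
  have -> : G * `|x 0 - Y i 0| ^+ 2 = expR (k * `|t|) * (K * `|x 0 - Y i 0| ^+ 2) / c1.
    by rewrite /G; ring.
  rewrite ler_pdivlMr// mulrC; apply: le_trans (H1 _) _.
  have V0 : 0 <= V (x 0 - Y i 0) by apply: le_trans (H1 _); rewrite mulr_ge0 ?sqr_ge0// ltW.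
  apply: (@le_trans _ _ (expR (k * `|t|) * V (x 0 - Y i 0))); last first.
    by rewrite ler_wpM2l ?expR_ge0.
  have [t0|t0] := leP t 0.
    by rewrite (ler0_norm t0); exact: Hk tx (HY i).1 t t0.
  apply: le_trans (traj_diff_ge tx (HY i).1 (ltW t0)) _.
  rewrite ler_wpM2r// ler_expR subr0 (gtr0_norm t0) mulNr.
  by apply: (@le_trans _ _ 0); rewrite ?oppr_le0 mulr_ge0// ltW.
rewrite -(subrK (Y i t) (x t)); apply: le_trans (ler_normD _ _) _; apply: lerD.
  by apply: le_trans xY _; rewrite mulrC -ler_pdivlMr// ltW.
by apply: Yb; move: ti; rewrite ler_norml => /andP[].
Qed.

Lemma entire_unique w x y B : traj A E N w x -> traj A E N w y ->
  (forall t, `|x t| <= B) -> (forall t, `|y t| <= B) -> x = y.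
Proof.
move=> tx ty xB yB; apply/funext => t; apply/eqP; rewrite -subr_eq0; apply/eqP.
have dd (r : R) : is_derive r 1 (fun t => x t - y t) (X (x r) (w r) - X (y r) (w r) + 0).
  by rewrite addr0; exact: is_deriveB_fun (tx r) (ty r).
apply: (posdef_eq0 pW).
have := @bounded_comparison R _ _ _ _ _ _ _ _ _ _ _ CF x y (fun=> 0) w 0 (B + B) dd _ _ t.
rewrite expr0n mulr0; apply => s; first by rewrite normr0.
by apply: le_trans (ler_normB _ _) _; exact: lerD.
Qed.

Lemma invariant_graph : exists (pi : 'cV[R]_q -> 'cV[R]_n) (c : R),
  [/\ 0 < c, forall v, `|pi v| <= c * `|v| &
   forall w, flow S w -> traj A E N w (fun t => pi (w t))].
Proof.
have [c c0 Hc] := entire_exists; have [b b0 Hb] := flow_bounded inv.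
have /choice[pi Hpi] v : exists p, exists w x, [/\ flow S w, w 0 = v, traj A E N w x,
    forall t, `|x t| <= c * `|w 0| & x 0 = p].
  have [w [w0 fw]] := linear_flow S v; have [x tx xb] := Hc w fw.
  by exists (x 0), w, x.
exists pi, c; split=> // [v|w fw].
  by have [w [x [_ <- _ xb <-]]] := Hpi v.
have [x tx xb] := Hc w fw.
suff -> : (fun t => pi (w t)) = x by [].
(* The solution chosen for [w t] and the shift by [t] of the one over [w] are bounded solutions over
   the same flow; they coincide, and evaluation at 0 gives [pi (w t) = x t]. *)
apply/funext => t; have [w' [x' [fw' w'0 tx' xb' <-]]] := Hpi (w t).
have w'E : w' = fun s => w (s + t).
  by apply: (flow_eq (s := 0) inv fw' (flow_shift t fw)); rewrite w'0 add0r.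
have tx'' := traj_shift t tx; rewrite w'E in tx'.
have := @entire_unique _ _ _ (c * (b * `|w 0|)) tx' tx''.
move=> /(_ _ _)/(congr1 (fun f => f 0)); rewrite add0r; apply.
- move=> s; apply: le_trans (xb' s) _; rewrite ler_wpM2l ?(ltW c0)// w'0; exact: Hb.
- move=> s; apply: le_trans (xb _) _; rewrite ler_wpM2l ?(ltW c0)//; exact: Hb.
Qed.

(** The trajectory through a small [v] stays within [b |v|] for all times, so the defect of [p] is
    uniformly of order [m] on the whole line. Comparison of two bounded curves then bounds
    [pi v - p v], with no regularity of [pi]. *)
Lemma graph_approx (pi p : 'cV[R]_q -> 'cV[R]_n) c (r Cr B : R) m :
  (forall v, `|pi v| <= c * `|v|) ->
  (forall w, flow S w -> traj A E N w (fun t => pi (w t))) ->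
  0 < r -> 0 <= Cr ->
  (forall w, flow S w -> (forall t, `|w t| <= r) -> exists rho : R -> 'cV[R]_n,
    (forall t : R, is_derive t 1 (fun t => p (w t)) (X (p (w t)) (w t) - rho t)) /\
    forall t, `|rho t| <= Cr * `|w t| ^+ m) ->
  (forall v, `|v| <= r -> `|p v| <= B) ->
  exists C' r' : R, [/\ 0 <= C', 0 < r' & forall v, `|v| <= r' -> `|pi v - p v| <= C' * `|v| ^+ m].
Proof.
move=> pic piT r0 Cr0 Hp pB; have [b b0 Hb] := flow_bounded inv.
have [c1 [K [c10 K0 H1 HK]]] := norm_form_bounds CF.
pose D := C / a * (Cr * b ^+ m) ^+ 2 / c1.
have D0 : 0 <= D by rewrite divr_ge0 ?(ltW c10)// mulr_ge0 ?sqr_ge0// divr_ge0// ltW.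
exists (D + 1), (r / b); split; [exact: addr_ge0|exact: divr_gt0|] => v vr.
have [w [w0 fw]] := linear_flow S v.
have wb t : `|w t| <= b * `|v| by rewrite -w0; exact: Hb.
have wr t : `|w t| <= r by apply: le_trans (wb t) _; rewrite mulrC -ler_pdivlMr.
have [rho [drho rhob]] := Hp w fw wr.
apply: ler_sqr_norm; rewrite ?exprn_ge0//.
rewrite /D mulrAC ler_pdivlMr// mulrC; apply: le_trans (H1 _) _.
have dd (t : R) : is_derive t 1 (fun t => pi (w t) - p (w t))
    (X (pi (w t)) (w t) - X (p (w t)) (w t) + rho t).
  by have := is_deriveB_fun (piT w fw t) (drho t); rewrite opprB addrCA addrC.
have := @bounded_comparison R _ _ _ _ _ _ _ _ _ _ _ CF _ _ rho w
  (Cr * (b * `|v|) ^+ m) (`|c| * r + B) dd _ _ 0.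
rewrite w0 => H0; apply: le_trans (H0 _ _) _.
- move=> t; apply: le_trans (rhob t) _; rewrite ler_wpM2l// lerXn2r ?nnegrE ?mulr_ge0 ?(ltW b0)//.
- move=> t; apply: le_trans (ler_normB _ _) _; apply: lerD; last exact: pB.
  apply: le_trans (pic _) _; apply: (@le_trans _ _ (`|c| * `|w t|)).
    by rewrite ler_wpM2r// ler_norm.
  by rewrite ler_wpM2l.
have -> : Cr * (b * `|v|) ^+ m = Cr * b ^+ m * `|v| ^+ m by rewrite exprMn mulrA.
by rewrite [X in _ * X <= _]exprMn mulrA.
Qed.

Lemma graph_attracts (pi : 'cV[R]_q -> 'cV[R]_n) w (x : R -> 'cV[R]_n) : flow S w ->
  traj A E N w (fun t => pi (w t)) ->
  {within `[0, +oo[, continuous x} ->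
  (forall t : R, 0 < t -> is_derive t 1 x (X (x t) (w t))) ->
  exists D : R, forall t, 0 <= t -> `|x t - pi (w t)| <= D * expR (- a / 2 * t).
Proof.
move=> fw tpi cx dx; have [c1 [K [c10 K0 H1 HK]]] := norm_form_bounds CF.
have V0 : 0 <= V (x 0 - pi (w 0)) by apply: le_trans (H1 _); rewrite mulr_ge0 ?sqr_ge0// ltW.
exists (V (x 0 - pi (w 0)) / c1 + 1) => t t0.
apply: ler_sqr_norm; rewrite ?expR_ge0// ?divr_ge0// ?(ltW c10)//.
rewrite mulrAC ler_pdivlMr// mulrC; apply: le_trans (H1 _) _.
have dd (r : R) : 0 < r -> is_derive r 1 (fun t => x t - pi (w t))
    (X (x r) (w r) - X (pi (w r)) (w r) + 0).
  by move=> r0; rewrite addr0; exact: is_deriveB_fun (dx r r0) (tpi r).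
have cpi := traj_continuous tpi.
have := @comparison R _ _ _ _ _ _ _ _ _ _ _ CF 0 x (fun t => pi (w t)) (fun=> 0) w 0 _ dd _ t t0.
rewrite expr0n mulr0 addr0 subr0 => H0; apply: le_trans (H0 _ _) _.
- by move=> s; apply: cvgB; [exact: cx|apply: continuous_subspaceT].
- by move=> *; rewrite normr0.
rewrite mulrC ler_wpM2l// -expRM_natl ler_expR.
by rewrite mulrA mulrCA mulfV// mulr1.
Qed.

End invariant_graph.

(** * Smooth maps and saturation *)

Section class_C_closure.
Context {R : realType}.
Implicit Types U V W : normedModType R.

Lemma class_C_cst V W m (c : W) : class_C m (fun _ : V => c).
Proof.
elim: m c => [|m IH] c; first exact: cst_continuous.
split=> [p|d]; first exact: differentiable_cst.
have -> : (fun p : V => 'D_d (fun=> c) p) = (fun=> 0) by apply/funext => p; exact: derive_cst.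
exact: IH.
Qed.

Lemma class_C_linear V W m (L : {linear V -> W}) : continuous L -> class_C m L.
Proof.
case: m => [//|m] cL; split=> [p|d]; first exact: linear_differentiable.
have -> : (fun p : V => 'D_d L p) = (fun=> L d).
  apply/funext => p; rewrite deriveE; last exact: linear_differentiable.
  by rewrite diff_lin.
exact: class_C_cst.
Qed.

(** After composition with a linear map, a directional derivative is still one directional
    derivative of [g], so the induction needs no product rule. *)
Lemma class_C_precomp U V W m (g : V -> W) (L : {linear U -> V}) :
  continuous L -> class_C m g -> class_C m (g \o L).
Proof.
move=> cL; elim: m g => [|m IH] g /=.
  by move=> cg x; apply: continuous_comp; [exact: cL|exact: cg].
move=> [dg cg]; have dL x : differentiable L x by exact: linear_differentiable.
split=> [p|d]; first exact: differentiable_comp.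
have -> : (fun p => 'D_d (g \o L) p) = (fun p => 'D_(L d) g p) \o L.
  apply/funext => p /=; rewrite !deriveE//; last exact: differentiable_comp.
  by rewrite diff_comp//= diff_lin.
exact: IH.
Qed.

Lemma class_C_postcomp U V W m (g : U -> V) (L : {linear V -> W}) :
  continuous L -> class_C m g -> class_C m (L \o g).
Proof.
move=> cL; elim: m g => [|m IH] g /=.
  by move=> cg x; apply: continuous_comp; [exact: cg|exact: cL].
move=> [dg cg]; have dL x : differentiable L x by exact: linear_differentiable.
split=> [p|d]; first exact: differentiable_comp.
have -> : (fun p => 'D_d (L \o g) p) = L \o (fun p => 'D_d g p).
  apply/funext => p /=; rewrite !deriveE//; last exact: differentiable_comp.
  by rewrite diff_comp//= diff_lin.
exact: IH.
Qed.

Lemma class_CD V W m (f g : V -> W) :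
  class_C m f -> class_C m g -> class_C m (fun p => f p + g p).
Proof.
elim: m f g => [|m IH] f g /=.
  by move=> cf cg x; apply: cvgD; [exact: cf|exact: cg].
move=> [df cf] [dg cg]; split=> [p|d]; first exact: differentiableD.
have -> : (fun p => 'D_d (fun p => f p + g p) p) = (fun p => 'D_d f p + 'D_d g p).
  by apply/funext => p; apply: deriveD; exact: diff_derivable.
exact: IH.
Qed.

Lemma linear_lipschitz_continuous V W (L : {linear V -> W}) (k : R) :
  (forall v, `|L v| <= k * `|v|) -> continuous L.
Proof.
by move=> Lk; apply: (@lipschitz_continuous _ _ _ k) => x y; rewrite -linearB.
Qed.

End class_C_closure.

(** * Quadratic remainders and saturation *)

Section remainder.
Context {R : realType}.

(* Mean value theorem along the segment, the partial derivatives being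
   Lipschitz at [0]. *)
Lemma quadratic_remainder m (g : 'cV[R]_m -> R) : class_C 2 g ->
  exists C r : R, [/\ 0 <= C, 0 < r & forall rho x y, rho <= r -> `|x| <= rho -> `|y| <= rho ->
    `|g x - g y - 'd g 0 (x - y)| <= C * rho * `|x - y|].
Proof.
move=> [dg cg].
have /choice[C /choice[r Hr]] (i : 'I_m) : exists C r : R, [/\ 0 <= C, 0 < r & forall p, `|p| <= r ->
    `|'D_(delta_mx i 0) g p - 'D_(delta_mx i 0) g 0| <= C * `|p|].
  have [P [hP [C [r [C0 r0 H]]]]] := @taylor R m 1 _ (cg (delta_mx i 0)).
  have P0 p : P 0%N p = P 0%N 0 by rewrite -[0](scale0r p) (homog_scale _ _ (hP 0%N)) mul1r.
  exists C, r; split=> // p pr; have := H p pr.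
  have := H 0; rewrite normr0 (ltW r0) => /(_ isT).
  rewrite !big_ord1 expr1 mulr0 normr_le0 subr_eq0 => /eqP ->.
  by rewrite (P0 p).
pose C0 := \sum_i C i.
have C00 : 0 <= C0 by apply: sumr_ge0 => i _; case: (Hr i).
have [r0 r0_gt0 r0_le] : exists2 r0 : R, 0 < r0 & forall i, r0 <= r i.
  exists (\big[Num.min/1]_i r i).
    by elim/big_ind: _ => // [x y x0 y0|i _]; [rewrite lt_min x0|case: (Hr i)].
  move=> i; exact: bigmin_le.
exists C0, r0; split=> // rho x y rhor xr yr.
pose z s := y + s *: (x - y).
pose phi s := g (z s) - s * 'd g 0 (x - y).
pose dphi s := \sum_i (x - y) i 0 * ('D_(delta_mx i 0) g (z s) - 'D_(delta_mx i 0) g 0).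
have phiE (s : R) : is_derive s 1 phi (dphi s).
  have dz : is_derive s 1 z (x - y).
    apply/is_derive_mxP => i j; under eq_fun do rewrite !mxE.
    have H1 := is_deriveM_fun (is_derive_id s 1) (is_derive_cst ((x - y) i j) s 1).
    have := is_deriveD_fun (is_derive_cst (y i j) s 1) H1.
    by rewrite mul1r mulr0 addr0 add0r !mxE.
  have H1 := @is_derive_comp_diff _ _ _ g z s (x - y) (dg _) dz.
  have H2 (D : R) : is_derive s 1 (fun s : R => s * D) D.
    have := is_deriveM_fun (is_derive_id s 1) (is_derive_cst D s 1).
    by rewrite mul1r mulr0 addr0.
  apply: is_derive_eq (is_deriveB_fun H1 (H2 ('d g 0 (x - y)))) _.
  apply: etrans (congr2 (fun u v => u - v) (diff_coord (x - y) (dg (z s)))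
    (diff_coord (x - y) (dg 0))) _.
  by rewrite -sumrB; apply: eq_bigr => i _; rewrite -scalerBr.
have [|s] := @MVT_segment R phi dphi 0 1 ler01 (fun s _ => phiE s).
  by apply: continuous_subspaceT => s; exact: is_derive_continuous (phiE s).
rewrite in_itv/= => /andP[s0 s1].
have -> : phi 1 - phi 0 = g x - g y - 'd g 0 (x - y).
  have z1 : z 1 = x by rewrite /z scale1r addrC subrK.
  have z0 : z 0 = y by rewrite /z scale0r addr0.
  by rewrite /phi z1 z0 mul1r mul0r subr0 addrAC.
rewrite subr0 mulr1 => ->.
have zr : `|z s| <= rho.
  have -> : z s = (1 - s) *: y + s *: x.
    by rewrite /z scalerBr scalerBl scale1r addrA addrAC.
  apply: le_trans (ler_normD _ _) _; rewrite !normrZ !ger0_norm ?subr_ge0//.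
  rewrite [leRHS](_ : rho = (1 - s) * rho + s * rho); last by ring.
  by rewrite lerD// ler_wpM2l// subr_ge0.
apply: le_trans (ler_norm_sum _ _ _) _; rewrite /C0 !mulr_suml; apply: ler_sum => i _.
have [Ci0 ri0 HPi] := Hr i.
rewrite normrM mulrC ler_pM ?mx_entry_le//.
apply: le_trans (HPi _ _) _; first by rewrite (le_trans zr)// (le_trans rhor).
by rewrite ler_wpM2l.
Qed.

Lemma quadratic_remainder_mx m n (F : 'cV[R]_m -> 'cV[R]_n) (DF : 'M[R]_(n, m)) :
  (forall i, class_C 2 (fun y => F y i 0)) ->
  (forall i v, 'd (fun y => F y i 0) 0 v = (DF *m v) i 0) ->
  exists C r : R, [/\ 0 <= C, 0 < r & forall rho x y, rho <= r -> `|x| <= rho -> `|y| <= rho ->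
    `|F x - F y - DF *m (x - y)| <= C * rho * `|x - y|].
Proof.
move=> cF dF; have /choice[C /choice[r Hr]] i := quadratic_remainder (cF i).
have C0 i : 0 <= C i by case: (Hr i).
have [r0 r0_gt0 r0_le] : exists2 r0 : R, 0 < r0 & forall i, r0 <= r i.
  exists (\big[Num.min/1]_i r i).
    by elim/big_ind: _ => // [x y x0 y0|i _]; [rewrite lt_min x0|case: (Hr i)].
  move=> i; exact: bigmin_le.
exists (\sum_i C i), r0; split=> //; first exact: sumr_ge0.
move=> rho x y rhor xr yr; have rho0 : 0 <= rho by apply: le_trans xr.
apply: mx_norm_le => [|i j]; first by rewrite !mulr_ge0// sumr_ge0.
rewrite ord1; have [_ _ H] := Hr i.
have -> : (F x - F y - DF *m (x - y)) i 0 = F x i 0 - F y i 0 - 'd (fun y => F y i 0) 0 (x - y).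
  by rewrite dF mxE [(- (DF *m _)) i 0]mxE; congr (_ - _); rewrite !mxE.
apply: le_trans (H rho x y (le_trans rhor (r0_le i)) xr yr) _.
rewrite !ler_wpM2r// (bigD1 i)//= lerDl; exact: sumr_ge0.
Qed.

(** Coordinatewise clipping retracts onto a ball of the max norm with Lipschitz constant 1, so
    cutting off does not enlarge Lipschitz constants. The field loses smoothness but keeps
    continuity. *)
Definition sat n (r : R) (y : 'cV[R]_n) : 'cV[R]_n :=
  \col_i Num.max (- r) (Num.min r (y i 0)).

Lemma sat_norm n r (y : 'cV[R]_n) : 0 <= r -> `|sat r y| <= r.
Proof.
move=> r0; apply: mx_norm_le => // i j; rewrite mxE ler_norml le_max lexx/=.
by rewrite ge_max ge_min lexx/= andbT; lra.
Qed.

Lemma sat_id n r (y : 'cV[R]_n) : `|y| <= r -> sat r y = y.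
Proof.
move=> yr; apply/matrixP => i j; rewrite ord1 mxE.
have := le_trans (mx_entry_le y i 0) yr; rewrite ler_norml => /andP[y1 y2].
by rewrite min_r// max_r.
Qed.

Lemma sat_lipschitz n r (x y : 'cV[R]_n) : `|sat r x - sat r y| <= `|x - y|.
Proof.
apply: mx_norm_le => // i j; apply: le_trans (mx_entry_le (x - y) i 0).
rewrite !mxE; move: (x i 0) (y i 0) => s t.
have H (u w : R) : u <= w ->
  Num.max (- r) (Num.min r w) - Num.max (- r) (Num.min r u) <= w - u /\
  Num.max (- r) (Num.min r u) <= Num.max (- r) (Num.min r w).
  by move=> uw; rewrite /Num.max /Num.min; repeat case: ifPn; lra.
have [st|ts] := leP s t.
  have [H1 H2] := H s t st.
  by rewrite distrC ger0_norm ?subr_ge0// (distrC s) (ger0_norm (_ : 0 <= t - s)) ?subr_ge0.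
have [H1 H2] := H t s (ltW ts).
by rewrite ger0_norm ?subr_ge0// (ger0_norm (_ : 0 <= s - t)) ?subr_ge0// ltW.
Qed.

End remainder.

Section saturated_field.
Context {R : realType}.

Lemma col_mx_curve_continuous (T : topologicalType) n q (x : T -> 'cV[R]_n) (w : T -> 'cV[R]_q) :
  continuous x -> continuous w -> continuous (fun s => col_mx (x s) (w s)).
Proof.
move=> cx cw.
have -> : (fun s => col_mx (x s) (w s)) = (fun s => col_mx (x s) 0 + col_mx 0 (w s)).
  by apply/funext => s; rewrite add_col_mx addr0 add0r.
have cl : continuous (fun u : 'cV[R]_n => col_mx u (0 : 'cV[R]_q)).
  apply: (@lipschitz_continuous _ _ _ 1) => u v.
  by rewrite opp_col_mx add_col_mx subrr mul1r; apply: col_mx_norm_le; rewrite ?normr0.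
have cr : continuous (fun u : 'cV[R]_q => col_mx (0 : 'cV[R]_n) u).
  apply: (@lipschitz_continuous _ _ _ 1) => u v.
  by rewrite opp_col_mx add_col_mx subrr mul1r; apply: col_mx_norm_le; rewrite ?normr0.
have c1 : continuous (fun s => col_mx (x s) (0 : 'cV[R]_q)).
  by move=> t; exact: (continuous_comp (cx t) (cl _)).
have c2 : continuous (fun s => col_mx (0 : 'cV[R]_n) (w s)).
  by move=> t; exact: (continuous_comp (cw t) (cr _)).
by move=> t; apply: cvgD; [exact: c1|exact: c2].
Qed.

(** Only the remainder is saturated; the linear part stays exact, and with it the Lyapunov
    inequality holds globally. *)
Lemma saturated_contracting_field n q (F : 'cV[R]_(n + q) -> 'cV[R]_n)
    (A : 'M[R]_n) (E : 'M[R]_(n, q)) W a C eps (S H : 'M[R]_q) :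
  (forall i, class_C 2 (fun y => F y i 0)) ->
  (forall i v, 'd (fun y => F y i 0) 0 v = (row_mx A E *m v) i 0) ->
  F 0 = 0 -> posdef W -> 0 < a -> 0 < C -> 0 < eps -> lyapunov_for A W a C eps ->
  invariant_under S H ->
  exists N r, [/\ 0 < r, contracting_field A E W a C eps S H N &
    forall x w, `|x| <= r -> `|w| <= r -> field A E N x w = F (col_mx x w)].
Proof.
move=> cF dF F0 pW a0 C0 eps0 Ly inv.
have [K [r0 [K0 r00 HF]]] := quadratic_remainder_mx cF dF.
have K1 : 0 < K + 1 by rewrite ltr_wpDl.
(* On the ball of radius [r] the remainder has Lipschitz constant at most [K * r], hence at most
   [eps]. *)
pose r := Num.min r0 (eps / (K + 1)).
have r_gt0 : 0 < r by rewrite lt_min r00 divr_gt0.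
have Kr : K * r <= eps.
  apply: (@le_trans _ _ ((K + 1) * r)); first by rewrite ler_wpM2r ?(ltW r_gt0)// lerDl.
  by rewrite mulrC -ler_pdivlMr// ge_min lexx orbT.
pose G y := F (sat r y) - row_mx A E *m sat r y.
have GL x y : `|G x - G y| <= eps * `|x - y|.
  have -> : G x - G y = F (sat r x) - F (sat r y) - row_mx A E *m (sat r x - sat r y).
    rewrite mulmxBr /G.
    move: (F (sat r x)) (F (sat r y)) (_ *m sat r x) (_ *m sat r y) => u1 u2 u3 u4.
    by apply/matrixP => i j; rewrite !mxE; ring.
  have rr0 : r <= r0 by rewrite ge_min lexx.
  apply: le_trans (HF r _ _ rr0 (sat_norm _ (ltW r_gt0)) (sat_norm _ (ltW r_gt0))) _.
  apply: (@le_trans _ _ (eps * `|sat r x - sat r y|)); first by rewrite ler_wpM2r.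
  by rewrite ler_wpM2l ?(ltW eps0)// sat_lipschitz.
have cG : continuous G by exact: lipschitz_continuous GL.
have G0 : G 0 = 0 by rewrite /G sat_id ?normr0 ?(ltW r_gt0)// F0 mulmx0 subrr.
exists (fun x w => G (col_mx x w)), r; split=> //.
  split=> //.
  - move=> x y w; apply: le_trans (GL _ _) _; rewrite ler_wpM2l ?(ltW eps0)//.
    by rewrite opp_col_mx add_col_mx subrr; apply: col_mx_norm_le; rewrite ?normr0.
  - move=> w; have Hw := GL (col_mx 0 w) 0; rewrite G0 !subr0 in Hw.
    by apply: le_trans Hw _; rewrite ler_wpM2l ?(ltW eps0)//; apply: col_mx_norm_le; rewrite ?normr0.
  - move=> x w cx cw t.
    have cc := @col_mx_curve_continuous _ _ _ x w cx cw.
    have := @continuous_comp _ _ _ (fun s => col_mx (x s) (w s)) G t (cc t) (cG _).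
    exact.
move=> x w xr wr; rewrite /field /G sat_id; last exact: col_mx_norm_le.
by rewrite mul_row_col addrC subrK.
Qed.

End saturated_field.

(** * Formal solution of the invariance equation *)

Section formal_solution.
Context {R : realType}.
Variables (n q : nat) (S : 'M[R]_q).

(* [P'] is the derivative of [P] along the exosystem, [D P (v) (S v)]. *)
Definition hpart l (P P' : 'cV[R]_q -> 'cV[R]_n) := exists X : 'M[R]_(n, q ^ l),
  (forall v, P v = X *m kronpow l v) /\
  (forall v, P' v = X *m (kronsum l S *m kronpow l v)).

Lemma hpart_homog l P P' i : hpart l P P' -> homog l (fun v => P v i 0).
Proof.
by move=> [X [HP _]]; exists (row i X) => v; rewrite HP -row_mul [RHS]mxE.
Qed.

Lemma hpart_homog' l P P' i : hpart l P P' -> homog l (fun v => P' v i 0).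
Proof.
by move=> [X [_ HP]]; exists (row i (X *m kronsum l S)) => v; rewrite HP mulmxA -row_mul [RHS]mxE.
Qed.

Lemma hpart0 l : hpart l (fun=> 0) (fun=> 0).
Proof. by exists 0; split=> v; rewrite mul0mx. Qed.

Lemma order_near_mx K m (f : 'cV[R]_q -> 'cV[R]_m) :
  (forall i, order_near K (fun v => f v i 0)) -> order_near K (fun v => `|f v|).
Proof.
move=> Hf; have /choice[C /choice[r Hr]] i := Hf i.
have [r0 r0_gt0 r0_le] : exists2 r0 : R, 0 < r0 & forall i, r0 <= r i.
  exists (\big[Num.min/1]_i r i).
    by elim/big_ind: _ => // [x y x0 y0|i _]; [rewrite lt_min x0|case: (Hr i)].
  move=> i; exact: bigmin_le.
have C0 i : 0 <= C i by case: (Hr i).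
exists (\sum_i C i), r0; split=> //; first exact: sumr_ge0.
move=> v vr; rewrite normr_id; apply: mx_norm_le => [|i j].
  by rewrite mulr_ge0 ?exprn_ge0// sumr_ge0.
rewrite ord1; have [_ _ H] := Hr i.
apply: le_trans (H v (le_trans vr (r0_le i))) _.
by rewrite ler_wpM2r ?exprn_ge0// (bigD1 i)//= lerDl sumr_ge0.
Qed.

Lemma order_near_bound K m (f : 'cV[R]_q -> 'cV[R]_m) (g : 'cV[R]_q -> R) r :
  0 < r -> order_near K g -> (forall v, `|v| <= r -> `|f v| <= `|g v|) ->
  forall i, order_near K (fun v => f v i 0).
Proof.
move=> r0 [C [r' [C0 r'0 H]]] fg i; exists C, (Num.min r r').
split=> //; first by rewrite lt_min r0.
move=> v; rewrite le_min => /andP[vr vr'].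
apply: le_trans (mx_entry_le _ _ _) _; apply: le_trans (fg v vr) _; exact: H.
Qed.

Variables (F : 'cV[R]_(n + q) -> 'cV[R]_n) (A : 'M[R]_n) (E : 'M[R]_(n, q)) (C r : R).
Hypothesis F_jet : forall K i, jet K (fun y => F y i 0).
Hypothesis F0 : F 0 = 0.
Hypothesis C0 : 0 <= C.
Hypothesis r0 : 0 < r.
Hypothesis F_rem : forall rho x y, rho <= r -> `|x| <= rho -> `|y| <= rho ->
    `|F x - F y - row_mx A E *m (x - y)| <= C * rho * `|x - y|.
Hypothesis syl : forall l (Q : 'M[R]_(n, q ^ l)),
  exists X : 'M[R]_(n, q ^ l), X *m kronsum l S - A *m X = Q.

Lemma graph_order (P P' : nat -> 'cV[R]_q -> 'cV[R]_n) k :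
  (forall l, hpart l (P l) (P' l)) -> P 0%N = (fun=> 0) ->
  order_near 1 (fun v => `|col_mx (\sum_(l < k.+1) P l v) v|).
Proof.
move=> hP P0; apply: order_near_mx => j; rewrite -(splitK j).
case: (fintype.split j) => m /=.
  have : order_near 1 (fun v => \sum_(l < k.+1) P l v m 0).
    apply: order_near_sum => -[[|l] lk].
      by rewrite P0; apply: order_near_ext (order_near0 _ _) => v; rewrite mxE.
    by apply: (order_near_le (ltn0Sn l)); exact: homog_order_near (hpart_homog m (hP l.+1)).
  by apply: order_near_ext => v; rewrite col_mxEu summxE.
by apply: order_near_ext (homog_order_near (homog_coord m)) => v; rewrite col_mxEd.
Qed.

Lemma graph_jet K (P : nat -> 'cV[R]_q -> 'cV[R]_n) P' k N (G : 'cV[R]_(n + q) -> 'cV[R]_N) i :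
  (forall l, hpart l (P l) (P' l)) -> P 0%N = (fun=> 0) ->
  (forall j, jet K (fun y => G y j 0)) ->
  jet K (fun v => G (col_mx (\sum_(l < k.+1) P l v) v) i 0).
Proof.
move=> hP P0 jG.
apply: (jet_compose (g := fun y => G y i 0) (y := fun v => col_mx (\sum_(l < k.+1) P l v) v)) => //.
  move=> j; rewrite -(splitK j); case: (fintype.split j) => m /=.
    apply: jet_ext (jet_sum (index_enum _) (fun l : 'I_k.+1 => jet_homog K (hpart_homog m (hP l)))) => v.
    by rewrite col_mxEu summxE.
  by apply: jet_ext (jet_coord K m) => v; rewrite col_mxEd.
exact: graph_order hP P0.
Qed.

(** Adding [Xv] of degree [k + 1] changes [F] by [A Xv] up to order [k + 2], because the remainder
    is quadratic and the base point is of order 1. The lowest part of the residual can thus be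
    cancelled by one Sylvester equation. *)
Lemma formal_solution k : exists P P' : nat -> 'cV[R]_q -> 'cV[R]_n,
  [/\ forall l, hpart l (P l) (P' l), P 0%N = (fun=> 0) &
   forall i, order_near k.+1 (fun v => (\sum_(l < k.+1) P' l v
      - F (col_mx (\sum_(l < k.+1) P l v) v)) i 0)].
Proof.
elim: k => [|k [P [P' [hP P0 PO]]]].
  exists (fun _ _ => 0), (fun _ _ => 0); split=> // [l|]; first exact: hpart0.
  apply: (@order_near_bound _ _ _ (fun v => (C * r + (n + q)%:R * `|row_mx A E|) * `|v|) r) => //.
    exists (C * r + (n + q)%:R * `|row_mx A E|), 1; split=> //.
      by rewrite addr_ge0// mulr_ge0// ltW.
    by move=> v _; rewrite normrM normr_id ger0_norm// addr_ge0// mulr_ge0// ltW.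
  move=> v vr; rewrite !big_ord1 sub0r normrN.
  have cv : `|col_mx (0 : 'cV[R]_n) v| <= `|v| by apply: col_mx_norm_le; rewrite ?normr0.
  have := F_rem (lexx r) (le_trans cv vr) (_ : `|0| <= r).
  rewrite normr0 (ltW r0) => /(_ isT); rewrite F0 !subr0 => H.
  rewrite [leRHS]ger0_norm; last by rewrite mulr_ge0// addr_ge0// mulr_ge0// ltW.
  rewrite -(subrK (row_mx A E *m col_mx 0 v) (F _)).
  apply: le_trans (ler_normD _ _) _; rewrite mulrDl lerD//.
    by apply: le_trans H _; rewrite ler_wpM2l// mulr_ge0// ltW.
  by apply: le_trans (mulmx_norm_le _ _) _; rewrite ler_wpM2l// mulr_ge0.
pose p v := \sum_(l < k.+1) P l v.
pose res v := \sum_(l < k.+1) P' l v - F (col_mx (p v) v).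
have jres i : jet k.+2 (fun v => res v i 0).
  have j1 : jet k.+2 (fun v => \sum_(l < k.+1) P' l v i 0).
    by apply: jet_sum => l; exact: jet_homog (hpart_homog' i (hP l)).
  have j2 := jetZ (-1) (graph_jet k i hP P0 (F_jet k.+2)).
  by apply: jet_ext (jetD j1 j2) => v; rewrite /res !mxE summxE mulN1r.
have /choice[T HT] i : exists T, homog k.+1 T /\ order_near k.+2 (fun v => res v i 0 - T v).
  have [T [hT TO]] := jres i; exists (T k.+1); split=> //.
  (* The residual and its part of degree [k + 1] are both of order [k + 1], so all lower parts of
     its expansion vanish. *)
  have TO' : order_near k.+1 (fun v => \sum_(d < k.+1) T d v).
    have H1 : order_near k.+1 (fun v => T k.+1 v) by exact: homog_order_near (hT k.+1).
    have H2 := order_nearD (PO i) (order_nearZ (-1) (order_nearD (order_near_le (leqnSn _) TO) H1)).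
    by apply: order_near_ext H2 => v; rewrite [in X in _ + X]big_ord_recr/=; ring.
  have T0 := homog_sum_order_near_eq0 hT TO'.
  apply: order_near_ext TO => v; rewrite big_ord_recr/= big1 ?add0r// => d _.
  exact: T0.
have /choice[c cE] i := (HT i).1.
pose Q : 'M[R]_(n, q ^ k.+1) := \matrix_(i, j) c i 0 j.
have [X XE] := syl (- Q).
pose add (f : nat -> 'cV[R]_q -> 'cV[R]_n) g l := if l == k.+1 then g else f l.
have add_sum f g v : \sum_(l < k.+2) add f g l v = \sum_(l < k.+1) f l v + g v.
  rewrite big_ord_recr/= {2}/add eqxx; congr (_ + _); apply: eq_bigr => l _.
  by rewrite /add ltn_eqF.
pose Xv v := X *m kronpow k.+1 v.
have hP' l : hpart l (add P Xv l)
    (add P' (fun v => X *m (kronsum k.+1 S *m kronpow k.+1 v)) l).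
  by rewrite /add; case: eqP => [->|_]; [exists X|exact: hP].
exists (add P Xv), (add P' (fun v => X *m (kronsum k.+1 S *m kronpow k.+1 v))); split=> //.
move=> i.
pose rem v := F (col_mx (p v + Xv v) v) - F (col_mx (p v) v) - A *m Xv v.
have remO j : order_near k.+2 (fun v => rem v j 0).
  have [B [r1 [B0 r10 H1]]] := graph_order k hP P0.
  have [B' [r2 [B'0 r20 H2]]] := graph_order k.+1 hP' P0.
  pose B2 := B + B' + 1; have B20 : 0 < B2 by rewrite ltr_wpDl// addr_ge0.
  pose D := (q ^ k.+1)%:R * `|X|; have D0 : 0 <= D by rewrite mulr_ge0.
  pose r3 := Num.min (Num.min r1 r2) (r / B2).
  have r30 : 0 < r3 by rewrite !lt_min r10 r20 divr_gt0.
  apply: (@order_near_bound _ _ _ (fun v => C * B2 * D * `|v| ^+ k.+2) r3) => //.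
    exists (C * B2 * D), 1; split=> //; first by rewrite !mulr_ge0// ltW.
    by move=> v _; rewrite ger0_norm// mulr_ge0 ?exprn_ge0// !mulr_ge0// ltW.
  move=> v; rewrite !le_min -andbA => /and3P[vr1 vr2 vr3].
  have rho_r : B2 * `|v| <= r by rewrite mulrC -ler_pdivlMr.
  have y1 : `|col_mx (p v + Xv v) v| <= B2 * `|v|.
    have := H2 v vr2; rewrite add_sum normr_id expr1 => /le_trans; apply.
    by rewrite ler_wpM2r// /B2 -addrA addrCA lerDl addr_ge0.
  have y2 : `|col_mx (p v) v| <= B2 * `|v|.
    have := H1 v vr1; rewrite normr_id expr1 => /le_trans; apply.
    by rewrite ler_wpM2r// /B2 -addrA lerDl addr_ge0.
  have := F_rem rho_r y1 y2.
  have -> : col_mx (p v + Xv v) v - col_mx (p v) v = col_mx (Xv v) 0.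
    by rewrite opp_col_mx add_col_mx subrr addrC addKr.
  rewrite mul_row_col mulmx0 addr0.
  rewrite -/(rem v) => /le_trans; apply.
  have XvD : `|col_mx (Xv v) (0 : 'cV[R]_q)| <= D * `|v| ^+ k.+1.
    have D' : 0 <= D * `|v| ^+ k.+1 by rewrite mulr_ge0// exprn_ge0.
    apply: col_mx_norm_le; last by rewrite normr0.
    by apply: le_trans (mulmx_norm_le _ _) _; rewrite ler_wpM2l ?kronpow_norm_le.
  rewrite [leRHS]ger0_norm; last by rewrite mulr_ge0 ?exprn_ge0// !mulr_ge0// ltW.
  have -> : C * B2 * D * `|v| ^+ k.+2 = C * (B2 * `|v|) * (D * `|v| ^+ k.+1).
    by rewrite exprS; ring.
  by rewrite ler_wpM2l// mulr_ge0// mulr_ge0// ltW.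
apply: order_near_ext (order_nearD (HT i).2 (order_nearZ (-1) (remO i))) => v.
rewrite !add_sum -/(p v) -/(Xv v).
have TQ : T i v = (Q *m kronpow k.+1 v) i 0.
  by rewrite cE mxE [RHS]mxE; apply: eq_bigr => j _; rewrite mxE.
have XKE : X *m (kronsum k.+1 S *m kronpow k.+1 v) = A *m Xv v - Q *m kronpow k.+1 v.
  have /eqP := XE; rewrite subr_eq => /eqP XK.
  by rewrite mulmxA XK mulmxDl mulNmx addrC mulmxA.
rewrite XKE TQ /res /rem.
move: (A *m Xv v) (Q *m _) (F _) (F _) (\sum_(l < _) _) => a b f g h.
by rewrite !mxE; ring.
Qed.

End formal_solution.

(** * Internal models *)

Section internal_model_principle.
Context {R : realType}.

Lemma horner_mx_sum n (A : 'M[R]_n.+1) (p : {poly R}) :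
  horner_mx A p = \sum_(j < size p) p`_j *: A ^+ j.
Proof.
rewrite -[p in LHS]coefK poly_def rmorph_sum/=; apply: eq_bigr => j _.
by rewrite linearZ/= rmorphXn/= horner_mx_X.
Qed.

Lemma char_poly_sum n (A : 'M[R]_n) :
  \sum_(j < size (char_poly A)) (char_poly A)`_j *: A ^+ j = 0.
Proof.
case: n A => [|n] A; first by apply/matrixP => -[].
by rewrite -horner_mx_sum Cayley_Hamilton.
Qed.

Lemma minpoly_sum n (A : 'M[R]_n) :
  \sum_(j < size (minpoly A)) (minpoly A)`_j *: A ^+ j = 0.
Proof.
case: n A => [|n] A; first by apply/matrixP => -[].
by rewrite -horner_mx_sum mx_root_minpoly.
Qed.

(* Eliminating the state [y_j = Z K^j x] with the Cayley-Hamilton theorem leaves a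
   linear relation between the independent vectors [beta^i sigma], whose leading
   coefficient is the driving term. *)
Lemma controllable_driving_eq0 nb N (beta : 'M[R]_nb) (sigma : 'cV[R]_nb) (K : 'M[R]_N)
    (Z : 'M[R]_(nb, N)) (g : 'rV[R]_N) (x : 'cV[R]_N) :
  controllable beta sigma ->
  (forall j, Z *m (K ^+ j.+1 *m x) = beta *m (Z *m (K ^+ j *m x)) + sigma *m (g *m (K ^+ j *m x))) ->
  \sum_(j < size (char_poly beta)) (char_poly beta)`_j *: (K ^+ j *m x) = 0 ->
  g *m x = 0.
Proof.
case: nb beta sigma Z => [|nb] beta sigma Z ctr step.
  (* For an empty [beta] the characteristic polynomial is 1, and the annihilation hypothesis says
     that [x] is zero. *)
  have monp := char_poly_monic beta.
  rewrite size_char_poly big_ord1 expr0 mul1mx.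
  move: monp; rewrite monicE lead_coefE size_char_poly/= => /eqP ->.
  by rewrite scale1r => ->; rewrite mulmx0.
have CH := char_poly_sum beta; have monp := char_poly_monic beta.
have szp := size_char_poly beta; set p := char_poly beta in CH monp szp *.
move=> px0.
pose c j : R := (g *m (K ^+ j *m x)) 0 0.
pose y j := Z *m (K ^+ j *m x).
have cE (z : 'cV[R]_nb.+1) (s : 'M[R]_1) : z *m s = s 0 0 *: z.
  by apply/matrixP => i j; rewrite ord1 !mxE big_ord1 mulrC.
(* Variation of constants. The predecessor in [j.-1 - i] is harmless at [j = 0], where the sum is
   empty. *)
have yE j : y j = beta ^+ j *m y 0%N + \sum_(i < j) c (j.-1 - i)%N *: (beta ^+ i *m sigma).
  elim: j => [|j IH]; first by rewrite big_ord0 addr0 expr0 mul1mx.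
  rewrite /y step -/(y j) IH mulmxDr mulmxA mulmxE -exprS -addrA; congr (_ + _).
  rewrite big_ord_recl/= expr0 mul1mx subn0 cE addrC; congr (_ + _).
  rewrite mulmx_sumr; apply: eq_bigr => i _.
  rewrite -scalemxAr mulmxA mulmxE -exprS; congr (c _ *: _).
  by rewrite /bump/= add1n; case: j i {IH} => [[]//|j] i; rewrite subSS.
(* Apply [Z] to the annihilation relation: the free terms cancel by Cayley-Hamilton, and exchanging
   sums collects the coefficient of each [beta ^+ i *m sigma]. *)
have sum0 : \sum_(i < nb.+1) (\sum_(j < nb.+2 | (i < j)%N) p`_j * c (j.-1 - i)%N) *:
    (beta ^+ i *m sigma) = 0.
  have := congr1 (mulmx Z) px0; rewrite mulmx0 mulmx_sumr szp.
  under eq_bigr => j _ do rewrite -scalemxAr -/(y j) yE scalerDr.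
  rewrite big_split/=.
  have -> : \sum_(j < nb.+2) p`_j *: (beta ^+ j *m y 0%N) = 0.
    rewrite -[RHS](mul0mx _ (y 0%N)) -CH szp mulmx_suml.
    by apply: eq_bigr => j _; rewrite scalemxAl.
  rewrite add0r => Hsum; apply: etrans Hsum.
  under eq_bigr do rewrite scaler_suml big_mkcond/=.
  rewrite exchange_big/=; apply: eq_bigr => j _; rewrite -big_mkcond/=.
  rewrite (big_ord_widen nb.+1 (fun i => c (j.-1 - i)%N *: (beta ^+ i *m sigma))); last first.
    by rewrite -ltnS.
  by rewrite scaler_sumr; apply: eq_bigr => i _; rewrite scalerA.
pose a : 'cV[R]_nb.+1 := \col_i (\sum_(j < nb.+2 | (i < j)%N) p`_j * c (j.-1 - i)%N).
pose T : 'M[R]_nb.+1 := \matrix_(i, j) (beta ^+ j *m sigma) i 0.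
have Ta : T *m a = 0.
  rewrite -sum0; apply/matrixP => i j; rewrite ord1 mxE summxE; apply: eq_bigr => k _.
  by rewrite !mxE mulrC; congr (_ * _); rewrite mxE.
have uT : T \in unitmx by rewrite -row_full_unit /row_full; apply/eqP; exact: ctr.
have a0 : a = 0 by rewrite -[a](mulKmx uT) Ta mulmx0.
(* In the last coefficient only the leading term of the monic polynomial occurs, times [c 0], which
   is [g *m x]. *)
have : a ord_max 0 = 0 by rewrite a0 mxE.
rewrite mxE (bigD1 ord_max)//= big1 ?addr0 => [|j /andP[jn jm]]; last first.
  by move: jm; rewrite -val_eqE/= => jm; have := ltn_ord j; lia.
rewrite subnn; have := monp; rewrite monicE lead_coefE szp/= => /eqP ->.
rewrite mul1r /c expr0 mul1mx => gx.
by apply/matrixP => i j; rewrite !ord1 gx mxE.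
Qed.

(** The span of the powers [v^(l)] is invariant under the Kronecker sum: differentiate
    [T *m kronpow l] at 0 along the line [v + t S v], on which it vanishes identically. *)
Lemma kronpow_kernel m n l (S : 'M[R]_n) (T : 'M[R]_(m, n ^ l)) :
  (forall v, T *m kronpow l v = 0) ->
  forall j v, T *m (kronsum l S ^+ j *m kronpow l v) = 0.
Proof.
move=> T0 j; elim: j T T0 => [|j IH] T T0 v; first by rewrite expr0 mul1mx.
rewrite exprS -mulmxE -mulmxA mulmxA; apply: IH => {}v.
pose w (t : R) := v + t *: (S *m v).
have dw : is_derive (0 : R) 1 w (S *m w 0).
  rewrite /w scale0r addr0; apply/is_derive_mxP => i k.
  under eq_fun do rewrite !mxE.
  have H1 := is_deriveM_fun (is_derive_id (0 : R) 1) (is_derive_cst ((S *m v) i k) (0 : R) 1).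
  have := is_deriveD_fun (is_derive_cst (v i k) (0 : R) 1) H1.
  by rewrite mul1r mulr0 addr0 add0r !mxE.
have := is_derive_mulmxl T (is_derive_kronpow l dw).
have -> : (fun s => T *m kronpow l (w s)) = (fun=> 0) by apply/funext => s; exact: T0.
move=> [_]; rewrite derive_cst /w scale0r addr0 mulmxA => H; exact: esym H.
Qed.

Variables (nv k : nat) (S : 'M[R]_nv).
Variables (M_ : forall l, 'M[R]_(nmon nv l, nv ^ l)) (N_ : forall l, 'M[R]_(nv ^ l, nmon nv l)).
Hypothesis MN_conv : forall l, (1 <= l)%N -> conversion_mx (M_ l) (N_ l).

(** [N_ l *m M_ l] is the identity on powers, though not on all tensors; the invariance of their
    span extends this to the iterates of the Kronecker sum. *)
Lemma conversion_invariant l j v : (1 <= l)%N ->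
  N_ l *m (M_ l *m (kronsum l S ^+ j *m kronpow l v)) = kronsum l S ^+ j *m kronpow l v.
Proof.
move=> l1; have T0 v' : (N_ l *m M_ l - 1%:M) *m kronpow l v' = 0.
  have [m1 m2] := MN_conv l1 v'.
  by rewrite mulmxBl mul1mx -mulmxA -m1 -m2 subrr.
have := @kronpow_kernel _ _ l S _ T0 j v.
by rewrite mulmxBl mul1mx -mulmxA => /eqP; rewrite subr_eq0 => /eqP.
Qed.

(** The stacked vectors [u j] are the iterates of the k-fold matrix on [u 0], so its minimal
    polynomial kills their combination; block [l], multiplied by [N_], brings the relation back to
    the tensor space. *)
Lemma minpoly_kfold_kronsum (l : 'I_k) (v : 'cV[R]_nv) :
  let m := minpoly (kfold k M_ N_ S) in
  \sum_(j < size m) m`_j *: (kronsum l.+1 S ^+ j *m kronpow l.+1 v) = 0.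
Proof.
move=> m.
pose u j := \mxcol_(i < k) (M_ i.+1 *m (kronsum i.+1 S ^+ j *m kronpow i.+1 v)).
have uE j : kfold k M_ N_ S ^+ j *m u 0%N = u j.
  elim: j => [|j IH]; first by rewrite expr0 mul1mx.
  rewrite exprS -mulmxE -mulmxA IH /kfold mul_mxdiag_mxcol.
  apply/eq_mxcol => i; rewrite /lifted -!mulmxA conversion_invariant//.
  by rewrite exprS -mulmxE -!mulmxA.
have : \sum_(j < size m) m`_j *: u j = 0.
  rewrite -[RHS](mul0mx _ (u 0%N)) -(minpoly_sum (kfold k M_ N_ S)) mulmx_suml.
  by apply: eq_bigr => j _; rewrite -scalemxAl uE.
move=> /(congr1 (fun U => submxcol U l)); rewrite submxcol0 submxcol_sum => H.
have {}H : \sum_(j < size m) m`_j *: (M_ l.+1 *m (kronsum l.+1 S ^+ j *m kronpow l.+1 v)) = 0.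
  rewrite -[RHS]H; apply: eq_bigr => j _.
  have sZ (a : R) (U : 'cV[R]_(\sum_(i < k) nmon nv i.+1)) :
      submxcol (a *: U) l = a *: submxcol U l.
    by apply/matrixP => s t; rewrite !mxE.
  by rewrite sZ mxcolK.
have := congr1 (mulmx (N_ l.+1)) H; rewrite mulmx0 mulmx_sumr => {}H.
rewrite -[RHS]H; apply: eq_bigr => j _.
by rewrite -scalemxAr conversion_invariant.
Qed.

(** The block diagonal pair splits into [ny] copies: block [i] of [Z] is driven through [sigma] by
    component [i] of the error alone, which leaves scalar driving terms. *)
Lemma internal_model_error_eq0 ny nz (G1 : 'M[R]_nz) (G2 : 'M[R]_(nz, ny)) (l : 'I_k)
    (Z : 'M[R]_(nz, nv ^ l.+1)) (Gam : 'M[R]_(ny, nv ^ l.+1)) :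
  internal_model (kfold k M_ N_ S) G1 G2 ->
  (forall v, (Z *m kronsum l.+1 S - G1 *m Z - G2 *m Gam) *m kronpow l.+1 v = 0) ->
  forall v, Gam *m kronpow l.+1 v = 0.
Proof.
move=> im; case: nz G1 G2 / im Z => nb beta sigma pE ctr Z T0 v.
apply/row_matrixP => i; rewrite row0 row_mul.
apply: (controllable_driving_eq0 (K := kronsum l.+1 S) (Z := submxcol Z i) ctr); last first.
  by rewrite pE; exact: minpoly_kfold_kronsum.
move=> j; have := kronpow_kernel S T0 j v.
rewrite !mulmxBl -!mulmxA => /eqP; rewrite subr_eq0 subr_eq => /eqP.
move=> /(congr1 (fun U => submxcol U i)).
set x := kronsum _ S ^+ j *m _.
rewrite submxcolD mxcol_mul mxcolK -!mulmxA -rowE -[Z *m x]submxcolK mul_mxdiag_mxcol mxcolK.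
rewrite !submxcol_mul row_mul exprS -mulmxE -mulmxA -/x => ->.
by rewrite addrC.
Qed.

End internal_model_principle.

(** * Regulation *)

Section regulation.
Context {R : realType}.
Variables (n q ny k : nat) (F : 'cV[R]_(n + q) -> 'cV[R]_n) (hh : 'cV[R]_(n + q) -> 'cV[R]_ny).
Variables (A P0 : 'M[R]_n) (E : 'M[R]_(n, q)) (S H : 'M[R]_q).
Hypothesis F_class : forall m i, class_C m (fun y => F y i 0).
Hypothesis F_diff : forall i v, 'd (fun y => F y i 0) 0 v = (row_mx A E *m v) i 0.
Hypothesis F0 : F 0 = 0.
Hypothesis hh_class : forall m j, class_C m (fun y => hh y j 0).
Hypothesis pP : posdef P0.
Hypothesis nA : negdef (A *m P0 + P0 *m A^T).
Hypothesis inv : invariant_under S H.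
Hypothesis hh_formal : forall P P' : nat -> 'cV[R]_q -> 'cV[R]_n,
  (forall l, hpart S l (P l) (P' l)) -> P 0%N = (fun=> 0) ->
  (forall i, order_near k.+1 (fun v => (\sum_(l < k.+1) P' l v
      - F (col_mx (\sum_(l < k.+1) P l v) v)) i 0)) ->
  forall j, order_near k.+1 (fun v => hh (col_mx (\sum_(l < k.+1) P l v) v) j 0).

Lemma locally_lipschitz m N (g : 'cV[R]_m -> 'cV[R]_N) :
  (forall j, class_C 2 (fun y => g y j 0)) ->
  exists L r : R, [/\ 0 < L, 0 < r & forall x y, `|x| <= r -> `|y| <= r ->
    `|g x - g y| <= L * `|x - y|].
Proof.
move=> cg.
pose Dg : 'M[R]_(N, m) := \matrix_(i, j) 'D_(delta_mx j 0) (fun y => g y i 0) 0.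
have dg i v : 'd (fun y => g y i 0) 0 v = (Dg *m v) i 0.
  have dgi : differentiable (fun y => g y i 0) 0 by case: (cg i).
  rewrite diff_coord// mxE; apply: eq_bigr => j _; rewrite mxE.
  by rewrite mulrC.
have [C [r [C0 r0 Hr]]] := quadratic_remainder_mx cg dg.
exists (C * r + m%:R * `|Dg| + 1), r; split=> //.
  by rewrite ltr_wpDl// addr_ge0 ?mulr_ge0// ltW.
move=> x y xr yr; have := Hr r x y (lexx r) xr yr => Hxy.
rewrite -(subrK (Dg *m (x - y)) (g x - g y)); apply: le_trans (ler_normD _ _) _.
apply: (@le_trans _ _ (C * r * `|x - y| + m%:R * `|Dg| * `|x - y|)).
  by apply: lerD; [exact: Hxy|exact: mulmx_norm_le].
by rewrite -mulrDl ler_wpM2r// lerDl.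
Qed.

(** On the polynomial graph the error is of order [k + 1] by [hh_formal]; the local Lipschitz bound
    on [hh] transfers this to the true graph, which is that close. *)
Lemma formal_graph_order W a C eps N r (pi : 'cV[R]_q -> 'cV[R]_n) (c : R) :
  0 < r -> contracting_field A E W a C eps S H N ->
  (forall x w, `|x| <= r -> `|w| <= r -> field A E N x w = F (col_mx x w)) ->
  (forall v, `|pi v| <= c * `|v|) ->
  (forall w, flow S w -> traj A E N w (fun t => pi (w t))) ->
  order_near k.+1 (fun v => `|hh (col_mx (pi v) v)|).
Proof.
move=> r0 CF fieldE pic piT.
have [Cq [rq [Cq0 rq0 Frem]]] := quadratic_remainder_mx (F_class 2) F_diff.
have syl l (Q : 'M[R]_(n, q ^ l)) : exists X : 'M[R]_(n, q ^ l), X *m kronsum l S - A *m X = Q.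
  exact: (sylvester_solvable Q (cf_posdef CF) (cf_a CF) (cf_eps CF) (cf_lyapunov CF) inv).
have F_jet K i : jet K (fun y => F y i 0) by apply: taylor; exact: F_class.
have [P [P' [hP P00 PO]]] := formal_solution F_jet F0 Cq0 rq0 Frem syl k.
pose p v := \sum_(l < k.+1) P l v.
have [B [r1 [B0 r10 HB]]] := graph_order k hP P00.
have [Cr [r2 [Cr0 r20 HCr]]] := order_near_mx PO.
pose r3 := Num.min (Num.min r1 r2) (Num.min r (r / (B + 1))).
have B1 : 0 < B + 1 by rewrite ltr_wpDl.
have r30 : 0 < r3 by rewrite !lt_min r10 r20 r0 divr_gt0.
have pr v : `|v| <= r3 -> [/\ `|col_mx (p v) v| <= B * `|v|, `|p v| <= r, `|v| <= r &
    `|\sum_(l < k.+1) P' l v - F (col_mx (p v) v)| <= Cr * `|v| ^+ k.+1].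
  rewrite !le_min => /andP[/andP[v1 v2] /andP[v3 v4]].
  have cB : `|col_mx (p v) v| <= B * `|v|.
    by have := HB v v1; rewrite normr_id expr1.
  split=> //; last by have := HCr v v2; rewrite normr_id.
  have -> : p v = usubmx (col_mx (p v) v) by rewrite col_mxKu.
  apply: le_trans (usubmx_norm_le _) _; apply: le_trans cB _.
  apply: (@le_trans _ _ ((B + 1) * `|v|)); first by rewrite ler_wpM2r// lerDl.
  by rewrite mulrC -ler_pdivlMr.
have dp (w : R -> 'cV[R]_q) : flow S w -> forall t : R,
    is_derive t 1 (fun t => p (w t)) (\sum_(l < k.+1) P' l (w t)).
  move=> fw t; apply: is_derive_sum_fun => l; have [X [XP XP']] := hP l.
  under eq_fun do rewrite XP; rewrite XP'.
  by apply: is_derive_mulmxl; exact: is_derive_kronpow.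
have Hrho w : flow S w -> (forall t, `|w t| <= r3) -> exists rho : R -> 'cV[R]_n,
    (forall t : R, is_derive t 1 (fun t => p (w t)) (field A E N (p (w t)) (w t) - rho t)) /\
    forall t, `|rho t| <= Cr * `|w t| ^+ k.+1.
  move=> fw wr3; exists (fun t => F (col_mx (p (w t)) (w t)) - \sum_(l < k.+1) P' l (w t)).
  split=> t; have [_ pt wt Ht] := pr _ (wr3 t); last by rewrite distrC.
  by rewrite fieldE// subKr; exact: dp.
have pb v : `|v| <= r3 -> `|p v| <= r by move=> /pr[].
have [C' [r' [C'0 r'0 Hpi]]] := graph_approx CF pic piT r30 Cr0 Hrho pb.
have [L [rL [L0 rL0 HL]]] := locally_lipschitz (hh_class 2).
have [Ch [rh [Ch0 rh0 Hh]]] := order_near_mx (hh_formal hP P00 PO).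
pose c' := `|c| + 1; have c'0 : 0 < c' by rewrite ltr_wpDl.
pose r4 := Num.min (Num.min r3 r') (Num.min rh (Num.min rL (Num.min (rL / c') (rL / (B + 1))))).
exists (Ch + L * C'), r4; split.
- by rewrite addr_ge0// mulr_ge0// ltW.
- by rewrite lt_min lt_min r30 r'0 !lt_min rh0 rL0 !divr_gt0.
move=> v; rewrite /r4 le_min => /andP[]; rewrite le_min => /andP[v3 v'].
rewrite !le_min => /and4P[vh vL vc vB].
have [cB _ _ _] := pr v v3.
have y1 : `|col_mx (pi v) v| <= rL.
  apply: col_mx_norm_le => //; apply: le_trans (pic v) _.
  apply: (@le_trans _ _ (c' * `|v|)); first by rewrite ler_wpM2r// /c' ler_wpDr// ler_norm.
  by rewrite mulrC -ler_pdivlMr.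
have y2 : `|col_mx (p v) v| <= rL.
  apply: le_trans cB _; apply: (@le_trans _ _ ((B + 1) * `|v|)).
    by rewrite ler_wpM2r// lerDl.
  by rewrite mulrC -ler_pdivlMr.
rewrite normr_id -(subrK (hh (col_mx (p v) v)) (hh _)).
apply: le_trans (ler_normD _ _) _; rewrite addrC mulrDl lerD//.
  by have := Hh v vh; rewrite normr_id.
apply: le_trans (HL _ _ y1 y2) _; rewrite -mulrA ler_wpM2l ?(ltW L0)//.
rewrite opp_col_mx add_col_mx subrr; apply: col_mx_norm_le; first exact: Hpi.
by rewrite normr0 mulr_ge0// exprn_ge0.
Qed.

(** Existence comes from the saturated system. The remaining claims concern every solution of the
    true system, so each one is trapped near the origin first; uniqueness in [xi] is never
    invoked. *)
Lemma regulation : exists (delta : R) (o : 'cV[R]_q -> 'cV[R]_ny), [/\ 0 < delta,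
  order_near k.+1 (fun v => `|o v|),
  (forall xi0 v0, `|xi0| < delta -> `|v0| < delta ->
    exists (xi : R -> 'cV[R]_n) (w : R -> 'cV[R]_q), [/\ xi 0 = xi0, w 0 = v0,
      continuous xi, flow S w & forall t : R, 0 < t -> is_derive t 1 xi (F (col_mx (xi t) (w t)))]) &
  (forall xi v, evolves xi (fun t => F (col_mx (xi t) (v t))) ->
    evolves v (fun t => S *m v t) -> `|xi 0| < delta -> `|v 0| < delta ->
    (exists c : R, forall t, 0 <= t -> `|col_mx (xi t) (v t)| <= c) /\
    (hh (col_mx (xi t) (v t)) - o (v t)) @[t --> +oo] --> (0 : 'cV[R]_ny))].
Proof.
have [W [a [C [eps [pW a0 C0 eps0 Ly]]]]] := lyapunov_exists pP nA.
have [N [r [r0 CF fieldE]]] :=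
  saturated_contracting_field (F_class 2) F_diff F0 pW a0 C0 eps0 Ly inv.
have [pi [c [c0 pic piT]]] := invariant_graph CF.
have [L [rL [L0 rL0 HL]]] := locally_lipschitz (hh_class 2).
have [b b0 Hb] := flow_bounded inv.
have [c1 [K [c10 K0 H1 HK]]] := norm_form_bounds CF.
have [cT cT0 HT] := traj_ge_bound CF.
(* Within radius [s] the true and saturated fields agree and [hh] is Lipschitz. *)
pose s := Num.min r rL; have s0 : 0 < s by rewrite lt_min r0.
pose K1 := (q%:R * `|E| + eps) * b.
have K10 : 0 < K1 by rewrite mulr_gt0// ltr_wpDl// mulr_ge0.
(* [M] dominates every factor by which initial data smaller than [d] may grow: exosystem, graph,
   constructed solution and, strictly, the two levels of the barrier argument. *)
pose M := b + c * b + 2 * cT + K / c1 + C * K1 ^+ 2 / a / c1 + 1.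
have k1 : 0 < c * b by rewrite mulr_gt0.
have k2 : 0 < 2 * cT by rewrite mulr_gt0.
have k3 : 0 < K / c1 by rewrite divr_gt0.
have k4 : 0 < C * K1 ^+ 2 / a / c1 by rewrite !divr_gt0// mulr_gt0// exprn_gt0.
have [[M1 Mb Mc] [MT MK MC]] : [/\ 1 <= M, b <= M & c * b <= M] /\
    [/\ 2 * cT <= M, K / c1 < M & C * K1 ^+ 2 / a / c1 < M].
  rewrite /M; move: (c * b) (2 * cT) (K / c1) (C * _ / _ / _) k1 k2 k3 k4 => x1 x2 x3 x4 *.
  by split; split; lra.
have M0 : 0 < M by apply: lt_le_trans M1.
pose d := s / M; have d0 : 0 < d by rewrite divr_gt0.
have le_s (u z : R) : 0 <= u -> u <= M -> 0 <= z -> z < d -> u * z <= s.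
  move=> u0 uM z0 zd; apply: (@le_trans _ _ (M * d)).
    by apply: ler_pM => //; exact: ltW.
  by rewrite /d mulrC divfK ?gt_eqF.
(* The sublevel set [qform W x < rho] lies in the ball of radius [s]. *)
pose rho := c1 * s ^+ 2.
have lt_rho (u z : R) : 0 <= u -> u / c1 < M -> 0 <= z -> z < d -> u * z ^+ 2 < rho.
  move=> u0 uM z0 zd; apply: (@le_lt_trans _ _ (u * d ^+ 2)).
    by rewrite ler_wpM2l// lerXn2r ?nnegrE// ltW.
  rewrite /rho /d expr_div_n mulrA ltr_pdivrMr ?exprn_gt0// mulrAC.
  rewrite ltr_pM2r ?exprn_gt0//; rewrite ltr_pdivrMr// mulrC in uM.
  apply: lt_le_trans uM _; rewrite ler_wpM2l ?(ltW c10)//.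
  by rewrite expr2 ler_peMr// ltW.
exists d, (fun v => hh (col_mx (pi v) v)); split=> //.
- exact: formal_graph_order r0 CF fieldE pic piT.
- move=> xi0 v0 xi0d v0d; have [w [w0 fw]] := linear_flow S v0.
  have [xi tx xi0E] := traj_exists CF 0 xi0 fw.
  have cxi := traj_continuous tx.
  exists xi, w; split=> // t t0; rewrite -fieldE; first exact: tx.
    have cx : {within `[0, +oo[, continuous xi} by exact: continuous_subspaceT.
    have := HT w xi 0 fw cx (fun t _ => tx t) t (ltW t0).
    rewrite xi0E w0 => /le_trans; apply.
    apply: (@le_trans _ _ (2 * cT * Num.max `|xi0| `|v0|)).
      rewrite (mulrC 2) -mulrA ler_wpM2l ?(ltW cT0)// mulr_natl mulr2n lerD//.
        by rewrite le_max lexx.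
      by rewrite le_max lexx orbT.
    apply: (@le_trans _ _ s); last by rewrite ge_min lexx.
    by apply: le_s => //; [exact: ltW|rewrite gt_max xi0d].
  apply: (@le_trans _ _ s); last by rewrite ge_min lexx.
  by apply: le_trans (Hb w fw 0 t) _; rewrite w0; apply: le_s => //; exact: ltW.
move=> xi v [cxi dxi] ev xi0d v0d; have [w [w0 fw]] := linear_flow S (v 0).
have vw t : 0 <= t -> v t = w t by apply: flow_unique inv ev fw _ _.
have ws t : `|w t| <= s.
  by apply: le_trans (Hb w fw 0 t) _; rewrite w0; apply: le_s => //; exact: ltW.
have pis t : `|pi (w t)| <= s.
  apply: le_trans (pic _) _; apply: (@le_trans _ _ (c * (b * `|w 0|))).
    by rewrite ler_wpM2l ?(ltW c0)//; exact: Hb.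
  by rewrite mulrA w0; apply: le_s => //; exact: ltW.
have sr : s <= r by rewrite ge_min lexx.
have srL : s <= rL by rewrite ge_min lexx orbT.
have V_s x : qform W x < rho -> `|x| <= s.
  move=> Vx; have := le_lt_trans (H1 x) Vx; rewrite /rho ltr_pM2l// => xs.
  by rewrite -(ler_pXn2r (n := 2))// ?nnegrE ?(ltW s0)// ltW.
have dq (t : R) (t0 : 0 < t) := is_derive_qform (proj1 pW) (dxi t t0).
have xis t : 0 <= t -> `|xi t| <= s.
  move=> t0; apply: (V_s (xi t)).
  (* Inside the sublevel set the true field is the saturated one. Relative to the zero state, its
     disturbance is [field A E N 0 w], bounded by [K1] times the initial exosystem state. *)
  apply: (barrier (b := C * K1 ^+ 2 * `|v 0| ^+ 2) a0
    (qform_within_continuous (M := W) cxi) dq) => //.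
  - move=> r' r'0 Vr; have xr := V_s _ Vr; rewrite vw ?(ltW r'0)//.
    rewrite -fieldE ?(le_trans xr)// ?(le_trans (ws r'))//.
    have -> : field A E N (xi r') (w r') = A *m xi r' +
        (N (xi r') (w r') - N 0 (w r')) + field A E N 0 (w r').
      rewrite /field mulmx0 add0r.
      move: (A *m _) (E *m _) (N (xi r') _) (N 0 _) => u1 u2 u3 u4.
      by apply/matrixP => i j; rewrite !mxE; ring.
    have lip := cf_lipschitz CF (xi r') 0 (w r'); rewrite subr0 in lip.
    apply: le_trans (cf_lyapunov CF (field A E N 0 (w r')) lip) _.
    rewrite lerD2l -mulrA ler_wpM2l ?(ltW C0)// -exprMn.
    rewrite lerXn2r ?nnegrE ?normr_ge0 ?(mulr_ge0 (ltW K10) (normr_ge0 _))//.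
    apply: le_trans (field0_le CF _) _; rewrite /K1 -mulrA; apply: ler_wpM2l.
      by rewrite addr_ge0 ?mulr_ge0// ltW.
    by rewrite -w0; exact: Hb.
  - by apply: le_lt_trans (HK _) _; apply: lt_rho => //; exact: ltW.
  - by rewrite mulrAC; apply: lt_rho => //; apply: divr_ge0 (ltW a0); exact: mulr_ge0 (ltW C0) (sqr_ge0 _).
have dxi' (t : R) : 0 < t -> is_derive t 1 xi (field A E N (xi t) (w t)).
  move=> t0; rewrite fieldE ?(le_trans (ws t))// ?(le_trans (xis t (ltW t0)))//.
  by rewrite -vw ?(ltW t0)//; exact: dxi.
split.
  by exists s => t t0; apply: col_mx_norm_le; rewrite ?vw ?xis ?ws.
have [D HD] := graph_attracts CF fw (piT w fw) cxi dxi'.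
apply/cvgrPdist_lt => e e0; near=> t.
have t0 : 0 <= t by near: t; exact: nbhs_pinfty_ge.
have tT : 2 / a * ((L * `|D| + 1) / e) <= t by near: t; apply: nbhs_pinfty_ge; exact: num_real.
rewrite sub0r normrN vw//.
apply: le_lt_trans (HL _ _ _ _) _.
- by apply: col_mx_norm_le; [exact: le_trans (xis t t0) srL|exact: le_trans (ws t) srL].
- by apply: col_mx_norm_le; [exact: le_trans (pis t) srL|exact: le_trans (ws t) srL].
apply: (@le_lt_trans _ _ (L * `|D| * expR (- a / 2 * t))).
  rewrite -mulrA ler_wpM2l ?(ltW L0)// opp_col_mx add_col_mx subrr.
  apply: col_mx_norm_le; last by rewrite normr0 mulr_ge0 ?expR_ge0.
  apply: le_trans (HD t t0) _; by rewrite ler_wpM2r ?expR_ge0// ler_norm.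
(* By [expR u >= 1 + u], the decaying bound is below [e] once [u = a / 2 * t] reaches
   [(L |D| + 1) / e]. *)
rewrite !mulNr expRN ltr_pdivrMr ?expR_gt0//.
have LD : 0 <= L * `|D| by rewrite mulr_ge0// ltW.
have : (L * `|D| + 1) / e <= a / 2 * t.
  have := ler_wpM2l (_ : 0 <= a / 2) tT; rewrite mulrA => H2.
  have E1 : a / 2 * (2 / a) = 1 by field; rewrite gt_eqF.
  by rewrite E1 mul1r in H2; apply: H2; rewrite divr_ge0// ltW.
rewrite ler_pdivrMr// => H2.
have H3 : e * (1 + a / 2 * t) <= e * expR (a / 2 * t).
  by rewrite ler_wpM2l ?(ltW e0)// expR_ge1Dx.
apply: lt_le_trans H3; rewrite mulrDr mulr1 (mulrC e (_ * t)); lra.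
Unshelve. all: by end_near. Qed.

End regulation.

(** * Order of the error *)

Section internal_model_order.
Context {R : realType}.
Variables (nx nz ny nv k : nat) (S : 'M[R]_nv).
Variables (M_ : forall l, 'M[R]_(nmon nv l, nv ^ l)) (N_ : forall l, 'M[R]_(nv ^ l, nmon nv l)).
Variables (G1 : 'M[R]_nz) (G2 : 'M[R]_(nz, ny)).
Variables (F : 'cV[R]_(nx + nz + nv) -> 'cV[R]_(nx + nz)).
Variables (hh : 'cV[R]_(nx + nz + nv) -> 'cV[R]_ny).
Hypothesis MN_conv : forall l, (1 <= l)%N -> conversion_mx (M_ l) (N_ l).
Hypothesis G_im : internal_model (kfold k M_ N_ S) G1 G2.
Hypothesis F_compensator : forall xi v,
  dsubmx (F (col_mx xi v)) = G1 *m dsubmx xi + G2 *m hh (col_mx xi v).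
Hypothesis hh_jet : forall K j, jet K (fun y => hh y j 0).
Hypothesis hh0 : hh 0 = 0.

(** The compensator receives the error, so the lower block of a small residual constrains it.
    Degrees separate because parts of degree at most [k] with a sum of order [k + 1] are zero. Any
    formal solution will do. *)
Lemma internal_model_order (P P' : nat -> 'cV[R]_nv -> 'cV[R]_(nx + nz)) :
  (forall l, hpart S l (P l) (P' l)) -> P 0%N = (fun=> 0) ->
  (forall i, order_near k.+1 (fun v => (\sum_(l < k.+1) P' l v
      - F (col_mx (\sum_(l < k.+1) P l v) v)) i 0)) ->
  forall j, order_near k.+1 (fun v => hh (col_mx (\sum_(l < k.+1) P l v) v) j 0).
Proof.
move=> hP P00 PO.
have /choice[T HT] j := graph_jet k j hP P00 (hh_jet k.+1).
have /choice[c cE] j : exists c : forall d, 'rV[R]_(nv ^ d),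
    forall d v, T j d v = (c d *m kronpow d v) 0 0.
  have hT d : {c : 'rV[R]_(nv ^ d) | forall v, T j d v = (c *m kronpow d v) 0 0}.
    by apply: cid; exact: (HT j).1.
  by exists (fun d => sval (hT d)) => d; exact: svalP (hT d).
have [X XE] : exists X : forall l, 'M[R]_(nx + nz, nv ^ l), forall l,
    (forall v, P l v = X l *m kronpow l v) /\
    (forall v, P' l v = X l *m (kronsum l S *m kronpow l v)).
  by exists (fun l => sval (cid (hP l))) => l; exact: svalP (cid (hP l)).
pose Gam d : 'M[R]_(ny, nv ^ d) := \matrix_(j, i) c j d 0 i.
have GamE d v j : (Gam d *m kronpow d v) j 0 = T j d v.
  by rewrite cE !mxE; apply: eq_bigr => i _; rewrite mxE.
have {}GamE d v : Gam d *m kronpow d v = \col_j T j d v.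
  by apply/matrixP => j i; rewrite ord1 GamE mxE.
move: Gam GamE => Gam GamE.
pose Z l := dsubmx (X l).
pose Q d := Z d *m kronsum d S - G1 *m Z d - G2 *m Gam d.
have Q0 (d : nat) : (d < k.+1)%N -> forall v, Q d *m kronpow d v = 0.
  move=> dk v; apply/matrixP => i j; rewrite ord1 [RHS]mxE {j}.
  apply: (@homog_sum_order_near_eq0 R nv k.+1 (fun d v => (Q d *m kronpow d v) i 0)) => //.
    by move=> e; exists (row i (Q e)) => w; rewrite -row_mul [RHS]mxE.
  (* [F] contains the true error; adding [G2] times its Taylor remainder leaves only polynomial
     parts. *)
  have H2 : order_near k.+1 (fun v => \sum_j G2 i j *
      (hh (col_mx (\sum_(l < k.+1) P l v) v) j 0 - \sum_(d < k.+1) T j d v)).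
    apply: (order_near_sum (index_enum _) (f := fun j v => G2 i j *
      (hh (col_mx (\sum_(l < k.+1) P l v) v) j 0 - \sum_(d < k.+1) T j d v))) => j.
    exact: order_nearZ (HT j).2.
  apply: order_near_ext (order_nearD (PO (rshift nx i)) H2) => w.
  have -> : \sum_(d < k.+1) (Q d *m kronpow d w) i 0 = (dsubmx (\sum_(l < k.+1) P' l w)
      - G1 *m dsubmx (\sum_(l < k.+1) P l w) - G2 *m (\col_j \sum_(d < k.+1) T j d w)) i 0.
    have sumQ : \sum_(d < k.+1) Q d *m kronpow d w = dsubmx (\sum_(l < k.+1) P' l w)
        - G1 *m dsubmx (\sum_(l < k.+1) P l w) - G2 *m (\col_j \sum_(d < k.+1) T j d w).
      have -> : \col_j \sum_(d < k.+1) T j d w = \sum_(d < k.+1) Gam d *m kronpow d w.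
        by apply/matrixP => j1 j2; rewrite summxE mxE; apply: eq_bigr => d' _; rewrite GamE mxE.
      rewrite !linear_sum/= -!big_split/=; apply: eq_bigr => d' _.
      rewrite /Q !mulmxBl -!mulmxA; congr (_ - _ - _).
        by rewrite (XE d').2 /Z mul_dsub_mx.
      by rewrite (XE d').1 /Z mul_dsub_mx.
    by rewrite -sumQ summxE.
  have -> : (\sum_(l < k.+1) P' l w - F (col_mx (\sum_(l < k.+1) P l w) w)) (rshift nx i) 0 =
      (dsubmx (\sum_(l < k.+1) P' l w) - (G1 *m dsubmx (\sum_(l < k.+1) P l w)
        + G2 *m hh (col_mx (\sum_(l < k.+1) P l w) w))) i 0.
    by rewrite -F_compensator -linearB/= [RHS]mxE.
  have -> : \sum_j G2 i j * (hh (col_mx (\sum_(l < k.+1) P l w) w) j 0 - \sum_(d < k.+1) T j d w) =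
     (G2 *m (hh (col_mx (\sum_(l < k.+1) P l w) w) - \col_j \sum_(d < k.+1) T j d w)) i 0.
    by rewrite [RHS]mxE; apply: eq_bigr => j _; rewrite !mxE.
  rewrite mulmxBr; move: (dsubmx _) (G1 *m _) (G2 *m hh _) (G2 *m (\col__ _)) => u1 u2 u3 u4.
  by rewrite !mxE; ring.
have T0 j (d : nat) v : (d < k)%N -> T j d.+1 v = 0.
  move=> dk; have := internal_model_error_eq0 MN_conv (l := Ordinal dk) G_im
    (Q0 d.+1 dk) v.
  by rewrite GamE => /matrixP/(_ j 0); rewrite !mxE.
move=> j; have [hT TO] := HT j.
have sumT v : \sum_(d < k.+1) T j d v = T j 0%N 0.
  rewrite big_ord_recl/= big1 ?addr0; last by move=> d _; exact: T0.
  by rewrite -[0](scale0r v) (homog_scale _ _ (hT 0%N)) mul1r.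
(* The k-fold matrix has blocks of degree 1 to [k], so the constant part escapes the internal model;
   it vanishes because the error does at the origin. *)
have T00 : T j 0%N 0 = 0.
  have [C [r [_ r0 H]]] := TO.
  have := H 0; rewrite normr0 (ltW r0) exprS mul0r mulr0 sumT => /(_ isT).
  have -> : \sum_(l < k.+1) P l 0 = 0.
    apply: big1 => -[[|l] lk] _ /=; first by rewrite P00.
    rewrite (XE l.+1).1 -[X in kronpow _ X](scale0r (0 : 'cV[R]_nv)) kronpowZ.
    by rewrite exprS mul0r scale0r mulmx0.
  by rewrite col_mx0 hh0 mxE sub0r normrN normr_le0 => /eqP.
by apply: order_near_ext TO => v; rewrite sumT T00 subr0.
Qed.

End internal_model_order.

(** * The closed loop *)

Section linear_maps.
Context {R : realType}.

Definition pairing (V A B : normedModType R) (L1 : {linear V -> A}) (L2 : {linear V -> B})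
  (y : V) : A * B := (L1 y, L2 y).

Lemma pairing_linear (V A B : normedModType R) (L1 : {linear V -> A}) (L2 : {linear V -> B}) :
  linear (pairing L1 L2).
Proof. by move=> r y z; rewrite /pairing !linearP. Qed.

HB.instance Definition _ (V A B : normedModType R) (L1 : {linear V -> A}) (L2 : {linear V -> B}) :=
  GRing.isLinear.Build _ _ _ _ (pairing L1 L2) (pairing_linear L1 L2).

Lemma pairing_continuous (V A B : normedModType R) (L1 : {linear V -> A}) (L2 : {linear V -> B}) :
  continuous L1 -> continuous L2 -> continuous (pairing L1 L2).
Proof. by move=> c1 c2 y; apply: (cvg_pair (F := nbhs y) (c1 y) (c2 y)). Qed.

Lemma id_linear_continuous (V : normedModType R) : continuous (@idfun V : {linear V -> V}).
Proof. by apply: (@linear_lipschitz_continuous _ _ _ _ 1) => v; rewrite mul1r. Qed.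

Lemma null_linear_continuous (V W : normedModType R) : continuous (\0 : {linear V -> W}).
Proof. by apply: (@linear_lipschitz_continuous _ _ _ _ 0) => v; rewrite mul0r normr0. Qed.

Lemma mulmx_linear_continuous m n (A : 'M[R]_(n, m)) :
  continuous (mulmx A : 'cV[R]_m -> 'cV[R]_n).
Proof.
apply: (@lipschitz_continuous _ _ _ (m%:R * `|A|)) => u v.
by rewrite -mulmxBr mulmx_norm_le.
Qed.

Lemma coord_linear m (i : 'I_m) : linear (fun y : 'cV[R]_m => y i 0).
Proof. by move=> r y z; rewrite !mxE. Qed.

Lemma class_C_coord (V : normedModType R) m n (g : V -> 'cV[R]_n) (i : 'I_n) :
  class_C m g -> class_C m (fun y => g y i 0).
Proof.
pose L : {linear 'cV[R]_n -> R} := HB.pack (fun y : 'cV[R]_n => y i 0)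
  (GRing.isLinear.Build _ _ _ _ (fun y : 'cV[R]_n => y i 0) (coord_linear i)).
move=> cg; apply: (class_C_postcomp (L := L)) cg.
by apply: (@linear_lipschitz_continuous _ _ _ L 1) => v; rewrite mul1r; exact: mx_entry_le.
Qed.

Lemma class_C_mulmx m p n (A : 'M[R]_(p, n)) : class_C m (mulmx A : 'cV[R]_n -> 'cV[R]_p).
Proof. by apply: class_C_linear; exact: mulmx_linear_continuous. Qed.

Lemma is_derive_comp_linear (V W : normedModType R) m (g : V -> W) (L : {linear 'cV[R]_m -> V}) w :
  continuous L -> differentiable g 0 ->
  is_derive (0 : 'cV[R]_m) w (g \o L) ('d g 0 (L w)).
Proof.
move=> cL dg; have L0 : L 0 = 0 by rewrite linear0.
have dL : differentiable L (0 : 'cV[R]_m) by exact: linear_differentiable.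
rewrite -L0 in dg.
apply: DeriveDef; first by apply: diff_derivable; exact: differentiable_comp.
rewrite deriveE; last exact: differentiable_comp.
by rewrite diff_comp//= diff_lin// L0.
Qed.

Lemma jac_mul (V : normedModType R) m n (g : V -> 'cV[R]_n) (L : {linear 'cV[R]_m -> V}) a :
  continuous L -> differentiable g 0 -> jac (g \o L) 0 *m a = 'd g 0 (L a).
Proof.
move=> cL dg; have dgL w := is_derive_comp_linear w cL dg.
have dL : differentiable L (0 : 'cV[R]_m) by exact: linear_differentiable.
have dg' : differentiable g (L 0) by rewrite linear0.
have dgl : differentiable (g \o L) (0 : 'cV[R]_m) by exact: differentiable_comp.
have <- : 'D_a (g \o L) 0 = 'd g 0 (L a) by exact: derive_val.
rewrite deriveE// diff_coord//; apply/matrixP => i j; rewrite ord1 mxE summxE.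
by apply: eq_bigr => l _; rewrite !mxE mulrC.
Qed.

End linear_maps.

(** * The closed loop as a vector field in stacked coordinates *)

Section closed_loop_field.
Context {R : realType}.
Variables (nx nu nv ny nz : nat).
Variables (f : 'cV[R]_nx * 'cV[R]_nu * 'cV[R]_nv -> 'cV[R]_nx).
Variables (h : 'cV[R]_nx * 'cV[R]_nv -> 'cV[R]_ny).
Variables (K : 'M[R]_(nu, nx + nz)) (G1 : 'M[R]_nz) (G2 : 'M[R]_(nz, ny)).
Hypothesis f_smooth : smooth f.
Hypothesis h_smooth : smooth h.

Definition loop_error (y : 'cV[R]_(nx + nz + nv)) : 'cV[R]_ny :=
  h (usubmx (usubmx y), dsubmx y).

Definition loop_field (y : 'cV[R]_(nx + nz + nv)) : 'cV[R]_(nx + nz) :=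
  col_mx (f (usubmx (usubmx y), K *m usubmx y, dsubmx y))
         (G1 *m dsubmx (usubmx y) + G2 *m loop_error y).

Let Mx : 'M[R]_(nx, nx + nz + nv) := usubmx (usubmx 1%:M).
Let Mz : 'M[R]_(nz, nx + nz + nv) := dsubmx (usubmx 1%:M).
Let Mu : 'M[R]_(nu, nx + nz + nv) := K *m usubmx 1%:M.
Let Mv : 'M[R]_(nv, nx + nz + nv) := dsubmx 1%:M.

Let MxE (y : 'cV[R]_(nx + nz + nv)) : Mx *m y = usubmx (usubmx y).
Proof. by rewrite /Mx !mul_usub_mx mul1mx. Qed.

Let MzE (y : 'cV[R]_(nx + nz + nv)) : Mz *m y = dsubmx (usubmx y).
Proof. by rewrite /Mz mul_dsub_mx mul_usub_mx mul1mx. Qed.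

Let MuE (y : 'cV[R]_(nx + nz + nv)) : Mu *m y = K *m usubmx y.
Proof. by rewrite /Mu -mulmxA mul_usub_mx mul1mx. Qed.

Let MvE (y : 'cV[R]_(nx + nz + nv)) : Mv *m y = dsubmx y.
Proof. by rewrite /Mv mul_dsub_mx mul1mx. Qed.

Let Lf := pairing (pairing (mulmx Mx : {linear 'cV[R]_(nx + nz + nv) -> 'cV[R]_nx})
  (mulmx Mu : {linear 'cV[R]_(nx + nz + nv) -> 'cV[R]_nu}))
  (mulmx Mv : {linear 'cV[R]_(nx + nz + nv) -> 'cV[R]_nv}).
Let Lh := pairing (mulmx Mx : {linear 'cV[R]_(nx + nz + nv) -> 'cV[R]_nx})
  (mulmx Mv : {linear 'cV[R]_(nx + nz + nv) -> 'cV[R]_nv}).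

Let LfE y : Lf y = (usubmx (usubmx y), K *m usubmx y, dsubmx y).
Proof. by rewrite -MxE -MuE -MvE. Qed.

Let LhE y : Lh y = (usubmx (usubmx y), dsubmx y).
Proof. by rewrite -MxE -MvE. Qed.

Let cLf : continuous Lf.
Proof.
by do 2?apply: pairing_continuous; exact: mulmx_linear_continuous.
Qed.

Let cLh : continuous Lh.
Proof. by apply: pairing_continuous; exact: mulmx_linear_continuous. Qed.

Let errorE : loop_error = h \o Lh.
Proof. by apply/funext => y /=; rewrite LhE. Qed.

Let fieldE : loop_field = fun y => col_mx ((f \o Lf) y) (G1 *m (Mz *m y) + G2 *m (h \o Lh) y).
Proof. by apply/funext => y /=; rewrite LfE LhE MzE. Qed.

Lemma loop_error_class m : class_C m loop_error.
Proof. by rewrite errorE; apply: class_C_precomp; [exact: cLh|exact: h_smooth]. Qed.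

Lemma loop_field_class m i : class_C m (fun y => loop_field y i 0).
Proof.
rewrite fieldE -(splitK i); case: (fintype.split i) => j /=.
  under eq_fun do rewrite col_mxEu.
  apply: class_C_coord; apply: class_C_precomp; [exact: cLf|exact: f_smooth].
under eq_fun do rewrite col_mxEd.
apply: (class_C_coord (g := fun y => G1 *m (Mz *m y) + G2 *m (h \o Lh) y)).
apply: class_CD.
  under eq_fun do rewrite mulmxA.
  exact: (class_C_mulmx _ (G1 *m Mz)).
apply: (class_C_postcomp (g := h \o Lh) (L := mulmx G2)); first exact: mulmx_linear_continuous.
by apply: class_C_precomp; [exact: cLh|exact: h_smooth].
Qed.

Let A := jac (fun x => f (x, 0, 0)) 0.
Let B := jac (fun w => f (0, w, 0)) 0.
Let E := jac (fun w => f (0, 0, w)) 0.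
Let C := jac (fun x => h (x, 0)) 0.
Let F := jac (fun w => h (0, w)) 0.

Let differentiable_f : differentiable f 0.
Proof. by case: (f_smooth 1%N) => + _; apply. Qed.

Let differentiable_h : differentiable h 0.
Proof. by case: (h_smooth 1%N) => + _; apply. Qed.

Let df a b c : 'd f 0 (a, b, c) = A *m a + B *m b + E *m c.
Proof.
have HA : A *m a = 'd f 0 (a, 0, 0).
  refine (jac_mul (L := pairing (pairing (@idfun 'cV[R]_nx) \0) \0) a _ differentiable_f).
  apply: pairing_continuous; first apply: pairing_continuous.
  - exact: id_linear_continuous.
  - exact: null_linear_continuous.
  - exact: null_linear_continuous.
have HB : B *m b = 'd f 0 (0, b, 0).
  refine (jac_mul (L := pairing (pairing \0 (@idfun 'cV[R]_nu)) \0) b _ differentiable_f).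
  apply: pairing_continuous; first apply: pairing_continuous.
  - exact: null_linear_continuous.
  - exact: id_linear_continuous.
  - exact: null_linear_continuous.
have HE : E *m c = 'd f 0 (0, 0, c).
  refine (jac_mul (L := pairing (pairing \0 \0) (@idfun 'cV[R]_nv)) c _ differentiable_f).
  apply: pairing_continuous; first apply: pairing_continuous.
  - exact: null_linear_continuous.
  - exact: null_linear_continuous.
  - exact: id_linear_continuous.
rewrite HA HB HE.
rewrite -!linearD; congr ('d f 0 _).
transitivity (a + 0 + 0, 0 + b + 0, 0 + 0 + c); last by [].
by rewrite !addr0 !add0r.
Qed.

Let dh a c : 'd h 0 (a, c) = C *m a + F *m c.
Proof.
have HC : C *m a = 'd h 0 (a, 0).
  refine (jac_mul (L := pairing (@idfun 'cV[R]_nx) \0) a _ differentiable_h).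
  by apply: pairing_continuous; [exact: id_linear_continuous|exact: null_linear_continuous].
have HF : F *m c = 'd h 0 (0, c).
  refine (jac_mul (L := pairing \0 (@idfun 'cV[R]_nv)) c _ differentiable_h).
  by apply: pairing_continuous; [exact: null_linear_continuous|exact: id_linear_continuous].
rewrite HC HF.
rewrite -!linearD; congr ('d h 0 _).
transitivity (a + 0, 0 + c); last by [].
by rewrite addr0 add0r.
Qed.

Lemma loop_field_diff i w : 'd (fun y => loop_field y i 0) 0 w =
  (row_mx (block_mx A 0 (G2 *m C) G1 + col_mx B 0 *m K) (col_mx E (G2 *m F)) *m w) i 0.
Proof.
have dfL := is_derive_comp_linear w cLf differentiable_f.
have dhL := is_derive_comp_linear w cLh differentiable_h.
have dz : is_derive (0 : 'cV[R]_(nx + nz + nv)) w (fun y => Mz *m y) (Mz *m w).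
  by apply: is_derive_mulmxl; exact: is_derive_id.
have dlower := is_deriveD_fun (is_derive_mulmxl G1 dz) (is_derive_mulmxl G2 dhL).
have := loop_field_class 1 i => -[/(_ 0) dF _].
rewrite -deriveE//.
have dloop : is_derive (0 : 'cV[R]_(nx + nz + nv)) w loop_field
    (col_mx ('d f 0 (Lf w)) (G1 *m (Mz *m w) + G2 *m 'd h 0 (Lh w))).
  rewrite fieldE; apply/is_derive_mxP => i1 j1; rewrite -(splitK i1).
  case: (fintype.split i1) => i2 /=.
    under eq_fun do rewrite col_mxEu.
    by rewrite col_mxEu; exact: (is_derive_mxP _ _ _ _).1 dfL i2 j1.
  under eq_fun do rewrite col_mxEd.
  by rewrite col_mxEd; exact: (is_derive_mxP _ _ _ _).1 dlower i2 j1.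
have dloopi := (is_derive_mxP _ _ _ _).1 dloop i 0.
apply: etrans (@derive_val _ _ _ _ _ _ _ dloopi) _; congr (_ i 0).
rewrite LfE LhE df dh MzE.
have -> : w = col_mx (col_mx (usubmx (usubmx w)) (dsubmx (usubmx w))) (dsubmx w).
  by rewrite !vsubmxK.
move: (usubmx (usubmx w)) (dsubmx (usubmx w)) (dsubmx w) => x z v.
rewrite !(col_mxKu, col_mxKd) mul_row_col mulmxDl mul_block_col -mulmxA !mul_col_mx.
rewrite !mul0mx addr0 !add_col_mx addr0; congr col_mx.
  by rewrite mulmxA.
by rewrite mulmxDr mulmxA addrCA addrA mulmxA.
Qed.

End closed_loop_field.

Section closed_loop_curves.
Context {R : realType}.

Lemma mulmx_cols m n T (A : 'M[R]_(m, n)) (c : 'I_T -> 'cV[R]_n) :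
  A *m cols c = cols (fun t => A *m c t).
Proof.
by apply/matrixP => i t; rewrite !mxE; apply: eq_bigr => j _; rewrite mxE.
Qed.

Lemma colsD n T (a b : 'I_T -> 'cV[R]_n) : cols (fun t => a t + b t) = cols a + cols b.
Proof. by apply/matrixP => i t; rewrite !mxE. Qed.

Lemma evolves_col_mx n m (x dx : R -> 'cV[R]_n) (z dz : R -> 'cV[R]_m) :
  evolves x dx -> evolves z dz ->
  evolves (fun t => col_mx (x t) (z t)) (fun t => col_mx (dx t) (dz t)).
Proof.
move=> [cx dxE] [cz dzE]; split.
  exact: (col_mx_curve_continuous cx cz).
move=> t t0; apply/is_derive_mxP => i j; rewrite -(splitK i).
case: (fintype.split i) => l /=.
  under eq_fun do rewrite col_mxEu.
  by rewrite col_mxEu; apply: (is_derive_mxP _ _ _ _).1 => //; exact: dxE.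
under eq_fun do rewrite col_mxEd.
by rewrite col_mxEd; apply: (is_derive_mxP _ _ _ _).1 => //; exact: dzE.
Qed.

Lemma evolves_mulmx n m (A : 'M[R]_(m, n)) (y dy : R -> 'cV[R]_n) :
  continuous y -> (forall t : R, 0 < t -> is_derive t 1 y (dy t)) ->
  evolves (fun t => A *m y t) (fun t => A *m dy t).
Proof.
move=> cy dyE; split; first by apply: continuous_subspaceT; exact: mulmx_continuous.
by move=> t t0; apply: is_derive_mulmxl; exact: dyE.
Qed.

Variables (nx nu nv ny nz : nat).
Variables (f : 'cV[R]_nx * 'cV[R]_nu * 'cV[R]_nv -> 'cV[R]_nx).
Variables (h : 'cV[R]_nx * 'cV[R]_nv -> 'cV[R]_ny).
Variables (S : 'M[R]_nv) (K : 'M[R]_(nu, nx + nz)) (G1 : 'M[R]_nz) (G2 : 'M[R]_(nz, ny)).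

Lemma loop_fieldE x z v : loop_field f h K G1 G2 (col_mx (col_mx x z) v) =
  col_mx (f (x, lsubmx K *m x + rsubmx K *m z, v)) (G1 *m z + G2 *m h (x, v)).
Proof.
rewrite /loop_field /loop_error !(col_mxKu, col_mxKd).
by rewrite -[in K *m _](hsubmxK K) mul_row_col.
Qed.

Lemma closed_loop_evolves x z v : closed_loop f h S (lsubmx K) (rsubmx K) G1 G2 x z v ->
  evolves (fun t => col_mx (x t) (z t))
    (fun t => loop_field f h K G1 G2 (col_mx (col_mx (x t) (z t)) (v t))) /\
  evolves v (fun t => S *m v t).
Proof.
move=> [ex ez ev]; split=> //; under [X in evolves _ X]eq_fun do rewrite loop_fieldE.
exact: evolves_col_mx.
Qed.

Lemma closed_loop_exists (xi : R -> 'cV[R]_(nx + nz)) (w : R -> 'cV[R]_nv) :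
  continuous xi -> flow S w ->
  (forall t : R, 0 < t -> is_derive t 1 xi (loop_field f h K G1 G2 (col_mx (xi t) (w t)))) ->
  closed_loop f h S (lsubmx K) (rsubmx K) G1 G2
    (fun t => usubmx (xi t)) (fun t => dsubmx (xi t)) w.
Proof.
move=> cxi fw dxi; split; last first.
  by split=> [|t _]; [apply: continuous_subspaceT; exact: flow_continuous fw|exact: fw].
- have := evolves_mulmx (dsubmx 1%:M) cxi dxi.
  under eq_fun do rewrite mul_dsub_mx mul1mx.
  under [X in evolves _ X]eq_fun => t do
    rewrite mul_dsub_mx mul1mx -{1}(vsubmxK (xi t)) loop_fieldE col_mxKd.
  by [].
have := evolves_mulmx (usubmx 1%:M) cxi dxi.
under eq_fun do rewrite mul_usub_mx mul1mx.
under [X in evolves _ X]eq_fun => t do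
  rewrite mul_usub_mx mul1mx -{1}(vsubmxK (xi t)) loop_fieldE col_mxKu.
by [].
Qed.

End closed_loop_curves.
Theorem theorem3 (R : realType) (k nx nu nv ny nz T nd : nat)
    (hk : (1 <= k)%N)
    (f : 'cV[R]_nx * 'cV[R]_nu * 'cV[R]_nv -> 'cV[R]_nx)
    (h : 'cV[R]_nx * 'cV[R]_nv -> 'cV[R]_ny)
    (S : 'M[R]_nv)
    (f_smooth : smooth f) (h_smooth : smooth h)
    (f0 : f (0, 0, 0) = 0) (h0 : h (0, 0) = 0)
    (S_spectrum : eigenvalues_zero_real_part S)
    (S_semisimple : semisimple S)
    (M_ : forall l, 'M[R]_(nmon nv l, nv ^ l))
    (N_ : forall l, 'M[R]_(nv ^ l, nmon nv l))
    (MN_conv : forall l, (1 <= l)%N -> conversion_mx (M_ l) (N_ l))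
    (G1 : 'M[R]_nz) (G2 : 'M[R]_(nz, ny))
    (G_im : internal_model (kfold k M_ N_ S) G1 G2)
    (u : 'I_T -> 'cV[R]_nu) (xi dxi : 'I_T -> 'cV[R]_(nx + nz))
    (v : 'I_T -> 'cV[R]_nv)
    (Delta : 'M[R]_(nx + nz, nd)) :
  let A := jac (fun x => f (x, 0, 0)) 0 in
  let B := jac (fun w => f (0, w, 0)) 0 in
  let E := jac (fun w => f (0, 0, w)) 0 in
  let C := jac (fun x => h (x, 0)) 0 in
  let F := jac (fun w => h (0, w)) 0 in
  let alpha x u v := f (x, u, v) - (A *m x + B *m u + E *m v) in
  let gamma x v := h (x, v) - (C *m x + F *m v) in
  let A_xi := block_mx A 0 (G2 *m C) G1 in
  let B_xi := col_mx B 0 in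
  let E_xi := col_mx E (G2 *m F) in
  let psi (xi : 'cV[R]_(nx + nz)) u v :=
    col_mx (alpha (usubmx xi) u v) (G2 *m gamma (usubmx xi) v) in
  (forall tau, dxi tau =
     A_xi *m xi tau + B_xi *m u tau + E_xi *m v tau
     + psi (xi tau) (u tau) (v tau)) ->
  let U := cols u in
  let Xi := cols xi in
  let Xi' := cols dxi in
  let V := cols v in
  let D := cols (fun tau => psi (xi tau) (u tau) (v tau)) in
  row_free (col_mx U Xi) ->
  negsemidef ((E_xi *m V + D) *m (E_xi *m V + D)^T - Delta *m Delta^T) ->
  let Psi := col_mx Xi U *m (col_mx Xi U)^T in
  let Upsilon := - (col_mx Xi U *m Xi'^T) in
  let Sigma := Xi' *m Xi'^T - Delta *m Delta^T in
  forall (P : 'M[R]_(nx + nz)) (Y : 'M[R]_(nu, nx + nz)),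
  posdef P ->
  negdef (block_mx (- Sigma) (Upsilon^T - (col_mx P Y)^T)
                   (Upsilon - col_mx P Y) (- Psi)) ->
  let K := Y *m invmx P in
  solves_output_regulation k f h S (lsubmx K) (rsubmx K) G1 G2.
Proof.
move=> A B E C F alpha gamma A_xi B_xi E_xi psi dyn U Xi Xi' V D _ noise.
move=> Psi Upsilon Sigma P Y pP lmi K.
(* The whole unknown term [E_xi *m V + D] takes the place of the noise. *)
have data : Xi' = A_xi *m Xi + B_xi *m U + (E_xi *m V + D).
  rewrite /Xi' (funext dyn) [LHS]colsD [X in X + D]colsD [X in X + _ + D]colsD.
  by rewrite !mulmx_cols !addrA.
have nA := data_lmi_negdef data noise pP lmi.
have [H [pH HS]] := invariant_form S_spectrum S_semisimple.
have F0 : loop_field f h K G1 G2 0 = 0.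
  by rewrite /loop_field /loop_error !linear0 f0 h0 !mulmx0 addr0 col_mx0.
have error0 : loop_error h (0 : 'cV[R]_(nx + nz + nv)) = 0 by rewrite /loop_error !linear0 h0.
have formal := @internal_model_order R nx nz ny nv k S M_ N_ G1 G2 (loop_field f h K G1 G2)
  (loop_error h) MN_conv G_im.
have [delta [err [d0 [Co [ro [Co0 ro0 Ho]]] solve attract]]] :
  exists (delta : R) (o : 'cV[R]_nv -> 'cV[R]_ny), [/\ 0 < delta,
    order_near k.+1 (fun v => `|o v|),
    (forall xi0 v0, `|xi0| < delta -> `|v0| < delta ->
      exists (xi : R -> 'cV[R]_(nx + nz)) (w : R -> 'cV[R]_nv), [/\ xi 0 = xi0, w 0 = v0,
        continuous xi, flow S w &
        forall t : R, 0 < t -> is_derive t 1 xi (loop_field f h K G1 G2 (col_mx (xi t) (w t)))]) &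
    (forall xi v, evolves xi (fun t => loop_field f h K G1 G2 (col_mx (xi t) (v t))) ->
      evolves v (fun t => S *m v t) -> `|xi 0| < delta -> `|v 0| < delta ->
      (exists c : R, forall t, 0 <= t -> `|col_mx (xi t) (v t)| <= c) /\
      (loop_error h (col_mx (xi t) (v t)) - o (v t)) @[t --> +oo] --> (0 : 'cV[R]_ny))].
  (* The linear part of the loop, given by [loop_field_diff], is the matrix [A_xi + B_xi K] for
     which the data yield the Lyapunov inequality. *)
  apply: (regulation (loop_field_class K G1 G2 f_smooth h_smooth)
    (loop_field_diff K G1 G2 f_smooth h_smooth) F0 _ pP nA (conj pH HS)).
    by move=> m j; apply: class_C_coord; exact: loop_error_class.
  apply: formal => //.
    by move=> xi1 v1; rewrite /loop_field col_mxKd col_mxKu.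
  by move=> K1 j; apply: taylor; apply: class_C_coord; exact: loop_error_class.
have errorE x z w : loop_error h (col_mx (col_mx x z : 'cV[R]_(nx + nz)) w) = h (x, w).
  by rewrite /loop_error !(col_mxKu, col_mxKd).
have small (x : 'cV[R]_nx) (z : 'cV[R]_nz) : `|x| < delta -> `|z| < delta -> `|col_mx x z| < delta.
  move=> xd zd; apply: (@le_lt_trans _ _ (Num.max `|x| `|z|)); last by rewrite gt_max xd.
  by apply: col_mx_norm_le; rewrite le_max lexx ?orbT.
split.
  exists delta => // x0 z0 v0 xd zd vd; split.
    have [xi1 [w [xi10 w0 cxi fw dxi1]]] := solve _ _ (small _ _ xd zd) vd.
    exists (fun t => usubmx (xi1 t)), (fun t => dsubmx (xi1 t)), w.
    by split; [exact: closed_loop_exists|rewrite xi10 col_mxKu col_mxKd].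
  move=> x z w loop [x_0 z_0 w_0]; have [exi ew] := closed_loop_evolves loop.
  have [] := attract _ _ exi ew; rewrite ?x_0 ?z_0 ?w_0 //; first exact: small.
  move=> [c Hc] _; exists c => t t0; apply: col_mx_norm_le.
    rewrite -(col_mxKu (x t) (z t)); apply: le_trans (usubmx_norm_le _) _.
    rewrite -(col_mxKu (col_mx (x t) (z t)) (w t)); apply: le_trans (usubmx_norm_le _) _.
    exact: Hc.
  rewrite -(col_mxKd (col_mx (x t) (z t)) (w t)); apply: le_trans (dsubmx_norm_le _) _.
  exact: Hc.
exists err; split.
  exists Co; apply/nbhs_ballP; exists ro => //= w; rewrite -ball_normE/= sub0r normrN => wr.
  by have := Ho w (ltW wr); rewrite normr_id.
exists delta => // x z w loop xd zd wd; have [exi ew] := closed_loop_evolves loop.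
have [//|//|_] := attract _ _ exi ew; first exact: small.
by under eq_fun do rewrite errorE.
Qed.
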